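(* Let $A$ be a (unital) commutative associative algebra over $\mathbb{C}$ and let $\mathfrak{g}$ be a Lie superalgebra which acts on $A$ as a Lie superalgebra of derivations. Let $B=(A\otimes\mathfrak{g})\oplus A\partial A$, with the operations given in the context, and let $V_B$ be the associated vertex superalgebra. For any derivation $d:\mathfrak{g}\to A$ there exists a semi-conformal structure on $V_B$, which is uniquely determined by $$L(0)|_A=0,\quad L(0)|_B=1,\quad L(1)|_A=0,\quad L(1)|_{A\partial A}=0,$$ $$L(1)(a\otimes g)=ga+a\,d(g)\quad\text{for } a\in A,\ g\in\mathfrak{g}.$$ Furthermore, $L(1)(V_B)_{(1)}=L(1)B$.
   Context: $A$ is regarded as a purely even superalgebra. The action of $\mathfrak{g}$ on $A$ is a Lie superalgebra homomorphism $\pi:\mathfrak{g}\to{\rm Der}(A)$, and $ga:=\pi(g)(a)$; since $A$ is purely even, odd elements of $\mathfrak{g}$ act as zero. $\varepsilon_{u,v}=(-1)^{|u||v|}$ for homogeneous $u,v$. A derivation from $\mathfrak{g}$ into the $\mathfrak{g}$-module $A$ is an even linear map $d:\mathfrak{g}\to A$ with $d([x,y])=x\,d(y)-y\,d(x)$ for $x,y\in\mathfrak{g}$. $A\partial A$ is the $A$-module of Kähler differentials of $A$ with universal derivation $\partial:A\to A\partial A$. Operations on $B=(A\otimes\mathfrak{g})\oplus A\partial A$, for $a,a',b,b'\in A$, $g,g'\in\mathfrak{g}$: $a*(b\otimes g)=ab\otimes g+(ga)\partial b+(gb)\partial a$ and $a*(a'\partial b)=(aa')\partial b$; $\pi(a\partial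 b)=0$, $\pi(a\otimes g)=a\pi(g)$; $[A\partial A,A\partial A]=0$, $[a'\otimes g',a\partial b]=a'(g'a)\partial b+a\,\partial(a'(g'b))$, $[a\partial b,a'\otimes g']=-a'(g'a)\partial b+a'(g'b)\partial a$, $[a\otimes g,a'\otimes g']=aa'\otimes[g,g']+a(ga')\otimes g'-\varepsilon_{g,g'}a'(g'a)\otimes g$; $\langle\cdot,\cdot\rangle:B\otimes B\to A$ the symmetric pairing with $\langle a\partial b,a'\partial b'\rangle=0$, $\langle a\otimes g,a'\otimes g'\rangle=0$, $\langle a\otimes g,a'\partial b\rangle=\langle a'\partial b,a\otimes g\rangle=aa'(gb)$. On $A\oplus B$ set $a_ia'=0$ ($i=0,1$), $u_0v=[u,v]$, $u_1v=\langle u,v\rangle$, $u_0a=\pi(u)(a)$, $a_0u=-\pi(u)(a)$ for $a,a'\in A$, $u,v\in B$; write $ab=a*b$ for $a\in A$, $b\in B$. Lie superalgebra $\mathcal{L}$: on $L(A\oplus B)=(A\oplus B)\otimes\mathbb{C}[t,t^{-1}]$ put $[a\otimes t^m,a'\otimes t^n]=0$, $[a\otimes t^m,b\otimes t^n]=a_0b\otimes t^{m+n}$, $[b\otimes t^n,a\otimes t^m]=b_0a\otimes t^{m+n}$, $[b\otimes t^m,b'\otimes t^n]=b_0b'\otimes t^{m+n}+m(b_1b')\otimes t^{m+n-1}$ for $a,a'\in A$, $b,b'\in B$. With $\hat\partial=\partial\otimes1+1\otimes d/dt:A\otimes\mathbb{C}[t,t^{-1}]\to L(A\oplus B)$, $\mathcal{L}=L(A\oplus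 B)/\hat\partial(A\otimes\mathbb{C}[t,t^{-1}])$ is a Lie superalgebra, $\mathbb{Z}$-graded by $\deg(a\otimes t^n)=-n-1$, $\deg(b\otimes t^n)=-n$; $u(n)$ is the image of $u\otimes t^n$, and $\mathcal{L}^{\ge0}$ is the span of $u(n)$ with $u\in A\oplus B$, $n\ge0$. $V_{\mathcal{L}}=U(\mathcal{L})\otimes_{U(\mathcal{L}^{\ge0})}\mathbb{C}$ ($\mathbb{C}$ trivial), with $\mathbf{1}=1\otimes1$ of degree $0$, is an $\mathbb{N}$-graded vertex superalgebra with $Y(u(-1)\mathbf{1},x)=\sum_{n\in\mathbb{Z}}u(n)x^{-n-1}$ for $u\in A\oplus B$. In a vertex superalgebra $Y(v,x)=\sum_nv_nx^{-n-1}$ and $\mathcal{D}(v)=v_{-2}\mathbf{1}$. Identify $u\in A\oplus B$ with $u(-1)\mathbf{1}$. With $e$ the identity of $A$, let $E={\rm span}\{e-\mathbf{1},\ a(-1)a'-aa',\ a(-1)b-ab\mid a,a'\in A,b\in B\}$, $I_B=U(\mathcal{L})\mathbb{C}[\mathcal{D}]E$ (a graded ideal), and $V_B=V_{\mathcal{L}}/I_B$, with induced grading $V_B=\bigoplus_{n\in\mathbb{N}}(V_B)_{(n)}$. In the claim, elements of $A$ and $B$ are viewed in $V_B$ through $u\mapsto u(-1)\mathbf{1}$. $Vir^+={\rm span}\{L_m\mid m\ge-1\}$ with $[L_m,L_n]=(m-n)L_{m+n}$; $L(m)$ denotes the operator of $L_m$. A semi-conformal structure on a vertex superalgebra $V$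 is a $Vir^+$-module structure such that $V=\bigoplus_{n\in\mathbb{Z}}V_{(n)}$ with $V_{(n)}=\{v\mid L(0)v=nv\}$, $V_{(-n)}=0$ for $n$ sufficiently large, $L(-1)=\mathcal{D}$ on $V$, and $[L(m),Y(v,x)]=\sum_{i\ge0}\binom{m+1}{i}x^{m+1-i}Y(L(i-1)v,x)$ for integers $m\ge-1$, $v\in V$. *)

(* Defs.v *)
From HB Require Import structures.
From mathcomp Require Import all_boot all_order all_algebra generic_quotient finmap.
From mathcomp Require Import boolp classical_sets reals complex.
From mathcomp.multinomials Require Import monalg.
From mathcomp Require Import ring.

Set Implicit Arguments.
Unset Strict Implicit.
Unset Printing Implicit Defensive.

Import GRing.Theory.
Local Open Scope ring_scope.
Local Open Scope classical_set_scope.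

(** * Linear algebra *)

(* A commutative k-algebra is a commutative ring with a ring morphism from k.
   MathComp's comAlgType would exclude the zero algebra. *)
Record comAlg (k : fieldType) := ComAlg {
  alg_ring : comPzRingType;
  alg_unit : {rmorphism k -> alg_ring} }.

Definition alg_sort (k : fieldType) (A : comAlg k) : Type := alg_ring A.
Coercion alg_sort : comAlg >-> Sortclass.

Section AlgModule.
Variables (k : fieldType) (A : comAlg k).

HB.instance Definition _ := GRing.ComPzRing.on (alg_sort A).

Definition alg_scale (c : k) (a : A) : A := alg_unit A c * (a : alg_ring A).

Lemma alg_scaleA b c a : alg_scale b (alg_scale c a) = alg_scale (b * c) a.
Proof. by rewrite /alg_scale rmorphM mulrA. Qed.
Lemma alg_scale1 : left_id 1 alg_scale.
Proof. by move=> a; rewrite /alg_scale rmorph1; exact: mul1r. Qed.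
Lemma alg_scaleDr : right_distributive alg_scale +%R.
Proof. by move=> c a b; rewrite /alg_scale -mulrDr. Qed.
Lemma alg_scaleDl a : {morph alg_scale^~ a : b c / b + c}.
Proof. by move=> b c; rewrite /alg_scale rmorphD mulrDl. Qed.

HB.instance Definition _ := GRing.Zmodule_isLmodule.Build k (alg_sort A)
  alg_scaleA alg_scale1 alg_scaleDr alg_scaleDl.

Lemma alg_scaleAl c (a b : A) : c *: (a * b) = (c *: a) * b.
Proof. exact: mulrA. Qed.

End AlgModule.

Section Span.
Variables (k : fieldType) (V : lmodType k).

Definition submodule (W : set V) : Prop :=
  W 0 /\ forall (c : k) x y, W x -> W y -> W (c *: x + y).

Definition lspan (S : set V) : set V := smallest submodule S.

Lemma lspan_submodule S : submodule (lspan S).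
Proof.
split=> [W [[W0 _] _] //|c x y Sx Sy W WS].
by case: (WS) => -[_ WZ] _; apply: WZ; [exact: Sx|exact: Sy].
Qed.

Lemma sub_lspan S : S `<=` lspan S.
Proof. by move=> x Sx W [_]; apply. Qed.

Lemma lspan_min S W : submodule W -> S `<=` W -> lspan S `<=` W.
Proof. by move=> sW SW x; apply. Qed.

Lemma lspan0 S : lspan S 0. Proof. by case: (lspan_submodule S). Qed.

Lemma lspanZ S c x : lspan S x -> lspan S (c *: x).
Proof.
move=> Sx; rewrite -[_ *: _]addr0.
by apply: (lspan_submodule S).2 => //; exact: lspan0.
Qed.

Lemma lspanD S x y : lspan S x -> lspan S y -> lspan S (x + y).
Proof. by move=> Sx Sy; rewrite -[x]scale1r; apply: (lspan_submodule S).2. Qed.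

Lemma lspanN S x : lspan S x -> lspan S (- x).
Proof. by rewrite -scaleN1r; exact: lspanZ. Qed.

Lemma lspanB S x y : lspan S x -> lspan S y -> lspan S (x - y).
Proof. by move=> Sx Sy; apply: lspanD => //; exact: lspanN. Qed.

Definition direct_sum (I : eqType) (F : I -> set V) : Prop :=
  [/\ forall i, submodule (F i),
      forall v, exists (s : seq I) (f : I -> V),
        (forall i, F i (f i)) /\ v = \sum_(i <- s) f i
    & forall (s : seq I) (f : I -> V), uniq s -> (forall i, F i (f i)) ->
        \sum_(i <- s) f i = 0 -> forall i, i \in s -> f i = 0].

End Span.

(* V / lspan S *)
Section Quotient.
Variables (k : fieldType) (V : lmodType k) (S : set V).

Definition quo_eq (x y : V) : bool := `[< lspan S (x - y) >].

Lemma quo_eq_refl : reflexive quo_eq.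
Proof. by move=> x; apply/asboolP; rewrite subrr; exact: lspan0. Qed.

Lemma quo_eq_sym : symmetric quo_eq.
Proof.
by move=> x y; apply/asboolP/asboolP => /lspanN; rewrite opprB.
Qed.

Lemma quo_eq_trans : transitive quo_eq.
Proof.
move=> y x z /asboolP xy /asboolP yz; apply/asboolP.
by rewrite -(subrKA y); exact: lspanD.
Qed.

Canonical quo_eq_equiv := EquivRel quo_eq quo_eq_refl quo_eq_sym quo_eq_trans.

Definition quo := {eq_quot quo_eq_equiv}%qT.
HB.instance Definition _ := Choice.on quo.

End Quotient.

(* Locking keeps conversion from unfolding towers of quotients. *)
HB.lock Definition quo_pi (k : fieldType) (V : lmodType k) (S : set V) (x : V) : quo S :=
  (\pi_({eq_quot (quo_eq_equiv S)}) x)%qT.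
HB.lock Definition quo_repr (k : fieldType) (V : lmodType k) (S : set V) (x : quo S) : V :=
  repr x.
HB.lock Definition quo_add (k : fieldType) (V : lmodType k) (S : set V) (x y : quo S) :
  quo S := quo_pi S (quo_repr x + quo_repr y).
HB.lock Definition quo_opp (k : fieldType) (V : lmodType k) (S : set V) (x : quo S) :
  quo S := quo_pi S (- quo_repr x).
HB.lock Definition quo_scale (k : fieldType) (V : lmodType k) (S : set V) (c : k)
  (x : quo S) : quo S := quo_pi S (c *: quo_repr x).

Section QuotientModule.
Variables (k : fieldType) (V : lmodType k) (S : set V).
Local Notation quo := (quo S).
Local Notation quo_pi := (quo_pi S).
Local Notation quo_repr := (@quo_repr k V S).
Local Notation quo_add := (@quo_add k V S).
Local Notation quo_opp := (@quo_opp k V S).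
Local Notation quo_scale := (@quo_scale k V S).

Lemma quo_reprK x : quo_pi (quo_repr x) = x.
Proof. by rewrite quo_pi.unlock quo_repr.unlock; exact: reprK. Qed.

Lemma quo_piP x y : quo_pi x = quo_pi y <-> lspan S (x - y).
Proof.
rewrite quo_pi.unlock; split=> [xy|xy].
  by have /eqquotP/asboolP : (x = y %[mod {eq_quot (quo_eq_equiv S)}])%qT := xy.
by apply/eqquotP/asboolP.
Qed.

Lemma quo_repr_pi x : lspan S (quo_repr (quo_pi x) - x).
Proof. by apply/quo_piP; rewrite quo_reprK. Qed.

Lemma quo_addE x y : quo_add (quo_pi x) (quo_pi y) = quo_pi (x + y).
Proof. by rewrite quo_add.unlock; apply/quo_piP; rewrite opprD addrACA; apply: lspanD; apply: quo_repr_pi. Qed.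

Lemma quo_oppE x : quo_opp (quo_pi x) = quo_pi (- x).
Proof. by rewrite quo_opp.unlock; apply/quo_piP; rewrite -opprD; apply: lspanN; exact: quo_repr_pi. Qed.

Lemma quo_scaleE c x : quo_scale c (quo_pi x) = quo_pi (c *: x).
Proof. by rewrite quo_scale.unlock; apply/quo_piP; rewrite -scalerBr; apply: lspanZ; exact: quo_repr_pi. Qed.

Lemma quo_ind (P : quo -> Prop) : (forall x, P (quo_pi x)) -> forall x, P x.
Proof. by move=> h x; rewrite -(quo_reprK x). Qed.

Lemma quo_addA : associative quo_add.
Proof.
by elim/quo_ind=> x; elim/quo_ind=> y; elim/quo_ind=> z; rewrite !quo_addE addrA.
Qed.
Lemma quo_addC : commutative quo_add.
Proof. by elim/quo_ind=> x; elim/quo_ind=> y; rewrite !quo_addE addrC. Qed.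
Lemma quo_add0 : left_id (quo_pi 0) quo_add.
Proof. by elim/quo_ind=> x; rewrite !quo_addE add0r. Qed.
Lemma quo_addN : left_inverse (quo_pi 0) quo_opp quo_add.
Proof. by elim/quo_ind=> x; rewrite quo_oppE quo_addE addNr. Qed.

HB.instance Definition _ :=
  GRing.isZmodule.Build quo quo_addA quo_addC quo_add0 quo_addN.

Lemma quo_scaleA a b x : quo_scale a (quo_scale b x) = quo_scale (a * b) x.
Proof. by elim/quo_ind: x => x; rewrite !quo_scaleE scalerA. Qed.
Lemma quo_scale1 : left_id 1 quo_scale.
Proof. by elim/quo_ind=> x; rewrite quo_scaleE scale1r. Qed.
Lemma quo_scaleDr : right_distributive quo_scale quo_add.
Proof.
by move=> a; elim/quo_ind=> x; elim/quo_ind=> y; rewrite !(quo_scaleE, quo_addE)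
  scalerDr.
Qed.
Lemma quo_scaleDl x : {morph quo_scale^~ x : a b / a + b >-> quo_add a b}.
Proof. by elim/quo_ind: x => x a b; rewrite !quo_scaleE quo_addE scalerDl. Qed.

HB.instance Definition _ := GRing.Zmodule_isLmodule.Build k quo
  quo_scaleA quo_scale1 quo_scaleDr quo_scaleDl.

Lemma quo_pi_is_linear : linear quo_pi.
Proof. by move=> c x y; rewrite -quo_addE -quo_scaleE. Qed.

HB.instance Definition _ := GRing.isLinear.Build k V quo *:%R quo_pi quo_pi_is_linear.

Lemma quo_pi0 x : quo_pi x = 0 <-> lspan S x.
Proof. by rewrite -[0](linear0 quo_pi) quo_piP subr0. Qed.

(* The map induced on the quotient by f, meaningful when f is linear and kills S. *)
Definition quo_lift (W : lmodType k) (f : V -> W) (x : quo) : W := f (quo_repr x).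

Lemma quo_liftE (W : lmodType k) (f : V -> W) x :
  linear f -> (forall s, S s -> f s = 0) -> quo_lift f (quo_pi x) = f x.
Proof.
move=> lf fS.
pose M := GRing.isLinear.Build k V W *:%R f lf.
pose f' : {linear V -> W} := HB.pack f M.
apply/eqP; rewrite -subr_eq0 /quo_lift -[f]/(f' : V -> W) -linearB /=.
apply/eqP; have := quo_repr_pi x; move: (_ - _).
apply: lspan_min => //; split; first exact: (linear0 f').
by move=> c u v fu fv; rewrite lf fu fv scaler0 addr0.
Qed.

Lemma quo_lift_linear (W : lmodType k) (f : V -> W) :
  linear f -> (forall s, S s -> f s = 0) -> linear (quo_lift f).
Proof.
move=> lf fS c; elim/quo_ind=> x; elim/quo_ind=> y.
by rewrite -linearP !quo_liftE // lf.
Qed.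

End QuotientModule.

(* The linear extension to {malg k[K]} of a function on the basis K. *)
Section FreeLift.
Variables (k : fieldType) (K : choiceType) (W : lmodType k).

Definition free_lift (f : K -> W) (x : {malg k[K]}) : W :=
  \sum_(i <- msupp x) x@_i *: f i.

Lemma free_liftEw f (x : {malg k[K]}) (d : {fset K}) :
  fsubset (msupp x) d -> free_lift f x = \sum_(i <- d) x@_i *: f i.
Proof.
move=> sxd; rewrite /free_lift (big_fset_incl _ sxd) //= => i _ /mcoeff_outdom ->.
by rewrite scale0r.
Qed.

Lemma free_lift_linear f : linear (free_lift f).
Proof.
move=> c x y; pose d := fsetU (msupp (c *: x + y)) (fsetU (msupp x) (msupp y)).
rewrite !(@free_liftEw _ _ d) /d; last 3 first.
- by rewrite fsubsetU // fsubsetUr orbT.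
- by rewrite fsubsetU // fsubsetUl orbT.
- exact: fsubsetUl.
rewrite scaler_sumr -big_split; apply: eq_bigr => i _ /=.
by rewrite mcoeffD mcoeffZ scalerDl scalerA.
Qed.

Lemma free_liftU f i : free_lift f << i >> = f i.
Proof.
rewrite (@free_liftEw _ _ (fset1 i)); last exact: msuppU_le.
by rewrite big_seq_fset1 mcoeffUU scale1r.
Qed.

End FreeLift.

Section Bilinear.
Variables (k : fieldType) (M N P : lmodType k).
Definition bilin (f : M -> N -> P) : Prop :=
  (forall n, linear (f^~ n)) /\ (forall m, linear (f m)).
End Bilinear.

(** * Tensor products over the base field *)
Section Tensor.
Variables (k : fieldType) (M N : lmodType k).

Local Notation F := {malg k[(M * N)%type]}.

Definition tens_rel : set F :=
  [set r | exists (c : k) (m m' : M) (n : N),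
     r = << (c *: m + m', n) >> - (c *: << (m, n) >> + << (m', n) >>)]
  `|` [set r | exists (c : k) (m : M) (n n' : N),
     r = << (m, c *: n + n') >> - (c *: << (m, n) >> + << (m, n') >>)].

Definition tens := quo tens_rel.
HB.instance Definition _ := GRing.Lmodule.on tens.

Definition tpure (m : M) (n : N) : tens := quo_pi tens_rel << (m, n) >>.

(* The linear map m (x) n |-> f m n, meaningful when f is bilinear. *)
Definition tlift (P : lmodType k) (f : M -> N -> P) : tens -> P :=
  quo_lift (free_lift (fun mn : M * N => f mn.1 mn.2)).

Lemma tpure_bilin : bilin tpure.
Proof.
split=> [n c m m'|m c n n'].
  rewrite /tpure -linearP; apply/quo_piP; apply: sub_lspan; rewrite /tens_rel /setU /mkset; left.
  by exists c, m, m', n.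
rewrite /tpure -linearP; apply/quo_piP; apply: sub_lspan; rewrite /tens_rel /setU /mkset; right.
by exists c, m, n, n'.
Qed.

Section Lift.
Variables (P : lmodType k) (f : M -> N -> P).
Hypothesis bf : bilin f.

Let f_rel r : tens_rel r -> free_lift (fun mn : M * N => f mn.1 mn.2) r = 0.
Proof.
have lfl := free_lift_linear (fun mn : M * N => f mn.1 mn.2).
have flB x y : free_lift (fun mn : M * N => f mn.1 mn.2) (x - y) =
   free_lift (fun mn : M * N => f mn.1 mn.2) x - free_lift (fun mn : M * N => f mn.1 mn.2) y.
  by rewrite addrC -[- y]scaleN1r lfl scaleN1r addrC.
rewrite /tens_rel /setU /mkset => -[] [c [m [x [y ->]]]];
  rewrite flB lfl !free_liftU /=.
  by rewrite bf.1 subrr.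
by rewrite bf.2 subrr.
Qed.

Lemma tliftE m n : tlift f (tpure m n) = f m n.
Proof. by rewrite /tlift quo_liftE ?free_liftU //; exact: free_lift_linear. Qed.

Lemma tlift_linear : linear (tlift f).
Proof. by apply: quo_lift_linear => //; exact: free_lift_linear. Qed.

End Lift.

Lemma tlift_pt (P : lmodType k) c (f g : M -> N -> P) x :
  tlift (fun m n => c *: f m n + g m n) x = c *: tlift f x + tlift g x.
Proof.
rewrite /tlift /quo_lift /free_lift scaler_sumr -big_split; apply: eq_bigr => i _ /=.
by rewrite scalerDr !scalerA mulrC.
Qed.

Lemma tens_span (W : set tens) : submodule W -> (forall m n, W (tpure m n)) ->
  forall x, W x.
Proof.
move=> [W0 WZ] Wp; elim/quo_ind=> x; rewrite [x]monalgE linear_sum /=.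
elim/big_rec: _ => //= i y _ Wy.
have -> : << x@_i *g i >> = x@_i *: << i >> :> F.
  by apply/malgP => j; rewrite mcoeffZ !mcoeffU mulrnAr mulr1.
by rewrite linearZ /=; apply: WZ => //; case: i => m n; exact: Wp.
Qed.

Lemma tens_ext (P : lmodType k) (f g : tens -> P) : linear f -> linear g ->
  (forall m n, f (tpure m n) = g (tpure m n)) -> f =1 g.
Proof.
move=> lf lg fg; apply: tens_span => //; split.
  have z h : linear h -> h (0 : tens) = 0 :> P.
    by move=> lh; have := lh (-1) 0 0; rewrite scaleN1r addNr scaleN1r addNr.
  by rewrite !z.
by move=> c x y ex ey; rewrite lf lg ex ey.
Qed.

End Tensor.

(** * Lie superalgebras acting on a commutative algebra *)

Record lieSuper (k : fieldType) := LieSuper {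
  lie_sort :> lmodType k;
  lie_par : bool -> set lie_sort;
  lie_br : lie_sort -> lie_sort -> lie_sort;
  lie_direct_sum : direct_sum lie_par;
  lie_br_bilin : bilin lie_br;
  lie_br_par : forall p q x y, lie_par p x -> lie_par q y ->
    lie_par (p (+) q) (lie_br x y);
  lie_skew : forall p q x y, lie_par p x -> lie_par q y ->
    lie_br x y = - ((-1) ^+ (p && q) *: lie_br y x);
  lie_jacobi : forall p q x y z, lie_par p x -> lie_par q y ->
    lie_br x (lie_br y z) =
      lie_br (lie_br x y) z + (-1) ^+ (p && q) *: lie_br y (lie_br x z) }.

(* An action of g on the purely even algebra A by superderivations. *)
Record lieAction (k : fieldType) (g : lieSuper k) (A : comAlg k) := LieAction {
  lie_act :> g -> A -> A;
  lie_act_bilin : bilin lie_act;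
  lie_act_der : forall x a b, lie_act x (a * b) = lie_act x a * b + a * lie_act x b;
  lie_act_odd : forall x a, lie_par true x -> lie_act x a = 0;
  lie_act_br : forall p q x y a, lie_par p x -> lie_par q y ->
    lie_act (lie_br x y) a =
      lie_act x (lie_act y a) - (-1) ^+ (p && q) *: lie_act y (lie_act x a) }.

Record lie_derivation (k : fieldType) (g : lieSuper k) (A : comAlg k)
    (act : lieAction g A) (d : g -> A) : Prop := LieDerivation {
  lie_der_linear : linear d;
  lie_der_even : forall x, lie_par true x -> d x = 0;
  lie_der_br : forall x y, d (lie_br x y) = act x (d y) - act y (d x) }.

(* The homogeneous component of x of parity p. *)
Definition lie_comp (k : fieldType) (g : lieSuper k) (p : bool) (x : g) : g :=
  xget 0 [set y | lie_par p y /\ lie_par (~~ p) (x - y)].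

(** * Kaehler differentials *)
Section Kaehler.
Variables (k : fieldType) (A : comAlg k).

(* a (x) b stands for a d(b) *)
Definition kaehler_rel : set (tens A A) :=
  [set r | exists a b c : A,
    r = tpure a (b * c) - (tpure (a * b) c + tpure (a * c) b)].

Definition kaehler := quo kaehler_rel.
HB.instance Definition _ := GRing.Lmodule.on kaehler.

Definition kd (a b : A) : kaehler := quo_pi kaehler_rel (tpure a b).

(* The linear map a d(b) |-> f a b, meaningful when f is bilinear and
   f a (b * c) = f (a * b) c + f (a * c) b. *)
Definition kaehler_lift (P : lmodType k) (f : A -> A -> P) : kaehler -> P :=
  quo_lift (tlift f).

End Kaehler.

(** * The operations on A (+) B *)
Section OpsB.
Variables (k : fieldType) (A : comAlg k) (g : lieSuper k) (act : lieAction g A).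

Definition Bmod : Type := (tens A g * kaehler A)%type.
HB.instance Definition _ := GRing.Lmodule.on Bmod.

Definition inAg (x : tens A g) : Bmod := (x, 0).
Definition inKd (w : kaehler A) : Bmod := (0, w).

(* a * b *)
Definition star (a : A) (b : Bmod) : Bmod :=
  tlift (fun (a' : A) x => inAg (tpure (a * a') x) + inKd (kd (act x a) a' + kd (act x a') a)) b.1
  + inKd (kaehler_lift (fun a' c : A => kd (a * a') c) b.2).

(* pi(b)(c) *)
Definition anchor (b : Bmod) (c : A) : A := tlift (fun (a : A) x => a * act x c) b.1.

Definition br_gg (u v : tens A g) : tens A g :=
  tlift (fun (a : A) x => tlift (fun (a' : A) x' =>
    tpure (a * a') (lie_br x x') + tpure (a * act x a') x'
    - \sum_(p : bool) \sum_(q : bool) (-1) ^+ (p && q) *: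
        tpure (a' * act (lie_comp q x') a) (lie_comp p x)) v) u.

Definition br_gk (u : tens A g) (w : kaehler A) : kaehler A :=
  tlift (fun (a' : A) x => kaehler_lift (fun a b : A =>
    kd (a' * act x a) b + kd a (a' * act x b)) w) u.

Definition br_kg (w : kaehler A) (u : tens A g) : kaehler A :=
  tlift (fun (a' : A) x => kaehler_lift (fun a b : A =>
    - kd (a' * act x a) b + kd (a' * act x b) a) w) u.

Definition br (b b' : Bmod) : Bmod :=
  (br_gg b.1 b'.1, br_gk b.1 b'.2 + br_kg b.2 b'.1).

Definition pair_gk (u : tens A g) (w : kaehler A) : A :=
  tlift (fun (a : A) x => kaehler_lift (fun a' b : A => a * a' * act x b) w) u.

Definition pairing (b b' : Bmod) : A := pair_gk b.1 b'.2 + pair_gk b'.1 b.2.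

Definition AB : Type := (A * Bmod)%type.
HB.instance Definition _ := GRing.Lmodule.on AB.

Definition inA (a : A) : AB := (a, 0).
Definition inB (b : Bmod) : AB := (0, b).

(* u_0 v and u_1 v *)
Definition prod0 (u v : AB) : AB := (anchor u.2 v.1 - anchor v.2 u.1, br u.2 v.2).
Definition prod1 (u v : AB) : AB := inA (pairing u.2 v.2).

Definition AB_par (p : bool) : set AB := lspan (
  [set u | ~~ p /\ exists a, u = inA a]
  `|` [set u | exists a (x : g), lie_par p x /\ u = inB (inAg (tpure a x))]
  `|` [set u | ~~ p /\ exists w, u = inB (inKd w)]).

End OpsB.

(** * The Lie superalgebra of modes *)
Section Modes.
Variables (k : fieldType) (A : comAlg k) (g : lieSuper k) (act : lieAction g A).

(* t ^ n is << n >> *)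
Definition laurent : Type := {malg k[int]}.
HB.instance Definition _ := GRing.Lmodule.on laurent.

Definition tpow (n : int) : laurent := << n >>.
Definition ddt : laurent -> laurent := free_lift (fun n => n%:~R *: tpow (n - 1)).

Definition loopAB := tens (AB A g) laurent.
HB.instance Definition _ := GRing.Lmodule.on loopAB.

Definition dhat : tens A laurent -> loopAB :=
  tlift (fun (a : A) (p : laurent) => tpure (inB (inKd g (kd 1 a))) p + tpure (inA g a) (ddt p)).

Definition loop_br (x y : loopAB) : loopAB :=
  tlift (fun u (p : laurent) => tlift (fun v (q : laurent) =>
    free_lift (fun m => free_lift (fun n =>
      tpure (prod0 act u v) (tpow (m + n))
      + m%:~R *: tpure (prod1 act u v) (tpow (m + n - 1))) q) p) y) x.

Definition calL := quo (range dhat).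
HB.instance Definition _ := GRing.Lmodule.on calL.

Definition mode (u : AB A g) (n : int) : calL := quo_pi (range dhat) (tpure u (tpow n)).

Definition calL_br (x y : calL) : calL :=
  quo_pi (range dhat) (loop_br (quo_repr x) (quo_repr y)).

Definition calL_par (p : bool) : set calL :=
  lspan [set x | exists u n, AB_par p u /\ x = mode u n].

Definition calL_deg (d : int) : set calL :=
  lspan ([set x | exists a n, - n - 1 = d /\ x = mode (inA g a) n]
    `|` [set x | exists b n, - n = d /\ x = mode (inB b) n]).

Definition calL_nonneg : set calL :=
  lspan [set x | exists u (n : int), 0 <= n /\ x = mode u n].

End Modes.

(** * Universal enveloping algebras and induced modules *)

(* The free associative algebra on the set X. *)
Section FreeAlgebra.
Variables (k : fieldType) (X : choiceType).

Definition freealg : Type := {malg k[fmonom X]}.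
HB.instance Definition _ := GRing.NzRing.on freealg.
HB.instance Definition _ := GRing.Lmodule.on freealg.

Let msuppZ (c : k) (x : freealg) : (msupp (c *: x) `<=` msupp x)%fset.
Proof.
apply/fsubsetP => i; rewrite -!mcoeff_neq0 mcoeffZ.
by apply: contra_neq => ->; rewrite mulr0.
Qed.

Lemma free_scaleAr (c : k) (a x : freealg) : a * (c *: x) = c *: (a * x).
Proof.
rewrite (malgMEw (fsubset_refl _) (msuppZ c x)) malgME scaler_sumr.
apply: eq_bigr => i _; rewrite scaler_sumr; apply: eq_bigr => j _.
by apply/malgP => w; rewrite !(mcoeffZ, mcoeffU) mulrnAr mulrCA.
Qed.

Lemma free_scaleAl (c : k) (a x : freealg) : (c *: a) * x = c *: (a * x).
Proof.
rewrite (malgMEw (msuppZ c a) (fsubset_refl _)) malgME scaler_sumr.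
apply: eq_bigr => i _; rewrite scaler_sumr; apply: eq_bigr => j _.
by apply/malgP => w; rewrite !(mcoeffZ, mcoeffU) mulrnAr mulrA.
Qed.

End FreeAlgebra.

Section Enveloping.
Variables (k : fieldType) (L : lmodType k) (par : bool -> set L) (br : L -> L -> L).

Local Notation F := (freealg k L).
Definition letter (x : L) : F := << fmu x >>.

Definition env_rel : set F :=
  [set r | exists (c : k) (x y : L), r = letter (c *: x + y) - (c *: letter x + letter y)]
  `|` [set r | exists p q (x y : L), [/\ par p x, par q y
      & r = letter x * letter y - (-1) ^+ (p && q) *: (letter y * letter x)
            - letter (br x y)]].

Definition env_ideal : set F := [set z | exists a r b : F, env_rel r /\ z = a * r * b].

Definition env := quo env_ideal.
HB.instance Definition _ := GRing.Lmodule.on env.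

Definition env_pi : F -> env := quo_pi env_ideal.

Lemma env_ideal_mul (a x b : F) : lspan env_ideal x -> lspan env_ideal (a * x * b).
Proof.
move: x; apply: (@lspan_min _ _ _ (fun x => lspan env_ideal (a * x * b))).
  split=> [|c x y ix iy]; first by rewrite mulr0 mul0r; exact: lspan0.
  rewrite mulrDr mulrDl free_scaleAr free_scaleAl.
  by apply: lspanD; first exact: lspanZ.
move=> x [a' [r [b' [rr ->]]]]; apply: sub_lspan.
exists (a * a'), r, (b' * b); split; first exact: rr.
by rewrite !mulrA.
Qed.

Definition env_one : env := env_pi 1.
Definition env_mul (x y : env) : env := env_pi (quo_repr x * quo_repr y).

Lemma env_mulE (x y : F) : env_mul (env_pi x) (env_pi y) = env_pi (x * y).
Proof.
apply/quo_piP; set x' := quo_repr _; set y' := quo_repr _.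
have -> : x' * y' - x * y = 1 * (x' - x) * y' + x * (y' - y) * 1.
  by rewrite mul1r mulr1 mulrBl mulrBr addrA subrK.
by apply: lspanD; apply: env_ideal_mul; exact: quo_repr_pi.
Qed.

Lemma env_ind (P : env -> Prop) : (forall x : F, P (env_pi x)) -> forall x, P x.
Proof. exact: quo_ind. Qed.

Lemma env_piD (x y : F) : env_pi (x + y) = env_pi x + env_pi y.
Proof. exact: linearD. Qed.

Lemma env_mulA : associative env_mul.
Proof.
by elim/env_ind=> x; elim/env_ind=> y; elim/env_ind=> z; rewrite !env_mulE mulrA.
Qed.
Lemma env_mul1 : left_id env_one env_mul.
Proof. by elim/env_ind=> x; rewrite env_mulE mul1r. Qed.
Lemma env_mulr1 : right_id env_one env_mul.
Proof. by elim/env_ind=> x; rewrite env_mulE mulr1. Qed.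
Lemma env_mulDl : left_distributive env_mul +%R.
Proof.
elim/env_ind=> x; elim/env_ind=> y; elim/env_ind=> z.
by rewrite -env_piD !env_mulE -env_piD mulrDl.
Qed.
Lemma env_mulDr : right_distributive env_mul +%R.
Proof.
elim/env_ind=> x; elim/env_ind=> y; elim/env_ind=> z.
by rewrite -env_piD !env_mulE -env_piD mulrDr.
Qed.

HB.instance Definition _ := GRing.Zmodule_isPzRing.Build env
  env_mulA env_mul1 env_mulr1 env_mulDl env_mulDr.

Definition env_in (x : L) : env := env_pi (letter x).

(* U(L) (x)_{U(H)} k for the trivial U(H)-module k.  As H generates U(H), the
   balancing relations are (u h) (x) c = u (x) (h . c) with h in H, where h . c = 0. *)
Variable H : set L.

Definition ind_rel : set (tens env k^o) :=
  [set r | exists (u : env) (h : L) (c : k^o), H h /\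
     r = tpure (u * env_in h) c - tpure u 0].

Definition ind := quo ind_rel.
HB.instance Definition _ := GRing.Lmodule.on ind.

Definition ind_pure (u : env) (c : k) : ind := quo_pi ind_rel (tpure u (c : k^o)).
Definition ind_one : ind := ind_pure 1 1.

(* The action of U(L) : u . (u' (x) c) = (u u') (x) c *)
Definition ind_act (u : env) : ind -> ind :=
  quo_lift (tlift (fun (u' : env) (c : k^o) => ind_pure (u * u') c)).

End Enveloping.

(** * Vertex superalgebras *)

Definition zbin (k : fieldType) (m : int) (i : nat) : k :=
  (\prod_(j < i) (m%:~R - j%:R)) / (i`!)%:R.

Section Vertex.
Variables (k : fieldType) (V : lmodType k).

(* Y u n v is u_n v.  In the Borcherds identity, which is the component form of
   the Jacobi identity, the three sums are finite by truncation: N bounds them. *)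
Record vertex_superalgebra (par : bool -> set V) (one : V)
    (Y : V -> int -> V -> V) : Prop := VertexSuperalgebra {
  vx_direct_sum : direct_sum par;
  vx_bilin : forall n, bilin (fun u v => Y u n v);
  vx_par : forall p q u n v, par p u -> par q v -> par (p (+) q) (Y u n v);
  vx_trunc : forall u v, exists N : int, forall n, N <= n -> Y u n v = 0;
  vx_one_par : par false one;
  vx_one : forall n v, Y one n v = if n == -1 then v else 0;
  vx_creation : forall v, Y v (-1) one = v;
  vx_creation0 : forall v (n : int), 0 <= n -> Y v n one = 0;
  vx_borcherds : forall p q u v w (l m n : int), par p u -> par q v ->
    exists N0 : nat, forall N : nat, (N0 <= N)%N ->
      \sum_(i < N) zbin k m i *: Y (Y u (l + i%:Z) v) (m + n - i%:Z) w =
      \sum_(i < N) ((-1) ^+ i * zbin k l i) *: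
        (Y u (m + l - i%:Z) (Y v (n + i%:Z) w)
         - ((-1) ^ l * (-1) ^+ (p && q)) *: Y v (n + l - i%:Z) (Y u (m + i%:Z) w)) }.

Variables (one : V) (Y : V -> int -> V -> V).

Definition Dop (v : V) : V := Y v (-2) one.

Definition L_weight (L : int -> {linear V -> V}) (n : int) : set V :=
  [set v | L 0 v = n%:~R *: v].

(* L m is only constrained for -1 <= m. *)
Record semi_conformal (L : int -> {linear V -> V}) : Prop := SemiConformal {
  sc_vir : forall m n : int, -1 <= m -> -1 <= n ->
    forall v, L m (L n v) - L n (L m v) = (m - n)%:~R *: L (m + n) v;
  sc_direct_sum : direct_sum (L_weight L);
  sc_bounded : exists N : int, forall n : int, N <= n -> L_weight L (- n) `<=` [set 0];
  sc_D : forall v, L (-1) v = Dop v;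
  sc_comm : forall m n : int, -1 <= m -> forall v w,
    L m (Y v n w) - Y v n (L m w) =
    \sum_(i < (absz (m + 1)).+1)
      zbin k (m + 1) i *: Y (L (i%:Z - 1) v) (n + m + 1 - i%:Z) w }.

End Vertex.

(** * V_L and V_B *)
Section VL.
Variables (k : fieldType) (A : comAlg k) (g : lieSuper k) (act : lieAction g A).

Definition VL : Type := ind (@calL_par k A g) (calL_br act) (@calL_nonneg k A g).
HB.instance Definition _ := GRing.Lmodule.on VL.

Definition UL : Type := env (@calL_par k A g) (calL_br act).
Definition UL_act (u : UL) (v : VL) : VL := ind_act u v.
Definition VL_act (x : calL A g) : VL -> VL := UL_act (env_in _ _ x).
Definition VL_one : VL := ind_one _ _ _.

(* u(-1) 1 *)
Definition VL_in (u : AB A g) : VL := VL_act (mode u (-1)) VL_one.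

(* The span of the x_1 ... x_r 1 with x_j in F i_j and i_1 + ... + i_r = i. *)
Definition word_grading (I : eqType) (add : I -> I -> I) (zero : I)
    (F : I -> set (calL A g)) (i : I) : set VL :=
  lspan [set v | exists s : seq (I * calL A g),
    [/\ forall x, x \in s -> F x.1 x.2, foldr (fun x => add x.1) zero s = i
      & v = foldr (fun x => VL_act x.2) VL_one s]].

Definition VL_par : bool -> set VL := word_grading addb false (@calL_par k A g).
Definition VL_deg : int -> set VL := word_grading +%R 0 (@calL_deg k A g).

(* The vertex superalgebra structure of V_L; it is unique. *)
Definition VL_vertex (Y : VL -> int -> VL -> VL) : Prop :=
  vertex_superalgebra VL_par VL_one Y /\
  forall u n v, Y (VL_in u) n v = VL_act (mode u n) v.

Variable Y : VL -> int -> VL -> VL.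

Definition E_B : set VL :=
  [set VL_in (inA g 1) - VL_one]
  `|` [set v | exists a a' : A,
        v = VL_act (mode (inA g a) (-1)) (VL_in (inA g a')) - VL_in (inA g (a * a'))]
  `|` [set v | exists (a : A) (b : Bmod A g),
        v = VL_act (mode (inA g a) (-1)) (VL_in (inB b)) - VL_in (inB (star act a b))].

(* I_B is the span of this set. *)
Definition I_B : set VL :=
  [set v | exists (u : UL) (j : nat) (e : VL),
    E_B e /\ v = UL_act u (iter j (Dop VL_one Y) e)].

Definition VB : Type := quo I_B.
HB.instance Definition _ := GRing.Lmodule.on VB.

Definition VB_pi : VL -> VB := quo_pi I_B.
Definition VB_one : VB := VB_pi VL_one.
(* The structure induced by Y on the quotient by the ideal I_B. *)
Definition VB_Y (u : VB) (n : int) (v : VB) : VB :=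
  VB_pi (Y (quo_repr u) n (quo_repr v)).
Definition VB_deg (n : int) : set VB := VB_pi @` VL_deg n.

Definition VB_inA (a : A) : VB := VB_pi (VL_in (inA g a)).
Definition VB_inB (b : Bmod A g) : VB := VB_pi (VL_in (inB b)).

Record L_conditions (d : g -> A) (L : int -> {linear VB -> VB}) : Prop := LConditions {
  L0_A : forall a, L 0 (VB_inA a) = 0;
  L0_B : forall b, L 0 (VB_inB b) = VB_inB b;
  L1_A : forall a, L 1 (VB_inA a) = 0;
  L1_Kd : forall w, L 1 (VB_inB (inKd g w)) = 0;
  L1_Ag : forall (a : A) (x : g),
    L 1 (VB_inB (inAg (tpure a x))) = VB_inA (act x a + a * d x) }.

End VL.

Arguments VB {k A g act} Y.
Arguments VB_one {k A g act} Y.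
Arguments VB_Y {k A g act} Y u n v.
Arguments VB_deg {k A g act} Y n _.
Arguments VB_inA {k A g act} Y a.
Arguments VB_inB {k A g act} Y b.

(* Main.v *)
(* The commutator formula forces [L(m), a(n)] = -(n+m+1) a(n+m) and
   [L(m), b(n)] = -n b(n+m) + C(m+1, 2) (L(1)b)(n+m-1).  These formulas define derivations T_m
   of the Lie superalgebra of modes satisfying the Virasoro relations; the derivation property
   is the identity L(1)[b, b'] = b (L(1)b') - b' (L(1)b), which is where d being a derivation
   enters.  For m >= -1, T_m preserves the modes of nonnegative index, so it induces an
   operator L(m) on V_L that kills the vacuum.  The commutator formula then propagates from A
   and B to all of V_L, because it is stable under all products u_n v; and L(m) preserves I_B
   because L(1)(a b) = b(a) + a L(1)b.
   V_L is spanned by words in modes of negative index, so its weights are nonnegative; this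
   gives uniqueness, as L(m) lowers weights by m.  In weight 1 such a word contains exactly one
   letter of degree 1, either b(-1) or a(-2) = (da)(-1), hence lies in B modulo I_B. *)
Require Import Defs.
From HB Require Import structures.
From mathcomp Require Import all_boot all_order all_algebra.
From mathcomp Require Import boolp classical_sets reals complex.
From mathcomp.multinomials Require Import monalg.
From mathcomp Require Import ring zify.

Set Implicit Arguments.
Unset Strict Implicit.
Unset Printing Implicit Defensive.

Import Order.TTheory GRing.Theory Num.Theory.
Local Open Scope ring_scope.
Local Open Scope classical_set_scope.

(** * Linear maps and submodules *)

(** The Borcherds identity is available for homogeneous vectors only, so every propagation argument
    carries parities along. They never obstruct L(m): odd elements of g act on A as zero and d is
    even, hence L(m) preserves parity. I_B is given only as a U(L)-submodule, while well-defined
    products on V_B require absorption on both sides. The iterate formula shows that I_B is stable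
    under every u_n; skew-symmetry then absorbs the products v_n w with v in I_B. The commutator
    formula stops at i = 2, because L(i - 1) vanishes on A for i > 0 and on B for i > 2; this is the
    origin of the single coefficient C(m+1, 2). The equality of L(-1) with D is not built into the
    construction: both are derivations over the action of modes, they agree on generators and kill
    the vacuum. Uniqueness must settle L(0) first. Its commutator formula involves only L(-1) and
    L(0) on A and B, and only afterwards can weights for a competing structure be compared with the
    nonnegative weights of V_B. *)

Section LinearFunctions.
Variables (k : fieldType) (V W : lmodType k) (f : V -> W).
Hypothesis lf : linear f.

Let f' : {linear V -> W} := HB.pack f (GRing.isLinear.Build k V W *:%R f lf).

Lemma lin0 : f 0 = 0. Proof. exact: (linear0 f'). Qed.
Lemma linD : {morph f : x y / x + y}. Proof. exact: (linearD f'). Qed.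
Lemma linN : {morph f : x / - x}. Proof. exact: (linearN f'). Qed.
Lemma linB : {morph f : x y / x - y}. Proof. exact: (linearB f'). Qed.
Lemma linZ c : {morph f : x / c *: x}. Proof. exact: (linearZ_LR f'). Qed.
Lemma lin_sum (I : Type) (r : seq I) (P : pred I) (E : I -> V) :
  f (\sum_(i <- r | P i) E i) = \sum_(i <- r | P i) f (E i).
Proof. exact: (linear_sum f'). Qed.

Lemma submodule_preim (S : set W) : submodule S -> submodule (f @^-1` S).
Proof.
move=> [S0 SZ]; split=> [|c x y]; rewrite /preimage /= ?lin0 //.
by rewrite lf; exact: SZ.
Qed.

Lemma submodule_image (S : set V) : submodule S -> submodule (f @` S).
Proof.
move=> [S0 SZ]; split=> [|c _ _ [x Sx <-] [y Sy <-]]; first by exists 0 => //; rewrite lin0.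
by exists (c *: x + y); [exact: SZ|rewrite lf].
Qed.

Lemma submodule_ker : submodule [set x | f x = 0].
Proof. by split=> [|c x y /= ex ey]; rewrite /= ?lin0 // lf ex ey scaler0 addr0. Qed.

Lemma lspan_preim (S : set V) (S' : set W) : submodule S' ->
  (forall x, S x -> S' (f x)) -> forall x, lspan S x -> S' (f x).
Proof. by move=> sS' h; apply: lspan_min (submodule_preim sS') _. Qed.

End LinearFunctions.

Section Submodules.
Variables (k : fieldType) (V : lmodType k).

Lemma submodule_sum (S : set V) (I : Type) (r : seq I) (P : pred I) (E : I -> V) :
  submodule S -> (forall i, P i -> S (E i)) -> S (\sum_(i <- r | P i) E i).
Proof.
move=> [S0 SZ] SE; apply: big_ind => // x y Sx Sy.
by rewrite -[x]scale1r; exact: SZ.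
Qed.

Lemma submoduleZ (S : set V) c x : submodule S -> S x -> S (c *: x).
Proof. by move=> [S0 SZ] Sx; rewrite -[_ *: _]addr0; exact: SZ. Qed.

Lemma submoduleD (S : set V) x y : submodule S -> S x -> S y -> S (x + y).
Proof. by move=> [S0 SZ] Sx Sy; rewrite -[x]scale1r; exact: SZ. Qed.

Lemma submoduleN (S : set V) x : submodule S -> S x -> S (- x).
Proof. by move=> sS Sx; rewrite -scaleN1r; exact: submoduleZ. Qed.

Lemma submoduleB (S : set V) x y : submodule S -> S x -> S y -> S (x - y).
Proof. by move=> sS Sx Sy; apply: submoduleD => //; exact: submoduleN. Qed.

Lemma submodule_set0 : submodule ([set 0] : set V).
Proof. by split=> // c x y /= -> ->; rewrite scaler0 addr0. Qed.

Lemma linear_eq_submodule (W : lmodType k) (f h : V -> W) :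
  linear f -> linear h -> submodule [set x | f x = h x].
Proof.
move=> lf lh; split=> [|c x y /= ex ey]; rewrite /= ?lin0 //.
by rewrite lf lh ex ey.
Qed.

Lemma lspan_eq_linear (W : lmodType k) (S : set V) (f h : V -> W) :
  linear f -> linear h -> (forall x, S x -> f x = h x) ->
  forall x, lspan S x -> f x = h x.
Proof. by move=> lf lh fh; apply: lspan_min => //; exact: linear_eq_submodule. Qed.

Lemma linear_comp (U W : lmodType k) (f : V -> W) (h : U -> V) :
  linear f -> linear h -> linear (f \o h).
Proof. by move=> lf lh c x y /=; rewrite lh lf. Qed.

Lemma linear_scale (W : lmodType k) (f : V -> W) c : linear f -> linear (fun x => c *: f x).
Proof. by move=> lf b x y; rewrite lf scalerDr !scalerA mulrC. Qed.

Lemma linear_add (W : lmodType k) (f h : V -> W) :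
  linear f -> linear h -> linear (fun x => f x + h x).
Proof. by move=> lf lh c x y; rewrite lf lh scalerDr addrACA. Qed.

Lemma linear_opp (W : lmodType k) (f : V -> W) : linear f -> linear (fun x => - f x).
Proof. by move=> lf c x y; rewrite lf scalerN opprD. Qed.

Lemma linear_sub (W : lmodType k) (f h : V -> W) :
  linear f -> linear h -> linear (fun x => f x - h x).
Proof. by move=> lf lh; apply: linear_add => //; exact: linear_opp. Qed.

Lemma linear_null (W : lmodType k) : linear (fun _ : V => 0 : W).
Proof. by move=> c x y; rewrite scaler0 addr0. Qed.

End Submodules.

(** The shape of the Leibniz rule on a supercommutator: [a] and [b] come from the product [x y], [d]
    and [c] from the signed product in the other order. *)
Lemma subr_addACA (V : zmodType) (a b c d : V) : a + b - (d + c) - ((a - c) + (b - d)) = 0.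
Proof. by rewrite [d + c]addrC opprD [a + b + _]addrACA subrr. Qed.

Lemma tlift_sub (k : fieldType) (M N P : lmodType k) (f : M -> N -> P) : bilin f ->
  forall m n m' n', tlift f (tpure m n - tpure m' n') = f m n - f m' n'.
Proof. by move=> bf m n m' n'; rewrite (linB (tlift_linear bf)) !tliftE. Qed.

Lemma malg_span (k : fieldType) (K : choiceType) (S : set {malg k[K]}) :
  submodule S -> (forall i, S << i >>) -> forall x, S x.
Proof.
move=> sS Si x; rewrite [x]monalgE; apply: submodule_sum => // i _.
have -> : << x@_i *g i >> = x@_i *: << i >> :> {malg k[K]}.
  by apply/malgP => j; rewrite mcoeffZ !mcoeffU mulrnAr mulr1.
exact: submoduleZ.
Qed.

(** * Derivations of induced modules *)

(* Locked copies of the product, the letters and the derivation: unification would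
   otherwise unfold the convolution product of {malg k[fmonom X]}. *)
HB.lock Definition fmul (k : fieldType) (X : choiceType) (f h : freealg k X) : freealg k X :=
  f * h.
HB.lock Definition flet (k : fieldType) (L : lmodType k) (x : L) : freealg k L := letter x.
HB.lock Definition word (k : fieldType) (L : lmodType k) (s : seq L) : freealg k L :=
  << FMonom s >>.

Fixpoint word_der (k : fieldType) (L : lmodType k) (T : L -> L) (s : seq L) : freealg k L :=
  if s is x :: s' then fmul (flet (T x)) (word s') + fmul (flet x) (word_der T s') else 0.

HB.lock Definition free_der (k : fieldType) (L : lmodType k) (T : L -> L) (f : freealg k L) :
  freealg k L := free_lift (fun m : fmonom L => word_der T m) f.

Section FreeDerivation.
Variables (k : fieldType) (L : lmodType k).
Local Notation F := (freealg k L).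

Lemma fmulA (f h l : F) : fmul f (fmul h l) = fmul (fmul f h) l.
Proof. by rewrite fmul.unlock mulrA. Qed.

Lemma fmul1 (f : F) : fmul f 1 = f.
Proof. by rewrite fmul.unlock mulr1. Qed.

Lemma fmul1l (f : F) : fmul 1 f = f.
Proof. by rewrite fmul.unlock mul1r. Qed.

Lemma fmul_bilin : bilin (@fmul k L).
Proof.
rewrite fmul.unlock; split=> [f c x y|f c x y]; first by rewrite mulrDl free_scaleAl.
by rewrite mulrDr free_scaleAr.
Qed.

Lemma word_nil : word [::] = 1 :> F.
Proof. by rewrite word.unlock -fmoneE. Qed.

Lemma word_cons (x : L) s : word (x :: s) = fmul (flet x) (word s).
Proof.
by rewrite word.unlock fmul.unlock flet.unlock malgM_def fgmulUU mulr1 fmuE /mmul /mul /= fmmulE.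
Qed.

Lemma free_span (S : set F) : submodule S -> S 1 ->
  (forall x f, S f -> S (fmul (flet x) f)) -> forall f, S f.
Proof.
move=> sS S1 Sl; apply: malg_span => // -[s].
suff: S (word s) by rewrite word.unlock.
by elim: s => [|x s Ss]; rewrite ?word_nil // word_cons; exact: Sl.
Qed.

Variable T : L -> L.
Hypothesis lT : linear T.
Local Notation D := (free_der T).

Lemma free_der_linear : linear D.
Proof. by rewrite free_der.unlock; exact: free_lift_linear. Qed.

Lemma free_der_word s : D (word s) = word_der T s.
Proof. by rewrite free_der.unlock word.unlock; exact: free_liftU. Qed.

Lemma free_der1 : D 1 = 0.
Proof. by rewrite -word_nil free_der_word. Qed.

Lemma free_der_letM x f :
  D (fmul (flet x) f) = fmul (flet (T x)) f + fmul (flet x) (D f).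
Proof.
move: f; apply: malg_span; last first.
  move=> [s].
  suff: D (fmul (flet x) (word s)) =
      fmul (flet (T x)) (word s) + fmul (flet x) (D (word s)).
    by rewrite word.unlock.
  by rewrite -word_cons !free_der_word.
apply: linear_eq_submodule; first exact: linear_comp free_der_linear (fmul_bilin.2 _).
apply: linear_add; first exact: fmul_bilin.2.
exact: linear_comp (fmul_bilin.2 _) free_der_linear.
Qed.

(** Induction on the left factor, built up letter by letter; [free_der_letM] is the step. *)
Lemma free_derM f h : D (fmul f h) = fmul (D f) h + fmul f (D h).
Proof.
move: f; apply: free_span; first last.
- move=> x f; rewrite /mkset => IH.
  rewrite -fmulA !free_der_letM IH (linD (fmul_bilin.2 _)) (linD (fmul_bilin.1 _)).
  by rewrite !fmulA addrA.
- by rewrite /mkset free_der1 !fmul1l (lin0 (fmul_bilin.1 _)) add0r.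
apply: linear_eq_submodule; first exact: linear_comp free_der_linear (fmul_bilin.1 _).
apply: linear_add; last exact: fmul_bilin.1.
exact: linear_comp (fmul_bilin.1 _) free_der_linear.
Qed.

Lemma free_der_let x : D (flet x) = flet (T x).
Proof.
by rewrite -[flet x]fmul1 free_der_letM free_der1 fmul1 (lin0 (fmul_bilin.2 _)) addr0.
Qed.

End FreeDerivation.

HB.lock Definition emul (k : fieldType) (L : lmodType k) (par : bool -> set L)
  (br : L -> L -> L) (u v : env par br) : env par br := u * v.

(** The projection of U(L) onto the induced module. As the inducing module is one-dimensional, it is
    onto ([ind_of_surj]), so elements of the induced module can be replaced by elements of U(L). *)
HB.lock Definition ind_of (k : fieldType) (L : lmodType k) (par : bool -> set L)
  (br : L -> L -> L) (H : set L) (u : env par br) : ind par br H := ind_pure H u 1.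
HB.lock Definition iact (k : fieldType) (L : lmodType k) (par : bool -> set L)
  (br : L -> L -> L) (H : set L) (u : env par br) (v : ind par br H) : ind par br H :=
  ind_act u v.

Section InducedDerivation.
Variables (k : fieldType) (L : lmodType k) (par : bool -> set L) (br : L -> L -> L).
Variable H : set L.

Local Notation F := (freealg k L).
Local Notation env := (env par br).
Local Notation env_pi := (@env_pi k L par br).
Local Notation env_in := (@env_in k L par br).
Local Notation ind := (ind par br H).

Lemma env_pi_linear : linear env_pi.
Proof. exact: linearP. Qed.

Lemma env_piM x y : env_pi (fmul x y) = emul (env_pi x) (env_pi y).
Proof. by rewrite fmul.unlock emul.unlock -env_mulE. Qed.

Lemma env_pi_let x : env_pi (flet x) = env_in x.
Proof. by rewrite flet.unlock. Qed.

Lemma emul_bilin : bilin (fun u v : env => emul u v).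
Proof.
split; apply: env_ind => u c; apply: env_ind => v; apply: env_ind => w.
  by rewrite -env_pi_linear -!env_piM (fmul_bilin _).1 env_pi_linear.
by rewrite -env_pi_linear -!env_piM (fmul_bilin _).2 env_pi_linear.
Qed.

Lemma emulA (u v w : env) : emul u (emul v w) = emul (emul u v) w.
Proof. by rewrite emul.unlock mulrA. Qed.

Lemma emul1 (u : env) : emul u 1 = u.
Proof. by rewrite emul.unlock mulr1. Qed.

Lemma emul1l (u : env) : emul 1 u = u.
Proof. by rewrite emul.unlock mul1r. Qed.

Lemma env_rel0 r : env_rel par br r -> env_pi r = 0.
Proof.
move=> rr; apply: (quo_pi0 (env_ideal par br) r).2; apply: sub_lspan.
by exists 1, r, 1; rewrite mul1r mulr1.
Qed.

Lemma env_in_linear : linear env_in.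
Proof.
move=> c x y; apply/eqP; rewrite -subr_eq0 /env_in -env_pi_linear -(linB env_pi_linear).
by apply/eqP/env_rel0; rewrite /env_rel /setU /mkset; left; exists c, x, y.
Qed.

Lemma env_in_br p q x y : par p x -> par q y ->
  emul (env_in x) (env_in y) - (-1) ^+ (p && q) *: emul (env_in y) (env_in x) = env_in (br x y).
Proof.
move=> px qy; apply/eqP; rewrite -subr_eq0 -!env_pi_let -!env_piM -(linZ env_pi_linear).
rewrite -!(linB env_pi_linear); apply/eqP/env_rel0.
rewrite /env_rel /setU /mkset; right.
by exists p, q, x, y; rewrite fmul.unlock flet.unlock.
Qed.

Lemma env_span (S : set env) : submodule S -> S 1 ->
  (forall x u, S u -> S (emul (env_in x) u)) -> forall u, S u.
Proof.
move=> sS S1 Sx; apply: env_ind; apply: free_span => //.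
  exact: submodule_preim env_pi_linear _ sS.
by move=> x f; rewrite /mkset env_piM env_pi_let; exact: Sx.
Qed.

Section EnvDerivation.
Variable T : L -> L.
Hypotheses (lT : linear T) (parT : forall p x, par p x -> par p (T x)).
Hypothesis brT : forall p q x y, par p x -> par q y -> T (br x y) = br (T x) y + br x (T y).

Let D (f : F) : env := env_pi (free_der T f).

Let lD : linear D.
Proof. exact: linear_comp env_pi_linear (free_der_linear _). Qed.

(** In the Leibniz expansion on [a r b] the outer terms still contain the relation [r] and vanish in
    U(L). The middle one vanishes because T respects linearity and brackets; that T is even keeps
    the sign of the supercommutator unchanged. *)
Let D_ideal r : env_ideal par br r -> D r = 0.
Proof.
move=> [a [{}r [b [rr ->]]]].
have -> : a * r * b = fmul (fmul a r) b by rewrite fmul.unlock.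
rewrite /D !free_derM // !(linD env_pi_linear) !env_piM (linD env_pi_linear) !env_piM.
rewrite (env_rel0 rr) !(lin0 (emul_bilin.2 _)) !(lin0 (emul_bilin.1 _)) add0r addr0.
suff -> : env_pi (free_der T r) = 0 by rewrite (lin0 (emul_bilin.2 _)) (lin0 (emul_bilin.1 _)).
move: rr; rewrite /env_rel /setU /mkset => -[[c [x [y]]]|[p [q [x [y [px qy]]]]]].
  have -> : letter (c *: x + y) - (c *: letter x + letter y) =
    flet (c *: x + y) - (c *: flet x + flet y) :> F by rewrite flet.unlock.
  move=> ->; rewrite (linB (free_der_linear _)) free_der_linear.
  rewrite !free_der_let // (linB env_pi_linear) env_pi_linear.
  by rewrite !env_pi_let lT env_in_linear subrr.
have -> : letter x * letter y - (-1) ^+ (p && q) *: (letter y * letter x) - letter (br x y) =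
    fmul (flet x) (flet y) - (-1) ^+ (p && q) *: (fmul (flet y) (flet x)) - flet (br x y) :> F.
  by rewrite flet.unlock fmul.unlock.
move=> ->; rewrite !(linB (free_der_linear _)) (linZ (free_der_linear _)).
rewrite !free_derM // !free_der_let //.
rewrite !(linB env_pi_linear) (linZ env_pi_linear) !(linD env_pi_linear) !env_piM.
rewrite !env_pi_let (brT px qy) (linD env_in_linear).
rewrite -(env_in_br (parT px) qy) -(env_in_br px (parT qy)) scalerDr.
exact: subr_addACA.
Qed.

Definition env_der : env -> env := quo_lift D.

Lemma env_der_linear : linear env_der.
Proof. exact: quo_lift_linear. Qed.

Let env_der_pi f : env_der (env_pi f) = env_pi (free_der T f).
Proof. exact: quo_liftE. Qed.

Lemma env_der1 : env_der 1 = 0.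
Proof. by rewrite env_der_pi free_der1 (lin0 env_pi_linear). Qed.

Lemma env_derM u v : env_der (emul u v) = emul (env_der u) v + emul u (env_der v).
Proof.
move: u v; apply: env_ind => u; apply: env_ind => v.
by rewrite -env_piM !env_der_pi free_derM // (linD env_pi_linear) !env_piM.
Qed.

Lemma env_der_in x : env_der (env_in x) = env_in (T x).
Proof. by rewrite -env_pi_let env_der_pi free_der_let // env_pi_let. Qed.

End EnvDerivation.

Local Notation ind_pure := (@ind_pure k L par br H).

Local Notation ind_of := (@ind_of k L par br H).
Local Notation iact := (@iact k L par br H).

Let ind_pureD c u u' b : ind_pure (c *: u + u') b = c *: ind_pure u b + ind_pure u' b.
Proof. by rewrite /ind_pure (tpure_bilin _ _).1 linearP. Qed.

Let ind_pureDr c u b b' :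
  ind_pure u (c * b + b') = c *: ind_pure u b + ind_pure u b'.
Proof. by rewrite /ind_pure -linearP /= -(tpure_bilin _ _).2. Qed.

Let ind_pure_of u : ind_pure u 1 = ind_of u.
Proof. by rewrite ind_of.unlock. Qed.

Let ind_pureE u c : ind_pure u c = c *: ind_of u.
Proof.
have e0 : ind_pure u 0 = 0.
  by have := ind_pureDr (-1) u 0 0; rewrite mulr0 addr0 scaleN1r addNr.
by have := ind_pureDr c u 1 0; rewrite mulr1 addr0 e0 addr0 ind_pure_of.
Qed.

Lemma ind_of_linear : linear ind_of.
Proof. by move=> c u v; rewrite -!ind_pure_of; exact: ind_pureD. Qed.

Lemma ind_of_H u h : H h -> ind_of (emul u (env_in h)) = 0.
Proof.
move=> Hh; have e : ind_pure (emul u (env_in h)) 1 = ind_pure u 0.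
  rewrite emul.unlock.
  apply: (quo_piP (@ind_rel k L par br H) _ _).2.
  by apply: sub_lspan; exists u, h, 1.
by rewrite ind_of.unlock e ind_pureE scale0r.
Qed.

Lemma ind_of_surj v : exists u, v = ind_of u.
Proof.
suff: (ind_of @` setT) v by case=> u _ <-; exists u.
have sR : submodule (ind_of @` setT) by apply: submodule_image => //; exact: ind_of_linear.
have lp : linear (quo_pi (@ind_rel k L par br H)) by exact: linearP.
move: v; apply: quo_ind; apply: (tens_span (submodule_preim lp sR)) => u c.
exists (c *: u); first exact: I.
by rewrite (linZ ind_of_linear) -ind_pureE.
Qed.

Section IndLift.
Variables (W : lmodType k) (f : env -> W).
Hypotheses (lf : linear f) (fH : forall u h, H h -> f (emul u (env_in h)) = 0).

Let b (u : env) (c : k^o) : W := c *: f u.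

Let bb : bilin b.
Proof.
by split=> [c|u] a x y; rewrite /b ?lf ?scalerDr ?scalerDl ?scalerA // mulrC.
Qed.

Let bH r : @ind_rel k L par br H r -> tlift b r = 0.
Proof.
move=> [u [h [c [Hh ->]]]].
apply: etrans (tlift_sub bb _ _ _ _) _.
have := fH u Hh; rewrite /b emul.unlock => ->.
by rewrite scaler0 scale0r subr0.
Qed.

(** Universal property of the quotient of U(L) by the left ideal generated by H, which is the
    induced module of the trivial module. *)
Lemma ind_lift_ex : {g : ind -> W | linear g & forall u, g (ind_of u) = f u}.
Proof.
exists (quo_lift (tlift b)).
  by apply: quo_lift_linear => //; exact: tlift_linear.
move=> u; rewrite ind_of.unlock.
apply: etrans (quo_liftE _ (tlift_linear bb) bH) _.
by apply: etrans (tliftE bb _ _) _; rewrite /b scale1r.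
Qed.

End IndLift.

Let ind_act_b u : bilin (fun (u' : env) (c : k^o) => ind_pure (emul u u') c).
Proof.
split=> [c|u'] a x y; last exact: ind_pureDr.
by rewrite (emul_bilin.2 u) ind_pureD.
Qed.

Lemma ind_actE u v : iact u (ind_of v) = ind_of (emul u v).
Proof.
have -> : iact u = quo_lift (tlift (fun (u' : env) (c : k^o) => ind_pure (emul u u') c)).
  by rewrite iact.unlock emul.unlock.
rewrite ind_of.unlock; apply: etrans (quo_liftE _ (tlift_linear (ind_act_b u)) _) _.
  move=> _ [u' [h [c [Hh ->]]]].
  apply: etrans (tlift_sub (ind_act_b u) _ _ _ _) _; rewrite !ind_pureE scale0r subr0.
  have -> : u' * env_in h = emul u' (env_in h) by rewrite emul.unlock.
  by rewrite emulA ind_of_H // scaler0.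
exact: (tliftE (ind_act_b u)).
Qed.

Lemma ind_act_linear u : linear (iact u).
Proof.
move=> c x y; have [{}x ->] := ind_of_surj x; have [{}y ->] := ind_of_surj y.
by rewrite -ind_of_linear !ind_actE (emul_bilin.2 u) ind_of_linear.
Qed.

Lemma ind_act_linearl v : linear (fun u => iact u v).
Proof.
move=> c x y; have [{}v ->] := ind_of_surj v.
by rewrite !ind_actE (emul_bilin.1 v) ind_of_linear.
Qed.

Lemma ind_act1 v : iact 1 v = v.
Proof. by have [u ->] := ind_of_surj v; rewrite ind_actE emul1l. Qed.

Lemma ind_actA u u' v : iact (emul u u') v = iact u (iact u' v).
Proof. by have [w ->] := ind_of_surj v; rewrite !ind_actE emulA. Qed.

Local Notation act x v := (iact (env_in x) v).

Lemma act_bilin : bilin (fun x v => act x v).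
Proof.
split=> [v|x]; last exact: ind_act_linear.
exact: linear_comp (ind_act_linearl v) env_in_linear.
Qed.

Lemma act_br p q x y v : par p x -> par q y ->
  act x (act y v) = act (br x y) v + (-1) ^+ (p && q) *: act y (act x v).
Proof.
move=> px qy; rewrite -(env_in_br px qy) (linB (ind_act_linearl v)).
by rewrite (linZ (ind_act_linearl v)) !ind_actA subrK.
Qed.

Lemma ind_oneE : ind_one par br H = ind_of 1.
Proof. by rewrite ind_of.unlock. Qed.

Lemma act_one0 h : H h -> act h (ind_one par br H) = 0.
Proof. by move=> Hh; rewrite ind_oneE ind_actE emul1 -[env_in h]emul1l ind_of_H. Qed.

Lemma ind_act_stable (S : set ind) : submodule S ->
  (forall x v, S v -> S (act x v)) -> forall u v, S v -> S (iact u v).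
Proof.
move=> sS Sx u v Sv; move: u; apply: env_span.
- exact: submodule_preim (ind_act_linearl v) _ sS.
- by rewrite /= ind_act1.
- by move=> x u /= Su; rewrite ind_actA; exact: Sx.
Qed.

Lemma ind_span (S : set ind) : submodule S -> S (ind_one par br H) ->
  (forall x v, S v -> S (act x v)) -> forall v, S v.
Proof.
move=> sS S1 Sx v; have [u ->] := ind_of_surj v.
by rewrite -[u]emul1 -ind_actE -ind_oneE; exact: ind_act_stable.
Qed.

(** The extension of T to U(L) maps the left ideal U(L) H into itself because T preserves H, and it
    kills 1; so it descends and kills the vacuum. *)
Lemma ind_der_ex (T : L -> L) : linear T -> (forall p x, par p x -> par p (T x)) ->
  (forall p q x y, par p x -> par q y -> T (br x y) = br (T x) y + br x (T y)) ->
  (forall h, H h -> H (T h)) ->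
  {D : ind -> ind | linear D & D (ind_one par br H) = 0 /\
     forall x v, D (act x v) = act (T x) v + act x (D v)}.
Proof.
move=> lT parT brT HT.
have ldT := env_der_linear lT parT brT.
have [D lD DE] : {D : ind -> ind | linear D & forall u, D (ind_of u) = ind_of (env_der T u)}.
  apply: ind_lift_ex; first exact: linear_comp ind_of_linear ldT.
  move=> u h Hh.
  by rewrite env_derM // (linD ind_of_linear) env_der_in // !ind_of_H ?addr0 //; exact: HT.
exists D => //; split; first by rewrite ind_oneE DE env_der1 // (lin0 ind_of_linear).
move=> x v; have [u ->] := ind_of_surj v.
by rewrite !(ind_actE, DE) env_derM // env_der_in // (linD ind_of_linear).
Qed.

End InducedDerivation.

(** * Consequences of the Borcherds identity *)

Section Binomials.
Variable k : fieldType.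
Hypothesis char0 : forall n : nat, n.+1%:R != 0 :> k.

Lemma fact_neq0 n : n`!%:R != 0 :> k.
Proof. by have := fact_gt0 n; case: n`! => // m _; exact: char0. Qed.

Lemma zbin_nat (n i : nat) : zbin k n%:Z i = 'C(n, i)%:R.
Proof.
rewrite /zbin; apply: (mulIf (fact_neq0 i)); rewrite divfK ?fact_neq0 //.
rewrite -natrM bin_ffact ffact_prod.
have [le_in|lt_ni] := leqP i n.
  rewrite natr_prod; apply: eq_bigr => j _.
  by rewrite natrB // ltnW // (leq_trans (ltn_ord j)).
rewrite (bigD1 (Ordinal lt_ni)) //= subrr mul0r.
by rewrite (bigD1 (Ordinal lt_ni)) //= subnn mul0n.
Qed.

Lemma zbin0 (i : nat) : zbin k 0 i = (i == 0%N)%:R.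
Proof. by rewrite (zbin_nat 0) bin0n. Qed.

Lemma zbin_0r (n : int) : zbin k n 0 = 1.
Proof. by rewrite /zbin big_ord0 fact0 divr1. Qed.

Lemma zbin_1r (n : int) : zbin k n 1 = n%:~R.
Proof. by rewrite /zbin big_ord1 subr0 divr1. Qed.

(** The weights in the iterate formula for [v_(-2) 1], that is, for [D v]. *)
Lemma zbinN2 (i : nat) : (-1) ^+ i * zbin k (-2) i = i.+1%:R.
Proof.
rewrite /zbin; apply: (mulIf (fact_neq0 i)).
rewrite mulrA divfK ?fact_neq0 // -natrM -factS.
elim: i => [|i IH]; first by rewrite big_ord0 mulr1.
rewrite big_ord_recr /= factS natrM -IH exprS.
have -> : (-2)%:~R = - 2%:R :> k by [].
have -> : i.+2%:R = 1 + 1 + i%:R :> k by rewrite -addrA -natr1 -natr1; ring.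
set x := \prod_(i < _) _; ring.
Qed.

Lemma mul_binA (M j l : nat) : (l <= j <= M)%N ->
  ('C(M, j) * 'C(j, l) = 'C(M, l) * 'C(M - l, j - l))%N.
Proof.
case/andP=> lj jM; have lM := leq_trans lj jM.
have h1 := bin_fact jM; have h2 := bin_fact lj; have h3 := bin_fact lM.
have h4 : ('C(M - l, j - l) * ((j - l)`! * (M - j)`!) = (M - l)`!)%N.
  have jl : (j - l <= M - l)%N by rewrite leq_sub2r.
  by rewrite -(bin_fact jl); congr (_ * (_ * _`!))%N; lia.
have f0 : (0 < l`! * (j - l)`! * (M - j)`!)%N by rewrite !muln_gt0 !fact_gt0.
apply/eqP; rewrite -(eqn_pmul2r f0); apply/eqP.
transitivity M`!; last by rewrite -h3 -h4; ring.
by rewrite -h1 -h2; ring.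
Qed.

(** Trinomial revision after the substitution j = l + s. The bound N is free because binomials
    beyond M - l vanish; this lets it match the truncation bound of a Borcherds sum. *)
Lemma sum_bin_shift (W : lmodType k) (M l N : nat) (H : nat -> W) : (l <= M < N)%N ->
  \sum_(s < N) ('C(M, l)%:R * 'C(M - l, s)%:R) *: H (l + s)%N =
  \sum_(j < M.+1) ('C(M, j)%:R * 'C(j, l)%:R) *: H j.
Proof.
case/andP=> lM MN.
rewrite -(big_mkord xpredT (fun s => ('C(M, l)%:R * 'C(M - l, s)%:R) *: H (l + s)%N)).
rewrite -(big_mkord xpredT (fun j => ('C(M, j)%:R * 'C(j, l)%:R) *: H j)).
rewrite (big_cat_nat (n := (M.+1 - l)%N)) //=; last by lia.
rewrite [X in _ + X]big_nat_cond [X in _ + X]big1 ?addr0; last first.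
  by move=> s; rewrite andbT => /andP[h _]; rewrite (@bin_small (M - l) s) ?mulr0 ?scale0r //; lia.
rewrite [RHS](big_cat_nat (n := l)) //=; last by lia.
rewrite [X in _ = X + _]big_nat_cond [X in _ = X + _]big1 ?add0r; last first.
  by move=> j; rewrite andbT => /andP[_ h]; rewrite (@bin_small j l) ?mulr0 ?scale0r.
rewrite -[X in _ = \sum_(X <= _ < _) _](add0n l) big_addn; apply: eq_big_nat => s /andP[_ h].
by rewrite addnC -natrM -[in RHS]natrM mul_binA ?addnK //; lia.
Qed.

End Binomials.

Section VertexTheory.
Variables (k : fieldType) (V : lmodType k) (par : bool -> set V) (one : V).
Variable Y : V -> int -> V -> V.
Hypothesis char0 : forall n : nat, n.+1%:R != 0 :> k.
Hypothesis HV : vertex_superalgebra par one Y.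

Local Notation D := (Dop one Y).

Lemma Yl n w : linear (fun u => Y u n w). Proof. exact: (vx_bilin HV n).1. Qed.
Lemma Yr u n : linear (Y u n). Proof. exact: (vx_bilin HV n).2. Qed.

Lemma par_sub p : submodule (par p).
Proof. by case: (vx_direct_sum HV). Qed.

Lemma par_span (S : set V) : submodule S -> (forall p v, par p v -> S v) -> forall v, S v.
Proof.
move=> sS pS v; case: (vx_direct_sum HV) => _ /(_ v) [s [f [fp ->]]] _.
by apply: submodule_sum => // i _; exact/pS/fp.
Qed.

Lemma Dop_linear : linear D. Proof. exact: Yl. Qed.

Lemma sum_single (N j : nat) (F : nat -> V) : (j < N)%N ->
  (forall i, i != j -> F i = 0) -> \sum_(i < N) F i = F j.
Proof.
move=> jN F0; rewrite (bigD1 (Ordinal jN)) //= big1 ?addr0 // => i ij.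
by apply: F0; move: ij; rewrite -val_eqE.
Qed.

(** The Borcherds identity with m = 0: its left side collapses to i = 0 since C(0, i) = 0
    otherwise. *)
Lemma iterate p q u v w (l n : int) : par p u -> par q v ->
  exists N0 : nat, forall N : nat, (N0 <= N)%N ->
  Y (Y u l v) n w = \sum_(i < N) ((-1) ^+ i * zbin k l i) *:
     (Y u (l - i%:Z) (Y v (n + i%:Z) w)
      - ((-1) ^ l * (-1) ^+ (p && q)) *: Y v (n + l - i%:Z) (Y u i%:Z w)).
Proof.
move=> pu qv; have [N0 h] := vx_borcherds HV w l 0 n pu qv.
exists N0.+1 => N hN; have := h N (ltnW hN).
rewrite (sum_single (j := 0)
  (F := fun i : nat => zbin k 0 i *: Y (Y u (l + i%:Z) v) (0 + n - i%:Z) w)).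
- rewrite zbin0 // scale1r addr0 add0r subr0 => ->.
  by apply: eq_bigr => i _; rewrite !add0r.
- exact: leq_trans hN.
- by move=> i /negbTE i0; rewrite zbin0 // i0 scale0r.
Qed.

(** In the iterate formula for [u_(-2) 1] the only nonzero mode of the vacuum is -1, so at most one
    index survives: i = -n - 1 in the first half when n < 0, i = n - 1 in the second half when n >
    0, none when n = 0. Its weight i + 1 is the absolute value of n. *)
Lemma Y_D v n w : Y (D v) n w = - (n%:~R *: Y v (n - 1) w).
Proof.
suff h p u : par p u -> Y (D u) n w = - (n%:~R *: Y u (n - 1) w).
  move: v; apply: par_span; last exact: h.
  apply: linear_eq_submodule; first exact: linear_comp (Yl _ _) Dop_linear.
  by apply: linear_opp; apply: linear_scale; exact: Yl.
move=> pu; rewrite /Dop; have [N0 h] := iterate w (-2) n pu (vx_one_par HV).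
pose N := (N0 + absz n).+1.
rewrite (h N); last by rewrite /N; lia.
under eq_bigr => i _ do rewrite zbinN2 // !(vx_one HV) andbF mulr1.
case: (ltrgtP n 0) => n0.
- pose j := (absz n).-1.
  rewrite (sum_single (j := j) (F := fun i : nat => i.+1%:R *: (Y u (-2 - i%:Z)
    (if n + i%:Z == -1 then w else 0) -
    (-1) ^ (-2) *: (if n + -2 - i%:Z == -1 then Y u i%:Z w else 0)))).
  + have -> : (n + j%:Z == -1) = true by apply/eqP; rewrite /j; lia.
    have -> : (n + -2 - j%:Z == -1) = false by apply/eqP; rewrite /j; lia.
    rewrite scaler0 subr0 -scaleNr.
    have -> : -2 - j%:Z = n - 1 by rewrite /j; lia.
    congr (_ *: _); have -> : n = - (j.+1)%:Z by rewrite /j; lia.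
    by rewrite mulrNz opprK.
  + by rewrite /N /j; lia.
  + move=> i ij.
    have -> : (n + i%:Z == -1) = false by apply/eqP; move: ij; rewrite /j; lia.
    have -> : (n + -2 - i%:Z == -1) = false by apply/eqP; move: ij; rewrite /j; lia.
    by rewrite (lin0 (Yr _ _)) scaler0 subr0 scaler0.
- pose j := (absz n).-1.
  rewrite (sum_single (j := j) (F := fun i : nat => i.+1%:R *: (Y u (-2 - i%:Z)
    (if n + i%:Z == -1 then w else 0) -
    (-1) ^ (-2) *: (if n + -2 - i%:Z == -1 then Y u i%:Z w else 0)))).
  + have -> : (n + j%:Z == -1) = false by apply/eqP; rewrite /j; lia.
    have -> : (n + -2 - j%:Z == -1) = true by apply/eqP; rewrite /j; lia.
    rewrite (lin0 (Yr _ _)) sub0r.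
    have -> : (-1) ^ (-2) = 1 :> k by rewrite -exprnN sqrrN expr1n invr1.
    rewrite scale1r scalerN.
    have -> : j%:Z = n - 1 by rewrite /j; lia.
    by congr (- (_ *: _)); have -> : n = (j.+1)%:Z by rewrite /j; lia.
  + by rewrite /N /j; lia.
  + move=> i ij.
    have -> : (n + i%:Z == -1) = false by apply/eqP; move: ij; rewrite /j; lia.
    have -> : (n + -2 - i%:Z == -1) = false by apply/eqP; move: ij; rewrite /j; lia.
    by rewrite (lin0 (Yr _ _)) scaler0 subr0 scaler0.
- rewrite n0 scale0r oppr0; apply: big1 => i _.
  have -> : (0 + i%:Z == -1) = false by apply/eqP; lia.
  have -> : (0 + -2 - i%:Z == -1) = false by apply/eqP; lia.
  by rewrite (lin0 (Yr _ _)) scaler0 subr0 scaler0.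
Qed.

(** In the iterate formula for [(u_n w)_(-2) 1] the second half vanishes by the creation axiom. In
    the first half only i = 0, giving [u_n (D w)], and i = 1, giving [-n u_(n-1) w], survive. *)
Lemma D_Y u n w : D (Y u n w) = Y u n (D w) - n%:~R *: Y u (n - 1) w.
Proof.
suff h p q u' w' : par p u' -> par q w' ->
    D (Y u' n w') = Y u' n (D w') - n%:~R *: Y u' (n - 1) w'.
  move: u; apply: par_span => [|p u pu].
    apply: linear_eq_submodule; first exact: linear_comp Dop_linear (Yl _ _).
    by apply: linear_sub; [exact: Yl|apply: linear_scale; exact: Yl].
  rewrite /mkset; move: w; apply: par_span => [|q w qw]; last exact: h pu qw.
  apply: linear_eq_submodule; first exact: linear_comp Dop_linear (Yr _ _).
  by apply: linear_sub; [exact: linear_comp (Yr _ _) Dop_linear|apply: linear_scale; exact: Yr].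
move=> pu qw; rewrite {1}/Dop; have [N0 h] := iterate one n (-2) pu qw.
rewrite (h N0.+2); last by lia.
rewrite !big_ord_recl big1 => [|i _]; last first.
  rewrite !lift0 (vx_creation0 HV u') // (lin0 (Yr _ _)) scaler0 subr0.
  by rewrite (vx_creation0 HV w') ?(lin0 (Yr _ _)) ?scaler0 //; lia.
rewrite /= !(vx_creation0 HV u') // !(lin0 (Yr _ _)) !scaler0 !subr0 addr0.
rewrite zbin_0r zbin_1r expr0 mulr1 scale1r /bump /= expr1 mulN1r scaleNr.
by rewrite [Y w' (-2 + _) one](vx_creation HV).
Qed.

Lemma D_one : D one = 0.
Proof. by rewrite /Dop (vx_one HV). Qed.

(** Up to the factor i!, the vector [v_(-1-i) 1] is [D^i v]; each induction step divides by i +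
    1. *)
Lemma Y_creation_ideal (S : set V) : submodule S -> (forall v, S v -> S (D v)) ->
  forall (i : nat) v, S v -> S (Y v (- 1 - i%:Z) one).
Proof.
move=> sS DS; elim=> [|i IH] v Sv; first by rewrite subr0 (vx_creation HV).
have := IH _ (DS _ Sv); rewrite Y_D -scaleNr => h.
have e : - (-1 - i%:Z)%:~R = i.+1%:R :> k.
  have -> : -1 - i%:Z = - (i.+1%:Z) by lia.
  by rewrite mulrNz opprK.
rewrite e in h; have := submoduleZ (i.+1%:R^-1) sS h.
rewrite scalerA mulVf // scale1r.
by have -> : -1 - i.+1%:Z = -1 - i%:Z - 1 by lia.
Qed.

(* Skew-symmetry writes Y e n w through the elements (Y w (n + i) e)_(-1-i) 1. *)
Lemma right_ideal_left (S : set V) : submodule S -> (forall v, S v -> S (D v)) ->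
  (forall u n v, S v -> S (Y u n v)) ->
  forall p e n w, par p e -> S e -> S (Y e n w).
Proof.
move=> sS DS YS p e n w pe Se; move: w; apply: par_span => [|q w qw].
  exact: submodule_preim (Yr _ _) _ sS.
(* On the vacuum, the nonnegative modes of [e] and [w] vanish, so the right side reduces to a signed
   [e_n w]. The sign squares to 1, which isolates this term. *)
have [N0 h] := vx_borcherds HV one n (-1) 0 qw pe.
have := h N0.+1 (leqnSn _).
rewrite [X in _ = X -> _]big_ord_recl [X in _ = _ + X -> _]big1 => [|i _]; last first.
  rewrite !lift0 (vx_creation0 HV e) // (vx_creation0 HV w) //.
  by rewrite !(lin0 (Yr _ _)) scaler0 subr0 scaler0.
rewrite /= (vx_creation0 HV e) // (lin0 (Yr _ _)) sub0r !addr0 zbin_0r mulr1 expr0 scale1r.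
rewrite add0r [Y w (-1) one](vx_creation HV) => E.
have sgn : ((-1) ^ n * (-1) ^+ (q && p)) * ((-1) ^ n * (-1) ^+ (q && p)) = 1 :> k.
  by rewrite mulrACA -expfzMl mulrNN mulr1 exp1rz mul1r -expr2 sqrr_sign.
rewrite /preimage /mkset -[Y e n w]scale1r -sgn -scalerA; apply: submoduleZ => //.
rewrite -[_ *: _]opprK -E; apply: submoduleN => //; apply: submodule_sum => // i _.
apply: submoduleZ => //; apply: Y_creation_ideal => //; exact: YS.
Qed.

Lemma iterate_stable (S : set V) p q u v l : submodule S -> par p u -> par q v ->
  (forall n w, S w -> S (Y u n w)) -> (forall n w, S w -> S (Y v n w)) ->
  forall n w, S w -> S (Y (Y u l v) n w).
Proof.
move=> sS pu qv Su Sv n w Sw; have [N0 h] := iterate w l n pu qv; rewrite (h N0 (leqnn _)).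
apply: submodule_sum => // i _; apply: submoduleZ => //.
by apply: submoduleB => //; [exact/Su/Sv|apply: submoduleZ => //; exact/Sv/Su].
Qed.

(** Each term of the iterate formula contains one mode of [v], which lands in S; the mode of [u] is
    applied either before it or to a vector already in S. *)
Lemma iterate_ideal (S : set V) p q u v l : submodule S -> par p u -> par q v ->
  (forall n w, S w -> S (Y u n w)) -> (forall n w, S (Y v n w)) ->
  forall n w, S (Y (Y u l v) n w).
Proof.
move=> sS pu qv Su Sv n w; have [N0 h] := iterate w l n pu qv; rewrite (h N0 (leqnn _)).
apply: submodule_sum => // i _; apply: submoduleZ => //.
by apply: submoduleB => //; [exact/Su/Sv|apply: submoduleZ => //; exact/Sv].
Qed.

Lemma lin_comb (W : lmodType k) (f : V -> W) (I : Type) (r : seq I) (c : I -> k) (E : I -> V) :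
  linear f -> f (\sum_(i <- r) c i *: E i) = \sum_(i <- r) c i *: f (E i).
Proof. by move=> lf; rewrite (lin_sum lf); apply: eq_bigr => i _; rewrite (linZ lf). Qed.

Lemma sum_scaleB (I : Type) (r : seq I) (c : I -> k) (e : k) (E F : I -> V) :
  \sum_(i <- r) c i *: (E i - e *: F i) =
  \sum_(i <- r) c i *: E i - e *: \sum_(i <- r) c i *: F i.
Proof.
rewrite scaler_sumr -sumrB; apply: eq_bigr => i _.
by rewrite scalerBr !scalerA mulrC.
Qed.

(** * The commutator formula is closed under all products u_l v *)

Section ConformalClosure.
Variable K : nat -> V -> V.
Hypothesis lK : forall M, linear (K M).

(* The commutator formula of L(M - 1) = K M with Y(v, x). *)
Definition conf_comm (v : V) : Prop := forall M n w,
  K M (Y v n w) = Y v n (K M w) +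
    \sum_(j < M.+1) 'C(M, j)%:R *: Y (K j v) (n + M%:Z - j%:Z) w.

(** Provides one truncation bound valid for all the finitely many [K j u] and [K j v] at once. *)
Lemma eventually_fin (I : finType) (P : I -> nat -> Prop) :
  (forall i, exists N0, forall N, (N0 <= N)%N -> P i N) ->
  exists N0, forall N, (N0 <= N)%N -> forall i, P i N.
Proof.
move=> /choice [f hf]; exists (\max_i f i)%N => N hN i.
by apply: hf; apply: leq_trans hN; exact: leq_bigmax.
Qed.

(* The terms with K j u match by 'C(M, j) 'C(j, i) = 'C(M, i) 'C(M - i, j - i) and the
   Borcherds identity with upper index M - i; the other terms match by the iterate formula. *)
Lemma conf_comm_prod p q u v l : par p u -> par q v ->
  (forall j, par p (K j u)) -> (forall j, par q (K j v)) ->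
  conf_comm u -> conf_comm v -> conf_comm (Y u l v).
Proof.
move=> pu qv pKu qKv cu cv M n w.
set eps : k := (-1) ^ l * (-1) ^+ (p && q).
pose b (i : nat) : k := (-1) ^+ i * zbin k l i.
have [N1 h1] := iterate (K M w) l n pu qv.
have [N2 h2] := iterate w l n pu qv.
have [N3 h3] := eventually_fin (fun j : 'I_M.+1 => iterate w l (n + M%:Z - j%:Z) pu (qKv j)).
have [N4 h4] := eventually_fin (fun j : 'I_M.+1 =>
  vx_borcherds HV w l (M - j)%N%:Z n (pKu j) qv).
pose N := (N1 + N2 + N3 + N4 + M).+1.
rewrite (h1 N) ?(h2 N); [|lia|lia].
rewrite (lin_sum (lK M)).
(* Moving [K M] to the right through the iterate expansion gives three families: [K M] reaches [w],
   some [K j] hits [v] ([X2]), or some [K j] hits [u] ([X3]). As [K j] preserves parity, all carry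
   the same sign [eps]. *)
pose X2 (i j : nat) : V := Y u (l - i%:Z) (Y (K j v) (n + i%:Z + M%:Z - j%:Z) w)
   - eps *: Y (K j v) (n + l - i%:Z + M%:Z - j%:Z) (Y u i%:Z w).
pose X3 (i j : nat) : V := Y (K j u) (l - i%:Z + M%:Z - j%:Z) (Y v (n + i%:Z) w)
   - eps *: Y v (n + l - i%:Z) (Y (K j u) (i%:Z + M%:Z - j%:Z) w).
transitivity (\sum_(i < N) b i *: (Y u (l - i%:Z) (Y v (n + i%:Z) (K M w)) -
      eps *: Y v (n + l - i%:Z) (Y u i%:Z (K M w)))
  + \sum_(j < M.+1) 'C(M, j)%:R *: (\sum_(i < N) b i *: X2 i j)
  + \sum_(j < M.+1) 'C(M, j)%:R *: (\sum_(i < N) b i *: X3 i j)).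
  have swap (X : nat -> nat -> V) :
      \sum_(j < M.+1) 'C(M, j)%:R *: (\sum_(i < N) b i *: X i j) =
      \sum_(i < N) b i *: (\sum_(j < M.+1) 'C(M, j)%:R *: X i j).
    under eq_bigr => j _ do rewrite scaler_sumr.
    rewrite exchange_big; apply: eq_bigr => i _; rewrite scaler_sumr.
    by apply: eq_bigr => j _; rewrite !scalerA mulrC.
  rewrite !swap -!big_split; apply: eq_bigr => i _ /=.
  rewrite (linZ (lK M)) (linB (lK M)) (linZ (lK M)) -!scalerDr; congr (_ *: _).
  rewrite /X2 /X3 !sum_scaleB.
  rewrite cu !cv cu !(linD (Yr _ _)) !(lin_comb _ _ _ (Yr _ _)).
  set a1 := Y u _ (Y v _ (K M w)); set a2 := Y v _ (Y u _ (K M w)).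
  set s1 := \sum_(j < M.+1) _; set s2 := \sum_(j < M.+1) _.
  set s3 := \sum_(j < M.+1) _; set s4 := \sum_(j < M.+1) _.
  rewrite -/eps !scalerDr !opprD.
  by rewrite [LHS](AC (3*3) ((1*4)*(2*6)*(3*5))).
rewrite -addrA; congr (_ + _).
under [RHS]eq_bigr => j _ do rewrite cu (linD (Yl _ _)) (lin_comb _ _ _ (Yl _ _)) scalerDr.
rewrite big_split /=; congr (_ + _).
  apply: eq_bigr => j _; congr (_ *: _).
  rewrite (h3 N _ j); last by rewrite /N; lia.
  apply: eq_bigr => i _; congr (_ *: (Y _ _ (Y _ _ _) - _ *: Y _ _ _)); lia.
(* [G j s] is the part of [K s (u_l v)] in which [K j] hits [u]. The left side reaches it by the
   Borcherds identity, with s = j + i. *)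
pose G (j s : nat) : V := Y (Y (K j u) (l + s%:Z - j%:Z) v) (n + M%:Z - s%:Z) w.
transitivity (\sum_(j < M.+1) \sum_(s < M.+1) ('C(M, s)%:R * 'C(s, j)%:R) *: G j s).
  apply: eq_bigr => j _; have jM : (j <= M)%N by rewrite -ltnS.
  rewrite -(@sum_bin_shift _ _ M j N (G j)); last by rewrite jM /N; lia.
  rewrite (_ : \sum_(i < N) b i *: X3 i j =
    \sum_(i < N) 'C(M - j, i)%:R *: G j (j + i)%N).
    by rewrite scaler_sumr; apply: eq_bigr => i _; rewrite scalerA.
  transitivity (\sum_(i < N) zbin k (M - j)%N i *:
      Y (Y (K j u) (l + i%:Z) v) ((M - j)%N%:Z + n - i%:Z) w).
    rewrite (h4 N _ j); last by rewrite /N; lia.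
    by apply: eq_bigr => i _; congr (_ *: (Y _ _ (Y _ _ _) - _ *: Y _ _ (Y _ _ _))); lia.
  apply: eq_bigr => i _; rewrite zbin_nat // /G; congr (_ *: Y (Y _ _ _) _ _); lia.
rewrite exchange_big; apply: eq_bigr => s _ /=.
rewrite scaler_sumr.
under [RHS]eq_bigr => i _ do rewrite scalerA.
(* The inner sum may be extended from s to M since C(s, i) = 0 for i > s. *)
have sM : (s.+1 <= M.+1)%N by [].
rewrite (big_ord_widen _ (fun i : nat => ('C(M, s)%:R * 'C(s, i)%:R) *:
  Y (Y (K i u) (l + s%:Z - i%:Z) v) (n + M%:Z - s%:Z) w) sM) [RHS]big_mkcond.
apply: eq_bigr => i _; case: ltnP => // h.
by rewrite (@bin_small s i) ?mulr0 ?scale0r.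
Qed.

End ConformalClosure.

End VertexTheory.

(** * The operations on B *)

Section Lifts.
Variable k : fieldType.

(** [tlift f v] is a finite sum over a chosen representative of [v], hence linear in the function
    [f]; linearity in parameters of [f] follows pointwise. *)
Lemma bilin_lift_par (M N M' N' P : lmodType k) (G : M -> N -> M' -> N' -> P) v :
  (forall m' n', bilin (fun m n => G m n m' n')) -> bilin (fun m n => tlift (G m n) v).
Proof.
move=> bG; split=> [n c x y|m c x y]; rewrite -tlift_pt; congr (tlift _ v);
  apply/funext => m'; apply/funext => n'.
  exact: ((bG m' n').1 n c x y).
exact: ((bG m' n').2 m c x y).
Qed.

Lemma bilin_tlift (M N W P : lmodType k) (F : M -> N -> W -> P) :
  (forall v, bilin (fun m n => F m n v)) -> (forall m n, linear (F m n)) ->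
  bilin (fun u v => tlift (fun m n => F m n v) u).
Proof.
move=> bF lF; split=> [v|u c x y]; first exact: tlift_linear.
rewrite -tlift_pt; congr (tlift _ u).
by apply/funext => m; apply/funext => n; exact: lF.
Qed.

Variable A : comAlg k.

Lemma amul_linl (b : A) : linear (fun a : A => a * b : A).
Proof. by move=> c x y; rewrite mulrDl alg_scaleAl. Qed.

Lemma amul_linr (b : A) : linear (fun a : A => b * a : A).
Proof. by move=> c x y; rewrite mulrC amul_linl ![_ * b]mulrC. Qed.

Definition kaehlerian (P : lmodType k) (f : A -> A -> P) : Prop :=
  bilin f /\ forall a b c, f a (b * c) = f (a * b) c + f (a * c) b.

Section KLift.
Variables (P : lmodType k) (f : A -> A -> P).
Hypothesis kf : kaehlerian f.

Let kills r : kaehler_rel r -> tlift f r = 0.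
Proof.
move=> [a [b [c ->]]]; rewrite (linB (tlift_linear kf.1)) (linD (tlift_linear kf.1)).
by rewrite !(tliftE kf.1) kf.2 subrr.
Qed.

Lemma kaehler_lift_linear : linear (kaehler_lift f).
Proof. by apply: quo_lift_linear kills; exact: tlift_linear kf.1. Qed.

Lemma kaehler_liftE a b : kaehler_lift f (kd a b) = f a b.
Proof. by apply: etrans (quo_liftE _ (tlift_linear kf.1) kills) _; exact: tliftE kf.1 _ _. Qed.

End KLift.

(** By conversion, [kaehler_lift f w] is [tlift f] at a representative of [w]. *)
Lemma bilin_klift_par (M N P : lmodType k) (G : M -> N -> A -> A -> P) w :
  (forall a b, bilin (fun m n => G m n a b)) -> bilin (fun m n => kaehler_lift (G m n) w).
Proof. exact: bilin_lift_par. Qed.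

Lemma kd_kaehlerian : kaehlerian (@kd k A).
Proof.
split; first split=> [b|a] c x y.
- by rewrite /kd (tpure_bilin _ _).1 linearP.
- by rewrite /kd (tpure_bilin _ _).2 linearP.
move=> a b c; rewrite /kd -linearD; apply: (quo_piP (@kaehler_rel k A) _ _).2.
by apply: sub_lspan; exists a, b, c.
Qed.

Lemma kaehler_span (S : set (kaehler A)) : submodule S -> (forall a b, S (kd a b)) ->
  forall w, S w.
Proof.
move=> sS Sk; apply: quo_ind.
have lp : linear (quo_pi (@kaehler_rel k A)) by exact: linearP.
exact: (tens_span (submodule_preim lp sS)).
Qed.

End Lifts.

(** * Homogeneous components of a Lie superalgebra *)

Section LieComponents.
Variables (k : fieldType) (g : lieSuper k).

Lemma lie_par_sub p : submodule (lie_par (l := g) p).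
Proof. by case: (lie_direct_sum g). Qed.

Lemma lie_decomp (x : g) : exists y z, [/\ lie_par false y, lie_par true z & x = y + z].
Proof.
case: (lie_direct_sum g) => sp /(_ x) [s [f [fp ->]]] _.
exists (\sum_(i <- s | ~~ i) f i), (\sum_(i <- s | i) f i); split.
- apply: submodule_sum => // -[] // _; exact: fp.
- apply: submodule_sum => // -[] // _; exact: fp.
- by rewrite addrC [LHS](bigID (fun b : bool => b)).
Qed.

Lemma lie_compP p (x : g) : lie_par p (lie_comp p x) /\ lie_par (~~ p) (x - lie_comp p x).
Proof.
have [y [z [py pz xyz]]] := lie_decomp x.
rewrite /lie_comp; case: xgetP => [_ _ //|/(_ (if p then z else y))] [].
case: p => /=; rewrite xyz; first by rewrite addrK.
by rewrite addrC addKr.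
Qed.

(** The family consisting of x in even degree and -x in odd degree sums to zero, so directness kills
    both. *)
Lemma lie_par_disjoint (x : g) : lie_par false x -> lie_par true x -> x = 0.
Proof.
move=> px qx; case: (lie_direct_sum g) => sp _.
move=> /(_ [:: false; true] (fun p => if p then - x else x)) h.
apply: (h _ _ _ false) => //; first by case=> //=; exact: submoduleN (sp _) _.
by rewrite !big_cons big_nil addr0 subrr.
Qed.

Lemma lie_comp_sum (x : g) : lie_comp false x + lie_comp true x = x.
Proof.
have [p0 p1] := lie_compP false x; have [q1 q0] := lie_compP true x.
apply/eqP; rewrite eq_sym -subr_eq0; apply/eqP; apply: lie_par_disjoint.
  by rewrite [X in x - X]addrC opprD addrA; exact: submoduleB (lie_par_sub _) _ _.
by rewrite opprD addrA; exact: submoduleB (lie_par_sub _) _ _.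
Qed.

Lemma lie_par_span (S : set g) : submodule S -> (forall p x, lie_par p x -> S x) ->
  forall x, S x.
Proof.
move=> sS pS x; have [y [z [py pz ->]]] := lie_decomp x.
by apply: submoduleD => //; [exact: pS py|exact: pS pz].
Qed.

End LieComponents.

(* gB a x is a (x) x and kB a b is a d(b), locked for the same reason as above. *)
HB.lock Definition gB (k : fieldType) (A : comAlg k) (g : lieSuper k) (a : A) (x : g) :
  Bmod A g := inAg (tpure a x).
HB.lock Definition kB (k : fieldType) (A : comAlg k) (g : lieSuper k) (a b : A) :
  Bmod A g := inKd g (kd a b).
HB.lock Definition banchor (k : fieldType) (A : comAlg k) (g : lieSuper k)
  (act : lieAction g A) (u : Bmod A g) (c : A) : A := anchor act u c.
HB.lock Definition bbr (k : fieldType) (A : comAlg k) (g : lieSuper k)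
  (act : lieAction g A) (u v : Bmod A g) : Bmod A g := br act u v.
HB.lock Definition bpair (k : fieldType) (A : comAlg k) (g : lieSuper k)
  (act : lieAction g A) (u v : Bmod A g) : A := pairing act u v.
HB.lock Definition bstar (k : fieldType) (A : comAlg k) (g : lieSuper k)
  (act : lieAction g A) (a : A) (u : Bmod A g) : Bmod A g := star act a u.
(* The prescribed L(1) : B -> A. *)
HB.lock Definition blam (k : fieldType) (A : comAlg k) (g : lieSuper k)
  (act : lieAction g A) (d : g -> A) (u : Bmod A g) : A :=
  tlift (fun (a : A) x => act x a + a * d x) u.1.

Section BOperations.
Variables (k : fieldType) (A : comAlg k) (g : lieSuper k) (act : lieAction g A).

Local Notation B := (Bmod A g).
Local Notation gB := (@gB k A g).
Local Notation kB := (@kB k A g).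

Lemma act_linr x : linear (act x). Proof. exact: (lie_act_bilin act).2. Qed.
Lemma act_linl a : linear (fun x => act x a). Proof. exact: (lie_act_bilin act).1. Qed.

Lemma act_1 x : act x 1 = 0.
Proof.
have := lie_act_der act x 1 1; rewrite !mulr1 mul1r -{1}[act x 1]addr0 => /addrI e.
by rewrite -e.
Qed.

Lemma inAg_linear : linear (@inAg k A g).
Proof.
move=> c x y; have e : c *: 0 + 0 = 0 :> kaehler A by rewrite scaler0 addr0.
by rewrite /inAg -{1}e.
Qed.

Lemma inKd_linear : linear (@inKd k A g).
Proof.
move=> c x y; have e : c *: 0 + 0 = 0 :> tens A g by rewrite scaler0 addr0.
by rewrite /inKd -{1}e.
Qed.

Lemma fst_linear : linear (fun u : B => u.1). Proof. by []. Qed.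
Lemma snd_linear : linear (fun u : B => u.2). Proof. by []. Qed.

Lemma gB_bilin : bilin gB.
Proof.
rewrite gB.unlock; split=> [x|a] c y z.
  by rewrite (tpure_bilin A g).1 inAg_linear.
by rewrite (tpure_bilin A g).2 inAg_linear.
Qed.

Lemma kB_kaehlerian : kaehlerian kB.
Proof.
have [bk kk] := kd_kaehlerian A.
rewrite kB.unlock; split; first split=> [b|a] c x y.
- by rewrite bk.1 inKd_linear.
- by rewrite bk.2 inKd_linear.
- by move=> a b c; rewrite kk (linD inKd_linear).
Qed.

Lemma B_span (S : set B) : submodule S -> (forall a x, S (gB a x)) -> (forall a b, S (kB a b)) ->
  forall u, S u.
Proof.
move=> sS Sg Sk [t w].
have -> : (t, w) = inAg t + inKd g w :> B by rewrite -{1}[t]addr0 -{1}[w]add0r.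
apply: submoduleD => //.
  apply: (tens_span (submodule_preim inAg_linear sS)) => a x.
  by have := Sg a x; rewrite gB.unlock.
apply: (kaehler_span (submodule_preim inKd_linear sS)) => a b.
by have := Sk a b; rewrite kB.unlock.
Qed.

(* The sign is invisible: odd elements act on A as zero. *)
Lemma lie_comp_act_sum (a a' : A) (x x' : g) :
  \sum_(p : bool) \sum_(q : bool) (-1) ^+ (p && q) *:
        tpure (a' * act (lie_comp q x') a) (lie_comp p x) = tpure (a' * act x' a) x.
Proof.
have e1 : act (lie_comp true x') a = 0 by apply: lie_act_odd; case: (lie_compP true x').
have e0 : act (lie_comp false x') a = act x' a.
  by rewrite -{2}(lie_comp_sum x') (linD (act_linl a)) e1 addr0.
rewrite !big_bool /= e1 e0 mulr0 !(lin0 ((tpure_bilin _ _).1 _)) !scaler0.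
rewrite !add0r !scale1r addrC -(linD ((tpure_bilin _ _).2 _)).
by rewrite lie_comp_sum.
Qed.

Let gg (a : A) (x : g) (a' : A) (x' : g) : tens A g :=
  tpure (a * a') (lie_br x x') + tpure (a * act x a') x' - tpure (a' * act x' a) x.

Let tl := tpure_bilin A g.

Let gg_l a' x' : bilin (fun a x => gg a x a' x').
Proof.
split=> [x|a]; apply: linear_sub; first [apply: linear_add|idtac].
- exact: linear_comp (tl.1 _) (amul_linl _).
- exact: linear_comp (tl.1 _) (amul_linl _).
- apply: linear_comp (tl.1 _) _.
  exact: linear_comp (amul_linr _) (act_linr _).
- exact: linear_comp (tl.2 _) ((lie_br_bilin g).1 _).
- apply: linear_comp (tl.1 _) _.
  exact: linear_comp (amul_linr _) (act_linl _).
- exact: tl.2.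
Qed.

Let gg_r a x : bilin (gg a x).
Proof.
split=> [x'|a']; apply: linear_sub; first [apply: linear_add|idtac].
- exact: linear_comp (tl.1 _) (amul_linr _).
- apply: linear_comp (tl.1 _) _.
  exact: linear_comp (amul_linr _) (act_linr _).
- exact: linear_comp (tl.1 _) (amul_linl _).
- exact: linear_comp (tl.2 _) ((lie_br_bilin g).2 _).
- exact: tl.2.
- apply: linear_comp (tl.1 _) _.
  exact: linear_comp (amul_linr _) (act_linl _).
Qed.

Let br_ggE (u v : tens A g) : br_gg act u v = tlift (fun a x => tlift (gg a x) v) u.
Proof.
rewrite /br_gg; congr (tlift _ u); apply/funext => a; apply/funext => x.
congr (tlift _ v); apply/funext => a'; apply/funext => x'.
by rewrite lie_comp_act_sum.
Qed.

Let br_gg_bilin : bilin (@br_gg k A g act).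
Proof.
have h : bilin (fun u v => tlift (fun a x => tlift (gg a x) v) u).
  apply: bilin_tlift => [v|a x]; first exact: bilin_lift_par.
  exact: tlift_linear.
split=> [v|u] c x y; rewrite !br_ggE; first exact: h.1.
exact: h.2.
Qed.

Let br_gg_pure a x a' x' : br_gg act (tpure a x) (tpure a' x') = gg a x a' x'.
Proof.
rewrite br_ggE; apply: etrans (tliftE _ _ _) _; first exact: bilin_lift_par.
exact: tliftE.
Qed.

Local Notation kd := (@kd k A).
Let kl := (kd_kaehlerian A).1.
Let kk := (kd_kaehlerian A).2.

Let gk (a' : A) (x : g) (a b : A) : kaehler A := kd (a' * act x a) b + kd a (a' * act x b).

Let gk_l a b : bilin (fun a' x => gk a' x a b).
Proof.
split=> [x|a']; apply: linear_add.
- exact: linear_comp (kl.1 _) (amul_linl _).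
- exact: linear_comp (kl.2 _) (amul_linl _).
- apply: linear_comp (kl.1 _) _; exact: linear_comp (amul_linr _) (act_linl _).
- apply: linear_comp (kl.2 _) _; exact: linear_comp (amul_linr _) (act_linl _).
Qed.

(** Compatibility with the Leibniz rule of the universal derivation, which makes the bracket descend
    to differentials; both sides expand into the same eight terms. *)
Let gk_r a' x : kaehlerian (gk a' x).
Proof.
split; first split=> [b|a]; first [apply: linear_add|idtac].
- apply: linear_comp (kl.1 _) _; exact: linear_comp (amul_linr _) (act_linr _).
- exact: kl.1.
- exact: kl.2.
- apply: linear_comp (kl.2 _) _; exact: linear_comp (amul_linr _) (act_linr _).
move=> a b c; rewrite /gk !lie_act_der !mulrDr !kk.
rewrite !(linD (kl.1 _)) !(linD (kl.2 _)) !kk.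
have zm (V : zmodType) (p q r s t u v w : V) :
  p + q + (r + s + t + (u + v + w)) = p + r + (u + w) + (q + v + (s + t)).
  by rewrite [LHS](AC (2*(3*3)) ((1*3)*(6*8)*((2*7)*(4*5)))).
have e1 : a' * (act x a * b) = a' * act x a * b by ring.
have e2 : a' * (a * act x b) = a * a' * act x b by ring.
have e3 : a * b * a' = a * a' * b by ring.
have e4 : a' * (act x a * c) = a' * act x a * c by ring.
have e5 : a' * (a * act x c) = a * a' * act x c by ring.
have e6 : a * c * a' = a * a' * c by ring.
have e7 : a * (act x b * c) = a * c * act x b by ring.
have e8 : a * (b * act x c) = a * b * act x c by ring.
rewrite e1 e2 e3 e4 e5 e6 e7 e8; exact: zm.
Qed.

Let kg (a' : A) (x : g) (a b : A) : kaehler A :=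
  - kd (a' * act x a) b + kd (a' * act x b) a.

Let kg_l a b : bilin (fun a' x => kg a' x a b).
Proof.
split=> [x|a']; apply: linear_add.
- apply: linear_opp; exact: linear_comp (kl.1 _) (amul_linl _).
- exact: linear_comp (kl.1 _) (amul_linl _).
- apply: linear_opp.
  apply: linear_comp (kl.1 _) _; exact: linear_comp (amul_linr _) (act_linl _).
- apply: linear_comp (kl.1 _) _; exact: linear_comp (amul_linr _) (act_linl _).
Qed.

Let kg_r a' x : kaehlerian (kg a' x).
Proof.
split; first split=> [b|a]; first [apply: linear_add|idtac].
- apply: linear_opp.
  apply: linear_comp (kl.1 _) _; exact: linear_comp (amul_linr _) (act_linr _).
- exact: kl.2.
- apply: linear_opp; exact: kl.2.
- apply: linear_comp (kl.1 _) _; exact: linear_comp (amul_linr _) (act_linr _).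
move=> a b c; rewrite /kg !lie_act_der !mulrDr !(linD (kl.1 _)) !kk.
(* The terms [t] and [u], which are [kd (a' * act x b * a) c] and [kd (a' * act x c * a) b], each
   occur twice on the right with opposite signs. *)
have zm (V : zmodType) (p q r s t u : V) :
  - (p + q) + (r + s) = - (p + t) + (u + s) + (- (q + u) + (t + r)).
  rewrite !opprD [RHS](AC ((2*2)*(2*2)) ((1*5)*(8*4)*((2*7)*(3*6)))) /=.
  by rewrite addNr subrr !addr0.
have e1 : a' * (a * act x b) = a' * act x b * a by ring.
have e2 : a' * (a * act x c) = a' * act x c * a by ring.
have e3 : a' * (act x a * b) = a' * act x a * b by ring.
have e4 : a' * (act x a * c) = a' * act x a * c by ring.
have e5 : a' * (act x b * c) = a' * act x b * c by ring.
have e6 : a' * (b * act x c) = a' * act x c * b by ring.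
rewrite e1 e2 e3 e4 e5 e6; exact: zm.
Qed.

Let pk (a : A) (x : g) (a' b : A) : A := a * a' * act x b.

Let pk_l a' b : bilin (fun a x => pk a x a' b).
Proof.
split=> [x|a]; first exact: linear_comp (amul_linl _) (amul_linl _).
exact: linear_comp (amul_linr _) (act_linl _).
Qed.

Let pk_r a x : kaehlerian (pk a x).
Proof.
split; first split=> [b|a'].
- exact: linear_comp (amul_linl _) (amul_linr _).
- exact: linear_comp (amul_linr _) (act_linr _).
by move=> a' b c; rewrite /pk lie_act_der; ring.
Qed.

Section GK.
Variables (P : lmodType k) (h : A -> g -> A -> A -> P).
Hypotheses (hl : forall a b, bilin (fun a' x => h a' x a b))
  (hr : forall a' x, kaehlerian (h a' x)).

Lemma gk_lift_bilin : bilin (fun u w => tlift (fun a' x => kaehler_lift (h a' x) w) u).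
Proof.
apply: bilin_tlift => [w|a x]; first exact: bilin_klift_par.
exact: kaehler_lift_linear.
Qed.

Lemma gk_lift_pure a' x a b :
  tlift (fun a' x => kaehler_lift (h a' x) (kd a b)) (tpure a' x) = h a' x a b.
Proof.
apply: etrans (tliftE _ _ _) _; first exact: bilin_klift_par.
exact: kaehler_liftE.
Qed.

End GK.

Let br_gk_bilin : bilin (@br_gk k A g act). Proof. exact: gk_lift_bilin gk_l gk_r. Qed.

Let br_kg_bilin : bilin (@br_kg k A g act).
Proof.
have [h1 h2] := gk_lift_bilin kg_l kg_r.
by split=> [v|u]; [exact: h2|exact: h1].
Qed.

Let pair_gk_bilin : bilin (@pair_gk k A g act). Proof. exact: gk_lift_bilin pk_l pk_r. Qed.

Let z1 a x : (gB a x).2 = 0. Proof. by rewrite gB.unlock. Qed.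
Let z2 a b : (kB a b).1 = 0. Proof. by rewrite kB.unlock. Qed.

Lemma banchor_bilin : bilin (banchor act).
Proof.
have ba c : bilin (fun (a : A) x => a * act x c).
  by split=> [x|a]; [exact: amul_linl|exact: linear_comp (amul_linr _) (act_linl _)].
have [h1 h2] : bilin (fun t (c : A) => tlift (fun (a : A) x => a * act x c) t).
  by apply: bilin_tlift => // a x; exact: linear_comp (amul_linr _) (act_linr _).
rewrite banchor.unlock; split=> [c|u]; last exact: h2.
exact: linear_comp (h1 c) fst_linear.
Qed.

Lemma banchor_g a x c : banchor act (gB a x) c = a * act x c.
Proof.
rewrite banchor.unlock gB.unlock; apply: tliftE.
by split=> [y|b]; [exact: amul_linl|exact: linear_comp (amul_linr _) (act_linl _)].
Qed.

Lemma banchor_k a b c : banchor act (kB a b) c = 0.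
Proof.
rewrite banchor.unlock /anchor z2; apply: (lin0 (tlift_linear _)).
by split=> [y|e]; [exact: amul_linl|exact: linear_comp (amul_linr _) (act_linl _)].
Qed.

Lemma bpair_bilin : bilin (bpair act).
Proof.
rewrite bpair.unlock; split=> [v|u]; apply: linear_add.
- exact: linear_comp (pair_gk_bilin.1 _) fst_linear.
- exact: linear_comp (pair_gk_bilin.2 _) snd_linear.
- exact: linear_comp (pair_gk_bilin.2 _) snd_linear.
- exact: linear_comp (pair_gk_bilin.1 _) fst_linear.
Qed.

Lemma bpairC u v : bpair act u v = bpair act v u.
Proof. by rewrite bpair.unlock /pairing addrC. Qed.

Lemma bpair_kk a b a' b' : bpair act (kB a b) (kB a' b') = 0.
Proof. by rewrite bpair.unlock /pairing !z2 !(lin0 (pair_gk_bilin.1 _)) addr0. Qed.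

Lemma bpair_gk a x a' b : bpair act (gB a x) (kB a' b) = a * a' * act x b.
Proof.
rewrite bpair.unlock /pairing z1 z2 (lin0 (pair_gk_bilin.1 _)) addr0 gB.unlock kB.unlock.
exact: gk_lift_pure pk_l pk_r _ _ _ _.
Qed.

Lemma bbr_bilin : bilin (bbr act).
Proof.
have pairl (W X Z : lmodType k) (f : W -> X) (h : W -> Z) : linear f -> linear h ->
    linear (fun w => (f w, h w)).
  by move=> lf lh c x y; rewrite lf lh.
rewrite bbr.unlock; split=> [v|u]; apply: pairl; first [apply: linear_add|idtac].
- exact: linear_comp (br_gg_bilin.1 _) fst_linear.
- exact: linear_comp (br_gk_bilin.1 _) fst_linear.
- exact: linear_comp (br_kg_bilin.1 _) snd_linear.
- exact: linear_comp (br_gg_bilin.2 _) fst_linear.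
- exact: linear_comp (br_gk_bilin.2 _) snd_linear.
- exact: linear_comp (br_kg_bilin.2 _) fst_linear.
Qed.

Lemma bbr_gg a x a' x' : bbr act (gB a x) (gB a' x') =
  gB (a * a') (lie_br x x') + gB (a * act x a') x' - gB (a' * act x' a) x.
Proof.
rewrite bbr.unlock /br !z1 (lin0 (br_gk_bilin.2 _)) (lin0 (br_kg_bilin.1 _)) addr0.
by rewrite gB.unlock br_gg_pure -[LHS]/(inAg _) /gg (linB inAg_linear) (linD inAg_linear).
Qed.

Lemma bbr_gk a' x a b : bbr act (gB a' x) (kB a b) =
  kB (a' * act x a) b + kB a (a' * act x b).
Proof.
rewrite bbr.unlock /br z1 z2 (lin0 (br_gg_bilin.2 _)) (lin0 (br_kg_bilin.1 _)) addr0.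
rewrite gB.unlock kB.unlock [br_gk _ _ _](gk_lift_pure gk_l gk_r).
by rewrite /gk -[LHS]/(inKd g _) (linD inKd_linear).
Qed.

Lemma bbr_kg a' x a b : bbr act (kB a b) (gB a' x) =
  - kB (a' * act x a) b + kB (a' * act x b) a.
Proof.
rewrite bbr.unlock /br z1 z2 (lin0 (br_gg_bilin.1 _)) (lin0 (br_gk_bilin.1 _)) add0r.
rewrite gB.unlock kB.unlock [br_kg _ _ _](gk_lift_pure kg_l kg_r).
by rewrite /kg -[LHS]/(inKd g _) (linD inKd_linear) (linN inKd_linear).
Qed.

Lemma bbr_kk a b a' b' : bbr act (kB a b) (kB a' b') = 0.
Proof.
rewrite bbr.unlock /br !z2 (lin0 (br_gg_bilin.1 _)) (lin0 (br_gk_bilin.1 _)).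
by rewrite (lin0 (br_kg_bilin.2 _)) addr0.
Qed.

Let st (a a' : A) (x : g) : B := gB (a * a') x + (kB (act x a) a' + kB (act x a') a).
Let kbl := kB_kaehlerian.1.

Let st_bilin a : bilin (st a).
Proof.
split=> [x|a']; apply: linear_add; first [apply: linear_add|idtac].
- exact: linear_comp (gB_bilin.1 _) (amul_linr _).
- exact: kbl.2.
- exact: linear_comp (kbl.1 _) (act_linr _).
- exact: gB_bilin.2.
- exact: linear_comp (kbl.1 _) (act_linl _).
- exact: linear_comp (kbl.1 _) (act_linl _).
Qed.

Let sk_kaehlerian a : kaehlerian (fun a' c => kd (a * a') c).
Proof.
split; first split=> [b|a']; [exact: linear_comp (kl.1 _) (amul_linr _)|exact: kl.2|].
by move=> a' b c; rewrite kk !mulrA.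
Qed.

Let bstarE a u : bstar act a u =
  tlift (st a) u.1 + inKd g (kaehler_lift (fun a' c : A => kd (a * a') c) u.2).
Proof.
rewrite bstar.unlock /star; congr (tlift _ _ + _); apply/funext => a'; apply/funext => x.
by rewrite /st gB.unlock kB.unlock (linD inKd_linear).
Qed.

Lemma bstar_linear a : linear (bstar act a).
Proof.
rewrite (_ : bstar act a = fun u => tlift (st a) u.1 +
  inKd g (kaehler_lift (fun a' c : A => kd (a * a') c) u.2)); last first.
  by apply/funext => u; exact: bstarE.
apply: linear_add; first exact: linear_comp (tlift_linear (st_bilin a)) fst_linear.
apply: linear_comp inKd_linear _.
exact: linear_comp (kaehler_lift_linear (sk_kaehlerian a)) snd_linear.
Qed.

Lemma bstar_g a a' x : bstar act a (gB a' x) =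
  gB (a * a') x + kB (act x a) a' + kB (act x a') a.
Proof.
rewrite bstarE z1 (lin0 (kaehler_lift_linear (sk_kaehlerian a))) (lin0 inKd_linear) addr0.
rewrite {1}gB.unlock (tliftE (st_bilin a)).
exact: addrA.
Qed.

Lemma bstar_k a a' b : bstar act a (kB a' b) = kB (a * a') b.
Proof.
rewrite bstarE z2 (lin0 (tlift_linear (st_bilin a))) add0r kB.unlock.
by rewrite (kaehler_liftE (sk_kaehlerian a)).
Qed.

(** * The prescribed L(1) on B, and the exact differentials *)

Variable d : g -> A.
Hypothesis hd : lie_derivation act d.

Let la_bilin : bilin (fun (a : A) x => act x a + a * d x).
Proof.
split=> [x|a]; apply: linear_add.
- exact: act_linr.
- exact: amul_linl.
- exact: act_linl.
- exact: linear_comp (amul_linr _) (lie_der_linear hd).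
Qed.

Lemma blam_linear : linear (blam act d).
Proof. by rewrite blam.unlock; exact: linear_comp (tlift_linear la_bilin) fst_linear. Qed.

Lemma blam_g a x : blam act d (gB a x) = act x a + a * d x.
Proof. by rewrite blam.unlock gB.unlock; exact: tliftE la_bilin _ _. Qed.

Lemma blam_inKd w : blam act d (inKd g w) = 0.
Proof. by rewrite blam.unlock (lin0 (tlift_linear la_bilin)). Qed.

Lemma blam_k a b : blam act d (kB a b) = 0.
Proof. by rewrite kB.unlock blam_inKd. Qed.

(** The super sign differs from 1 only if both elements are odd, and then both products on the right
    vanish because odd elements act as zero. *)
Lemma lie_act_br0 x y a : act (lie_br x y) a = act x (act y a) - act y (act x a).
Proof.
have lb := lie_br_bilin g.
move: x; apply: lie_par_span => [|p x px].
  apply: linear_eq_submodule; first exact: linear_comp (act_linl _) (lb.1 _).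
  by apply: linear_sub; [exact: act_linl|exact: linear_comp (act_linr _) (act_linl _)].
rewrite /mkset; move: y; apply: lie_par_span => [|q y qy].
  apply: linear_eq_submodule; first exact: linear_comp (act_linl _) (lb.2 _).
  by apply: linear_sub; [exact: linear_comp (act_linr _) (act_linl _)|exact: act_linl].
rewrite /mkset (lie_act_br act a px qy); case: p px; case: q qy => qy px /=;
  rewrite ?scale1r //.
by rewrite !(lie_act_odd _ _ px) !(lie_act_odd _ _ qy) scaler0 subr0.
Qed.

(** On two tensors this expands to the cocycle identity for [d] and the Leibniz rule. If one
    argument is a differential, the bracket is again a combination of differentials, and [blam] and
    the anchor both vanish on differentials. *)
Lemma blam_br u v : blam act d (bbr act u v) =
  banchor act u (blam act d v) - banchor act v (blam act d u).
Proof.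
have [bl br] := bbr_bilin; have [al ar] := banchor_bilin; have ll := blam_linear.
move: u; apply: B_span => [|a x|a b].
- apply: linear_eq_submodule; first exact: linear_comp ll (bl _).
  by apply: linear_sub; [exact: al|exact: linear_comp (ar _) ll].
- rewrite /mkset; move: v; apply: B_span => [|a' x'|a' b'].
  + apply: linear_eq_submodule; first exact: linear_comp ll (br _).
    by apply: linear_sub; [exact: linear_comp (ar _) ll|exact: al].
  + rewrite /mkset bbr_gg (linB ll) (linD ll) !blam_g !banchor_g.
    rewrite (lie_der_br hd) lie_act_br0 !lie_act_der !(linD (act_linr _)) !lie_act_der.
    by ring.
  + rewrite /mkset bbr_gk (linD ll) !blam_k banchor_k (lin0 (ar _)).
    by rewrite addr0 subr0.
- rewrite /mkset; move: v; apply: B_span => [|a' x'|a' b'].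
  + apply: linear_eq_submodule; first exact: linear_comp ll (br _).
    by apply: linear_sub; [exact: linear_comp (ar _) ll|exact: al].
  + rewrite /mkset bbr_kg (linD ll) (linN ll) !blam_k banchor_k (lin0 (ar _)).
    by rewrite !(oppr0, addr0).
  + by rewrite /mkset bbr_kk (lin0 ll) !banchor_k subr0.
Qed.

(** [blam] is not A-linear: the defect is the Leibniz term. In [Erel_L] this defect is matched by
    the commutator of a(0) with b(-1). *)
Lemma blam_star a u : blam act d (bstar act a u) = banchor act u a + a * blam act d u.
Proof.
have al := banchor_bilin.1; have ll := blam_linear.
move: u; apply: B_span => [|a' x|a' b].
- apply: linear_eq_submodule; first exact: linear_comp ll (bstar_linear _).
  by apply: linear_add; [exact: al|exact: linear_comp (amul_linr _) ll].
- rewrite /mkset bstar_g !(linD ll) !blam_k blam_g banchor_g blam_g lie_act_der.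
  by ring.
- by rewrite /mkset bstar_k !blam_k banchor_k mulr0 addr0.
Qed.

(** Together with [kB1_bracket] and [kB1_pair], this lets the mode n of the differential of c be
    identified with -n c(n-1) inside brackets, as the quotient by [dhat] demands. *)
Lemma kB1_anchor u c : bbr act u (kB 1 c) = kB 1 (banchor act u c).
Proof.
have [kbk kbr] := kB_kaehlerian.
move: u; apply: B_span => [|a x|a b].
- apply: linear_eq_submodule; first exact: bbr_bilin.1.
  exact: linear_comp (kbk.2 _) (banchor_bilin.1 _).
- by rewrite /mkset bbr_gk banchor_g act_1 mulr0 (lin0 (kbk.1 _)) add0r.
- by rewrite /mkset bbr_kk banchor_k (lin0 (kbk.2 _)).
Qed.

Lemma kB_1 a : kB a 1 = 0.
Proof.
have [_ kbr] := kB_kaehlerian; have := kbr a 1 1.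
by rewrite !mulr1 -{1}[kB a 1]addr0 => /addrI <-.
Qed.

Lemma kB1_bracket u c : bbr act (kB 1 c) u = 0.
Proof.
have [kbk kbr] := kB_kaehlerian.
move: u; apply: B_span => [|a x|a b].
- apply: linear_eq_submodule; first exact: bbr_bilin.2.
  exact: linear_null.
- by rewrite /mkset bbr_kg act_1 mulr0 (lin0 (kbk.1 _)) oppr0 add0r kB_1.
- by rewrite /mkset bbr_kk.
Qed.

Lemma kB1_pair u c : bpair act u (kB 1 c) = banchor act u c.
Proof.
move: u; apply: B_span => [|a x|a b].
- by apply: linear_eq_submodule; [exact: bpair_bilin.1|exact: banchor_bilin.1].
- by rewrite /mkset bpair_gk banchor_g mulr1.
- by rewrite /mkset bpair_kk banchor_k.
Qed.

End BOperations.

(** * Modes and the derivations induced by L(m) *)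

Lemma free_lift_pt (k : fieldType) (K : choiceType) (W : lmodType k) c (f h : K -> W) x :
  free_lift (fun i => c *: f i + h i) x = c *: free_lift f x + free_lift h x.
Proof.
rewrite /free_lift scaler_sumr -big_split; apply: eq_bigr => i _ /=.
by rewrite scalerDr !scalerA mulrC.
Qed.

Lemma free_lift_linr (k : fieldType) (K : choiceType) (U W : lmodType k) (f : K -> U -> W) x :
  (forall i, linear (f i)) -> linear (fun u => free_lift (fun i => f i u) x).
Proof.
move=> lf c u v; rewrite -free_lift_pt; congr (free_lift _ x).
by apply/funext => i; exact: lf.
Qed.

Lemma quo_bilinE (k : fieldType) (V : lmodType k) (S : set V) (f : V -> V -> V) :
  bilin f -> (forall s y, S s -> lspan S (f s y)) -> (forall x s, S s -> lspan S (f x s)) ->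
  forall x y, quo_pi S (f (quo_repr (quo_pi S x)) (quo_repr (quo_pi S y))) = quo_pi S (f x y).
Proof.
move=> [fl fr] Sl Sr x y; set x' := quo_repr _; set y' := quo_repr _.
apply/quo_piP.
have -> : f x' y' - f x y = f (x' - x) y' + f x (y' - y).
  by rewrite (linB (fl _)) (linB (fr _)) addrA subrK.
apply: lspanD.
  move: (x' - x) (quo_repr_pi x : lspan S (x' - x)) => z.
  exact: (lspan_preim (fl y') (lspan_submodule S) (fun s => Sl s y')).
move: (y' - y) (quo_repr_pi y : lspan S (y' - y)) => z.
exact: (lspan_preim (fr x) (lspan_submodule S) (Sr x)).
Qed.

HB.lock Definition mA (k : fieldType) (A : comAlg k) (g : lieSuper k) (a : A) (n : int) :
  calL A g := mode (inA g a) n.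
HB.lock Definition mB (k : fieldType) (A : comAlg k) (g : lieSuper k) (b : Bmod A g) (n : int) :
  calL A g := mode (inB b) n.
HB.lock Definition lbr (k : fieldType) (A : comAlg k) (g : lieSuper k) (act : lieAction g A)
  (x y : calL A g) : calL A g := calL_br act x y.

HB.lock Definition loopU (k : fieldType) (A : comAlg k) (g : lieSuper k) (u : AB A g)
  (n : int) : loopAB A g := tpure u (tpow k n).
(** The loop bracket followed by the projection. Compatibility with [dhat] then becomes an equation
    in the quotient, where [mB_partial] can be used. *)
HB.lock Definition loop_lbr (k : fieldType) (A : comAlg k) (g : lieSuper k)
  (act : lieAction g A) (x y : loopAB A g) : calL A g :=
  quo_pi (range (@dhat k A g)) (loop_br act x y).

Section ModeAlgebra.
Variables (k : fieldType) (A : comAlg k) (g : lieSuper k) (act : lieAction g A).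

Local Notation B := (Bmod A g).
Local Notation AB := (AB A g).
Local Notation inA := (@inA k A g).
Local Notation inB := (@inB k A g).
Local Notation mA := (@mA k A g).
Local Notation mB := (@mB k A g).
Local Notation gB := (@gB k A g).
Local Notation kB := (@kB k A g).
Local Notation loop := (@loopAB k A g).
Local Notation pi := (quo_pi (range (@dhat k A g))).
Local Notation mode := (@mode k A g).
Local Notation loopU := (@loopU k A g).

Lemma inA_linear : linear inA.
Proof.
move=> c x y; have e : c *: 0 + 0 = 0 :> B by rewrite scaler0 addr0.
by rewrite /Defs.inA -{1}e.
Qed.

Lemma inB_linear : linear inB.
Proof.
move=> c x y; have e : c *: 0 + 0 = 0 :> A by rewrite scaler0 addr0.
by rewrite /Defs.inB -{1}e.
Qed.

Lemma AB_split (u : AB) : u = inA u.1 + inB u.2.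
Proof. by case: u => a b; rewrite /= -[a in LHS]addr0 -[b in LHS]add0r. Qed.

Lemma pi_linear : linear pi. Proof. exact: linearP. Qed.

Lemma mode_linear n : linear (mode^~ n).
Proof. by move=> c u v; rewrite /Defs.mode (tpure_bilin _ _).1 pi_linear. Qed.

Lemma mA_linear n : linear (mA^~ n).
Proof. by rewrite mA.unlock; exact: linear_comp (mode_linear n) inA_linear. Qed.

Lemma mB_linear n : linear (mB^~ n).
Proof. by rewrite mB.unlock; exact: linear_comp (mode_linear n) inB_linear. Qed.

Lemma mode_split u n : mode u n = mA u.1 n + mB u.2 n.
Proof. by rewrite {1}(AB_split u) (linD (mode_linear n)) mA.unlock mB.unlock. Qed.

Lemma loop_span (S : set loop) : submodule S -> (forall u n, S (loopU u n)) ->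
  forall x, S x.
Proof.
rewrite loopU.unlock => sS St; apply: tens_span => // u p.
move: p; apply: malg_span => [|n]; last exact: St.
exact: submodule_preim ((tpure_bilin _ _).2 u) _ sS.
Qed.

Lemma calL_span (S : set (calL A g)) : submodule S -> (forall a n, S (mA a n)) ->
  (forall b n, S (mB b n)) -> forall x, S x.
Proof.
move=> sS SA SB; apply: quo_ind; apply: loop_span => [|u n].
  exact: submodule_preim pi_linear _ sS.
have : S (mode u n) by rewrite mode_split; exact: submoduleD.
by rewrite loopU.unlock.
Qed.

Let banchorE : anchor act = banchor act. Proof. by rewrite banchor.unlock. Qed.
Let bbrE : br act = bbr act. Proof. by rewrite bbr.unlock. Qed.
Let bpairE : pairing act = bpair act. Proof. by rewrite bpair.unlock. Qed.

Lemma prod0E u v : prod0 act u v =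
  inA (banchor act u.2 v.1 - banchor act v.2 u.1) + inB (bbr act u.2 v.2).
Proof. by rewrite [LHS]AB_split /= banchorE bbrE. Qed.

Lemma prod1E u v : prod1 act u v = inA (bpair act u.2 v.2).
Proof. by rewrite /prod1 bpairE. Qed.

Let l1 : linear (fun u : AB => u.1). Proof. by []. Qed.
Let l2 : linear (fun u : AB => u.2). Proof. by []. Qed.

Lemma prod0_bilin : bilin (prod0 act).
Proof.
have [al ar] := banchor_bilin act; have [bl br] := bbr_bilin act.
rewrite (_ : prod0 act = fun u v => inA (banchor act u.2 v.1 - banchor act v.2 u.1) +
  inB (bbr act u.2 v.2)); last by apply/funext => u; apply/funext => v; exact: prod0E.
split=> [v|u]; apply: linear_add.
- apply: linear_comp inA_linear _; apply: linear_sub.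
    exact: linear_comp (al _) l2.
  exact: linear_comp (ar _) l1.
- apply: linear_comp inB_linear _; exact: linear_comp (bl _) l2.
- apply: linear_comp inA_linear _; apply: linear_sub.
    exact: linear_comp (ar _) l1.
  exact: linear_comp (al _) l2.
- apply: linear_comp inB_linear _; exact: linear_comp (br _) l2.
Qed.

Lemma prod1_bilin : bilin (prod1 act).
Proof.
have [pl pr] := bpair_bilin act.
rewrite (_ : prod1 act = fun u v => inA (bpair act u.2 v.2)); last first.
  by apply/funext => u; apply/funext => v; exact: prod1E.
split=> [v|u]; apply: linear_comp inA_linear _.
  exact: linear_comp (pl _) l2.
exact: linear_comp (pr _) l2.
Qed.

Let X (u v : AB) (m n : int) : loop :=
  tpure (prod0 act u v) (tpow k (m + n)) + m%:~R *: tpure (prod1 act u v) (tpow k (m + n - 1)).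

Let F (u : AB) (p : laurent k) (v : AB) (q : laurent k) : loop :=
  free_lift (fun m => free_lift (fun n => X u v m n) q) p.

Let X_bilin m n : bilin (fun u v => X u v m n).
Proof.
split=> [v|u]; apply: linear_add; last 1 first.
- apply: linear_scale; exact: linear_comp ((tpure_bilin _ _).1 _) (prod1_bilin.2 _).
- exact: linear_comp ((tpure_bilin _ _).1 _) (prod0_bilin.1 _).
- apply: linear_scale; exact: linear_comp ((tpure_bilin _ _).1 _) (prod1_bilin.1 _).
- exact: linear_comp ((tpure_bilin _ _).1 _) (prod0_bilin.2 _).
Qed.

Let F_l v q : bilin (fun u p => F u p v q).
Proof.
split=> [p|u]; last exact: free_lift_linear.
by apply: free_lift_linr => m; apply: free_lift_linr => n; exact: (X_bilin m n).1.
Qed.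

Let F_r u p : bilin (F u p).
Proof.
split=> [q|v]; apply: free_lift_linr => m; last exact: free_lift_linear.
by apply: free_lift_linr => n; exact: (X_bilin m n).2.
Qed.

Lemma loop_br_bilin : bilin (loop_br act).
Proof.
apply: (@bilin_tlift _ _ _ _ _ (fun u p y => tlift (F u p) y)) => [y|u p].
  exact: (bilin_lift_par (G := F) y F_l).
exact: (tlift_linear (F_r u p)).
Qed.

Lemma loop_br_pure u n v m : loop_br act (tpure u (tpow k n)) (tpure v (tpow k m)) = X u v n m.
Proof.
apply: etrans (tliftE (bilin_lift_par (G := F) _ F_l) _ _) _.
apply: etrans (tliftE (F_r _ _) _ _) _.
by rewrite /F !free_liftU.
Qed.

Local Notation lb := (loop_lbr act).

Let lb_l y : linear (lb^~ y).
Proof. rewrite loop_lbr.unlock; exact: linear_comp pi_linear (loop_br_bilin.1 y). Qed.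

Let lb_r x : linear (lb x).
Proof. rewrite loop_lbr.unlock; exact: linear_comp pi_linear (loop_br_bilin.2 x). Qed.

Let lb_pure u n v m : lb (loopU u n) (loopU v m) =
  mA (banchor act u.2 v.1 - banchor act v.2 u.1) (n + m) + mB (bbr act u.2 v.2) (n + m)
  + n%:~R *: mA (bpair act u.2 v.2) (n + m - 1).
Proof.
transitivity (mode (prod0 act u v) (n + m) + n%:~R *: mode (prod1 act u v) (n + m - 1)).
  by rewrite loop_lbr.unlock loopU.unlock loop_br_pure /X (linD pi_linear) (linZ pi_linear).
rewrite prod0E prod1E.
rewrite (linD (mode_linear (n + m))).
by rewrite mA.unlock mB.unlock.
Qed.

Lemma dhat_linear : linear (@dhat k A g).
Proof.
apply: tlift_linear; split=> [p|a]; apply: linear_add.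
- apply: linear_comp ((tpure_bilin _ _).1 p) _; apply: linear_comp inB_linear _.
  apply: linear_comp (@inKd_linear k A g) _; exact: (kd_kaehlerian A).1.2.
- exact: linear_comp ((tpure_bilin _ _).1 _) inA_linear.
- exact: (tpure_bilin _ _).2.
- apply: linear_comp ((tpure_bilin _ _).2 _) _; exact: free_lift_linear.
Qed.

Lemma dhat_pure a n : dhat g (tpure a (tpow k n)) =
  loopU (inB (kB 1 a)) n + n%:~R *: loopU (inA a) (n - 1).
Proof.
rewrite loopU.unlock.
apply: etrans (tliftE _ _ _) _.
  split=> [p|c]; apply: linear_add.
  - apply: linear_comp ((tpure_bilin _ _).1 p) _; apply: linear_comp inB_linear _.
    apply: linear_comp (@inKd_linear k A g) _; exact: (kd_kaehlerian A).1.2.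
  - exact: linear_comp ((tpure_bilin _ _).1 _) inA_linear.
  - exact: (tpure_bilin _ _).2.
  - apply: linear_comp ((tpure_bilin _ _).2 _) _; exact: free_lift_linear.
by rewrite /ddt free_liftU (linZ ((tpure_bilin _ _).2 _)) kB.unlock.
Qed.

Lemma mB_partial a n : mB (kB 1 a) n = - (n%:~R *: mA a (n - 1)).
Proof.
apply/eqP; rewrite -subr_eq0 opprK; apply/eqP.
have : pi (dhat g (tpure a (tpow k n))) = 0.
  apply: (quo_pi0 (range (@dhat k A g)) _).2; apply: sub_lspan.
  by exists (tpure a (tpow k n)).
by rewrite dhat_pure (linD pi_linear) (linZ pi_linear) loopU.unlock mA.unlock mB.unlock.
Qed.

Lemma dhat_span (S : set (tens A (laurent k))) : submodule S ->
  (forall a n, S (tpure a (tpow k n))) -> forall x, S x.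
Proof.
move=> sS St; apply: tens_span => // a p; move: p; apply: malg_span => [|n]; last exact: St.
exact: submodule_preim ((tpure_bilin _ _).2 a) _ sS.
Qed.

Let lb_dhat_l z y : lb (dhat g z) y = 0.
Proof.
move: z; apply: dhat_span => [|a n].
  apply: linear_eq_submodule; last exact: linear_null.
  exact: linear_comp (lb_l y) dhat_linear.
rewrite /mkset; move: y; apply: loop_span => [|v m].
  by apply: linear_eq_submodule; [exact: lb_r|exact: linear_null].
rewrite /mkset dhat_pure (linD (lb_l _)) (linZ (lb_l _)) !lb_pure /=.
have a0 c : banchor act 0 c = 0 by exact: lin0 ((banchor_bilin act).1 c).
have b0 w : bbr act 0 w = 0 by exact: lin0 ((bbr_bilin act).1 w).
have p0 w : bpair act 0 w = 0 by exact: lin0 ((bpair_bilin act).1 w).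
rewrite banchor_k kB1_bracket a0 b0 p0 bpairC kB1_pair.
rewrite !(lin0 ((banchor_bilin act).2 _)) subr0 !sub0r !(lin0 (mA_linear _)).
rewrite !(lin0 (mB_linear _)) scaler0 !addr0 add0r (linN (mA_linear _)) scalerN.
have -> : n - 1 + m = n + m - 1 by ring.
by rewrite subrr.
Qed.

(** On the left, two terms with coefficients n and -n cancel directly. Here the bracket produces a
    new exact differential, and its coefficient -(m+n), obtained from [mB_partial], cancels m from
    the pairing and n from the derivative of t^n. *)
Let lb_dhat_r x z : lb x (dhat g z) = 0.
Proof.
move: z; apply: dhat_span => [|a n].
  apply: linear_eq_submodule; last exact: linear_null.
  exact: linear_comp (lb_r x) dhat_linear.
rewrite /mkset; move: x; apply: loop_span => [|v m].
  by apply: linear_eq_submodule; [exact: lb_l|exact: linear_null].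
rewrite /mkset dhat_pure (linD (lb_r _)) (linZ (lb_r _)) !lb_pure /=.
have a0 c : banchor act 0 c = 0 by exact: lin0 ((banchor_bilin act).1 c).
have b0 w : bbr act w 0 = 0 by exact: lin0 ((bbr_bilin act).2 w).
have p0 w : bpair act w 0 = 0 by exact: lin0 ((bpair_bilin act).2 w).
rewrite banchor_k a0 b0 p0 kB1_pair kB1_anchor !subr0.
rewrite !(lin0 ((banchor_bilin act).2 _)) !(lin0 (mA_linear _)).
rewrite !(lin0 (mB_linear _)) scaler0 !addr0 add0r mB_partial.
have -> : m + (n - 1) = m + n - 1 by ring.
by rewrite -addrA -scalerDl -intrD addNr.
Qed.

Local Notation lbr := (lbr act).

Let lbrE x y : lbr (pi x) (pi y) = lb x y.
Proof.
rewrite lbr.unlock loop_lbr.unlock; apply: quo_bilinE; first exact: loop_br_bilin.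
  move=> _ w [z _ <-]; apply: (quo_pi0 (range (@dhat k A g)) _).1.
  by have := lb_dhat_l z w; rewrite loop_lbr.unlock.
move=> w _ [z _ <-]; apply: (quo_pi0 (range (@dhat k A g)) _).1.
by have := lb_dhat_r w z; rewrite loop_lbr.unlock.
Qed.

Lemma lbr_bilin : bilin lbr.
Proof.
split=> [y|x] c; [move: y|move: x]; apply: quo_ind => w.
  by apply: quo_ind => x; apply: quo_ind => y; rewrite -pi_linear !lbrE lb_l.
by apply: quo_ind => x; apply: quo_ind => y; rewrite -pi_linear !lbrE lb_r.
Qed.

Lemma lbr_mode u n v m : lbr (mode u n) (mode v m) =
  mA (banchor act u.2 v.1 - banchor act v.2 u.1) (n + m) + mB (bbr act u.2 v.2) (n + m)
  + n%:~R *: mA (bpair act u.2 v.2) (n + m - 1).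
Proof.
have e w l : mode w l = pi (loopU w l) by rewrite loopU.unlock.
by rewrite !e lbrE lb_pure.
Qed.

Let a0 c : banchor act 0 c = 0. Proof. exact: lin0 ((banchor_bilin act).1 c). Qed.
Let a0r c : banchor act c 0 = 0. Proof. exact: lin0 ((banchor_bilin act).2 c). Qed.
Let b0 w : bbr act 0 w = 0. Proof. exact: lin0 ((bbr_bilin act).1 w). Qed.
Let b0r w : bbr act w 0 = 0. Proof. exact: lin0 ((bbr_bilin act).2 w). Qed.
Let p0 w : bpair act 0 w = 0. Proof. exact: lin0 ((bpair_bilin act).1 w). Qed.
Let p0r w : bpair act w 0 = 0. Proof. exact: lin0 ((bpair_bilin act).2 w). Qed.

Lemma lbr_AA a n a' m : lbr (mA a n) (mA a' m) = 0.
Proof.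
rewrite {1 2}mA.unlock lbr_mode /= !a0 b0 p0 subrr !(lin0 (mA_linear _)) (lin0 (mB_linear _)).
by rewrite scaler0 !addr0.
Qed.

Lemma lbr_AB a n b m : lbr (mA a n) (mB b m) = - mA (banchor act b a) (n + m).
Proof.
rewrite {1}mA.unlock {1}mB.unlock lbr_mode /= !a0 b0 p0 sub0r (linN (mA_linear _)).
by rewrite (lin0 (mA_linear _)) (lin0 (mB_linear _)) scaler0 !addr0.
Qed.

Lemma lbr_BA b n a m : lbr (mB b n) (mA a m) = mA (banchor act b a) (n + m).
Proof.
rewrite {1}mA.unlock {1}mB.unlock lbr_mode /= !a0 b0r p0r subr0.
by rewrite (lin0 (mA_linear _)) (lin0 (mB_linear _)) scaler0 !addr0.
Qed.

Lemma lbr_BB b n b' m : lbr (mB b n) (mB b' m) =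
  mB (bbr act b b') (n + m) + n%:~R *: mA (bpair act b b') (n + m - 1).
Proof. by rewrite {1 2}mB.unlock lbr_mode /= !a0r subrr (lin0 (mA_linear _)) add0r. Qed.

(** * The derivations T_m of the mode algebra *)

Variable d : g -> A.
Hypothesis hd : lie_derivation act d.

Definition vir_beta (m : int) : k := zbin k (m + 1) 2.

Lemma vir_betaE m : vir_beta m = ((m + 1) * m)%:~R / 2%:R.
Proof.
rewrite /vir_beta /zbin !big_ord_recr big_ord0 /= mul1r subr0; congr (_ / _).
by rewrite intrM; congr (_ * _); rewrite -[1%:R]/(1%:~R) -intrB addrK.
Qed.

(* The right side of the commutator formula for [L(m), u(n)], using L(0) = 0, L(1) = 0 on A
   and L(0) = 1, L(1) = blam on B. *)
Let Tm (m : int) (u : AB) (n : int) : calL A g :=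
  - ((n + m + 1)%:~R *: mA u.1 (n + m)) - n%:~R *: mB u.2 (n + m)
  + vir_beta m *: mA (blam act d u.2) (n + m - 1).

Let Tm_linear m n : linear (fun u => Tm m u n).
Proof.
apply: linear_add; first apply: linear_sub.
- apply: linear_opp; apply: linear_scale; exact: linear_comp (mA_linear _) l1.
- apply: linear_scale; exact: linear_comp (mB_linear _) l2.
- apply: linear_scale; apply: linear_comp (mA_linear _) _.
  exact: linear_comp (blam_linear hd) l2.
Qed.

Let TF m (u : AB) (p : laurent k) : calL A g := free_lift (fun n => Tm m u n) p.

Let TF_bilin m : bilin (TF m).
Proof.
split=> [p|u]; last exact: free_lift_linear.
by apply: free_lift_linr => n; exact: Tm_linear.
Qed.

Let Tl m : loop -> calL A g := tlift (TF m).

Let Tl_linear m : linear (Tl m). Proof. exact: tlift_linear. Qed.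

Let Tl_pure m u n : Tl m (loopU u n) = Tm m u n.
Proof. by rewrite loopU.unlock; apply: etrans (tliftE (TF_bilin m) _ _) _; exact: free_liftU. Qed.

(** The mode n of the differential of a goes to n(n+m) a(n+m-1), and n a(n-1) goes to the opposite;
    [blam] contributes nothing as it kills differentials. *)
Let Tl_dhat m s : range (@dhat k A g) s -> Tl m s = 0.
Proof.
move=> [z _ <-]; move: z; apply: dhat_span => [|a n].
  apply: linear_eq_submodule; last exact: linear_null.
  exact: linear_comp (Tl_linear m) dhat_linear.
rewrite /mkset dhat_pure (linD (Tl_linear m)) (linZ (Tl_linear m)) !Tl_pure /Tm /=.
rewrite !(lin0 (mA_linear _)) !(lin0 (mB_linear _)) !scaler0 !subr0 oppr0 !sub0r.
rewrite (blam_k hd) (lin0 (blam_linear hd)) !(lin0 (mA_linear _)) !scaler0 !addr0.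
rewrite mB_partial scalerN opprK scalerN.
have -> : n - 1 + m = n + m - 1 by ring.
by rewrite !scalerA -scalerBl -!intrM -intrB (_ : _ - _ = 0) ?scale0r //; ring.
Qed.

Lemma mode_der_ex (m : int) : {T : calL A g -> calL A g | linear T &
  (forall a n, T (mA a n) = - ((n + m + 1)%:~R *: mA a (n + m))) /\
  (forall b n, T (mB b n) = - (n%:~R *: mB b (n + m)) +
     vir_beta m *: mA (blam act d b) (n + m - 1))}.
Proof.
exists (quo_lift (Tl m)); first exact: quo_lift_linear (Tl_linear m) (@Tl_dhat m).
split=> [a|b] n.
  have -> : mA a n = pi (loopU (inA a) n) by rewrite mA.unlock loopU.unlock.
  apply: etrans (quo_liftE _ (Tl_linear m) (@Tl_dhat m)) _.
  rewrite Tl_pure /Tm /= (lin0 (blam_linear hd)) (lin0 (mA_linear _)) (lin0 (mB_linear _)).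
  by rewrite !scaler0 subr0 addr0.
have -> : mB b n = pi (loopU (inB b) n) by rewrite mB.unlock loopU.unlock.
apply: etrans (quo_liftE _ (Tl_linear m) (@Tl_dhat m)) _.
by rewrite Tl_pure /Tm /= (lin0 (mA_linear _)) scaler0 oppr0 sub0r.
Qed.

Section ModeDerivation.
Variables (m : int) (T : calL A g -> calL A g).
Hypothesis lT : linear T.
Hypothesis TA : forall a n, T (mA a n) = - ((n + m + 1)%:~R *: mA a (n + m)).
Hypothesis TB : forall b n, T (mB b n) = - (n%:~R *: mB b (n + m)) +
     vir_beta m *: mA (blam act d b) (n + m - 1).

(** For two elements of B the terms with [vir_beta] agree by [blam_br], and the pairing terms by
    n(n+n'+m) = n(n+m) + nn'. *)
Lemma mode_der_br x y : T (lbr x y) = lbr (T x) y + lbr x (T y).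
Proof.
have [ll lr] := lbr_bilin.
move: x; apply: calL_span => [|a n|b n].
- apply: linear_eq_submodule; first exact: linear_comp lT (ll y).
  by apply: linear_add; [exact: linear_comp (ll y) lT|exact: ll].
- rewrite /mkset; move: y; apply: calL_span => [|a' n'|b' n'].
  + apply: linear_eq_submodule; first exact: linear_comp lT (lr _).
    by apply: linear_add; [exact: lr|exact: linear_comp (lr _) lT].
  + rewrite /mkset !TA (linN (ll _)) (linN (lr _)) (linZ (ll _)) (linZ (lr _)) !lbr_AA.
    by rewrite !scaler0 oppr0 addr0 (lin0 lT).
  + rewrite /mkset TA TB (linN (ll _)) (linZ (ll _)) (linD (lr _)) (linN (lr _)) !(linZ (lr _)).
    rewrite !lbr_AB lbr_AA scaler0 addr0 (linN lT) TA !scalerN !opprK.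
    have -> : n + m + n' = n + n' + m by ring.
    have -> : n + (n' + m) = n + n' + m by ring.
    by rewrite -scalerDl -intrD; congr (_%:~R *: _); ring.
- rewrite /mkset; move: y; apply: calL_span => [|a' n'|b' n'].
  + apply: linear_eq_submodule; first exact: linear_comp lT (lr _).
    by apply: linear_add; [exact: lr|exact: linear_comp (lr _) lT].
  + rewrite /mkset TA TB (linN (lr _)) (linZ (lr _)) (linD (ll _)) (linN (ll _)) !(linZ (ll _)).
    rewrite !lbr_BA lbr_AA scaler0 addr0 TA.
    have -> : n + m + n' = n + n' + m by ring.
    have -> : n + (n' + m) = n + n' + m by ring.
    by rewrite -opprD -scalerDl -intrD; congr (- (_%:~R *: _)); ring.
  + rewrite /mkset !TB (linD (lr _)) (linN (lr _)) !(linZ (lr _)).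
    rewrite (linD (ll _)) (linN (ll _)) !(linZ (ll _)).
    rewrite !lbr_BB lbr_BA lbr_AB (linD lT) (linZ lT) TA TB (blam_br hd).
    rewrite (linB (mA_linear _)).
    have -> : n + m + n' = n + n' + m by ring.
    have -> : n + (n' + m) = n + n' + m by ring.
    have -> : n + m - 1 + n' = n + n' + m - 1 by ring.
    have -> : n + (n' + m - 1) = n + n' + m - 1 by ring.
    have -> : n + n' - 1 + m = n + n' + m - 1 by ring.
    set e1 := mB _ _; set e2 := mA _ _; set e3 := mA _ _; set e4 := mA _ _.
    rewrite !(scalerDr, scalerN, scalerA) !opprD.
    rewrite [RHS](AC (3*3) ((1*4)*(6*3)*(2*5))) /= -!opprD -!scalerDl -!intrM -!intrD.
    by rewrite addrA; congr (_ + _ - _%:~R *: _); ring.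
Qed.

(** The one term that could change parity is [blam] on a tensor with odd second factor, and it
    vanishes. *)
Lemma mode_der_par p x : calL_par p x -> calL_par p (T x).
Proof.
have sP q : submodule (@calL_par k A g q) by exact: lspan_submodule.
apply: (lspan_preim lT (sP p)) => {}x [u [n [pu ->]]].
have inP q v l : AB_par q v -> calL_par q (mode v l).
  by move=> qv; apply: sub_lspan; exists v, l.
have inPA c l : calL_par false (mA c l).
  rewrite mA.unlock; apply: inP; apply: sub_lspan; rewrite /setU /mkset.
  by left; left; split=> //; exists c.
have lTm : linear (fun v => T (mode v n)) by exact: linear_comp lT (mode_linear n).
apply: (lspan_preim lTm (sP p) _ pu) => {pu}u; rewrite /setU /mkset.
case=> [[[np [a ->]]|[a [y [py ->]]]]|[np [w ->]]].
- case: p np => // _.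
  have -> : mode (inA a) n = mA a n by rewrite mA.unlock.
  rewrite TA; apply: (submoduleN (sP _)). by apply: (submoduleZ _ (sP _)); exact: inPA.
- have -> : mode (inB (inAg (tpure a y))) n = mB (gB a y) n by rewrite mB.unlock gB.unlock.
  rewrite TB; apply: (submoduleD (sP _)).
    apply: (submoduleN (sP _)); apply: (submoduleZ _ (sP _)).
    rewrite mB.unlock gB.unlock; apply: inP; apply: sub_lspan; rewrite /setU /mkset.
    by left; right; exists a, y.
  apply: (submoduleZ _ (sP _)); case: p py => py; last exact: inPA.
  rewrite (blam_g hd) (lie_act_odd _ _ py) (lie_der_even hd py) mulr0 addr0.
  by rewrite (lin0 (mA_linear _)); case: (sP true).
- case: p np => // _.
  have -> : mode (inB (inKd g w)) n = mB (inKd g w) n by rewrite mB.unlock.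
  rewrite TB; apply: (submoduleD (sP _)).
    apply: (submoduleN (sP _)); apply: (submoduleZ _ (sP _)).
    rewrite mB.unlock; apply: inP; apply: sub_lspan; rewrite /setU /mkset.
    by right; split=> //; exists w.
  by apply: (submoduleZ _ (sP _)); exact: inPA.
Qed.

(** Whenever an index would drop below 0, its coefficient vanishes: n + m = -1 makes n + m + 1 = 0
    on A and forces n = 0 on B, while [vir_beta] is 0 for m = -1 and m = 0. *)
Lemma mode_der_nonneg x : -1 <= m -> calL_nonneg x -> calL_nonneg (T x).
Proof.
move=> m1.
have sN : submodule (@calL_nonneg k A g) by exact: lspan_submodule.
have inA' c l : 0 <= l -> calL_nonneg (mA c l).
  by move=> l0; rewrite mA.unlock; apply: sub_lspan; exists (inA c), l.
have inB' c l : 0 <= l -> calL_nonneg (mB c l).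
  by move=> l0; rewrite mB.unlock; apply: sub_lspan; exists (inB c), l.
apply: (lspan_preim lT sN) => _ [u [n [n0 ->]]]; rewrite mode_split (linD lT) TA TB.
apply: (submoduleD sN); last apply: (submoduleD sN).
- apply: (submoduleN sN); have [->|nm] := eqVneq (n + m + 1) 0.
    by rewrite scale0r; case: sN.
  by apply: (submoduleZ _ sN); apply: inA'; lia.
- apply: (submoduleN sN); have [->|nm] := eqVneq n 0.
    by rewrite scale0r; case: sN.
  by apply: (submoduleZ _ sN); apply: inB'; lia.
- have [m0|m0] := leP m 0.
    rewrite vir_betaE (_ : (m + 1) * m = 0) ?mul0r ?scale0r; first by case: sN.
    by apply/eqP; rewrite mulf_eq0; lia.
  by apply: (submoduleZ _ sN); apply: inA'; lia.
Qed.

End ModeDerivation.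

Lemma mode_der_vir (T : int -> calL A g -> calL A g) :
  (forall m, linear (T m)) ->
  (forall m a n, T m (mA a n) = - ((n + m + 1)%:~R *: mA a (n + m))) ->
  (forall m b n, T m (mB b n) = - (n%:~R *: mB b (n + m)) +
     vir_beta m *: mA (blam act d b) (n + m - 1)) ->
  forall m n x, T m (T n x) = T n (T m x) + (m - n)%:~R *: T (m + n) x.
Proof.
move=> lT TA TB m n; apply: calL_span => [|a l|b l].
- apply: linear_eq_submodule; first exact: linear_comp.
  by apply: linear_add; [exact: linear_comp|exact: linear_scale].
- rewrite /mkset !TA !(linN (lT _)) !(linZ (lT _)) !TA !scalerN !opprK !scalerA.
  have -> : l + m + n = l + (m + n) by ring.
  have -> : l + n + m = l + (m + n) by ring.
  by rewrite -scalerBl -!intrM -intrB; congr (_%:~R *: _); ring.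
- rewrite /mkset !TB !(linD (lT _)) !(linN (lT _)) !(linZ (lT _)) !TB !TA.
  have -> : l + m + n = l + (m + n) by ring.
  have -> : l + n + m = l + (m + n) by ring.
  have -> : l + n - 1 + m = l + (m + n) - 1 by ring.
  have -> : l + m - 1 + n = l + (m + n) - 1 by ring.
  set e1 := mB _ _; set e2 := mA _ _.
  rewrite !(scalerDr, scalerN, scalerA) !opprD !opprK.
  (* Separates the coefficients of [e1] and [e2]; the second condition is then a polynomial identity
     for the numbers C(m+1, 2). *)
  have lin2 (u v : calL A g) (a1 a2 a3 b1 b2 b3 b4 b5 : k) : a1 = b1 - b4 ->
      a2 + a3 = b2 + b3 - b5 -> a1 *: u - a2 *: v - a3 *: v =
      b1 *: u - b2 *: v - b3 *: v - b4 *: u + b5 *: v.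
    move=> -> e; rewrite -addrA -opprD -scalerDl e !scalerBl scalerDl opprB opprD.
    by rewrite [LHS](AC (2*(1*2)) ((((1*4)*5)*2)*3)).
  rewrite !addrA; apply: lin2; first by ring.
  by rewrite !vir_betaE; ring.
Qed.

End ModeAlgebra.

Lemma eigen_free (k : fieldType) (char0 : forall n : nat, n.+1%:R != 0 :> k)
  (V : lmodType k) (h : V -> V) : linear h ->
  forall (s : seq int) (f : int -> V), uniq s -> (forall i, h (f i) = i%:~R *: f i) ->
  \sum_(i <- s) f i = 0 -> forall i, i \in s -> f i = 0.
Proof.
move=> lh; elim=> // i0 s IH f /andP[i0s us] hf s0.
have IH' i : i \in s -> f i = 0.
  (* [h - i0] kills [f i0] and rescales every other [f j] by j - i0, so the induction hypothesis
     applies to the shorter list. *)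
  move=> si; pose f' j := (j - i0)%:~R *: f j.
  have : f' i = 0.
    apply: (IH f') => // [j|]; first by rewrite /f' (linZ lh) hf !scalerA mulrC.
    have e : h (\sum_(j <- i0 :: s) f j) - i0%:~R *: \sum_(j <- i0 :: s) f j =
        \sum_(j <- i0 :: s) f' j.
      rewrite (lin_sum lh) scaler_sumr -sumrB; apply: eq_bigr => j _.
      by rewrite hf -scalerBl -intrB.
    by move: e; rewrite s0 (lin0 lh) scaler0 subrr big_cons /f' subrr scale0r add0r => <-.
  move=> /eqP; rewrite /f' scaler_eq0 => /orP[|/eqP //].
  have ne : i - i0 != 0 by rewrite subr_eq0; apply: contraNneq i0s => <-.
  suff /negbTE -> : (i - i0)%:~R != 0 :> k by [].
  case: (i - i0) ne => [[//|n]|n] _; first exact: char0.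
  by rewrite NegzE mulrNz oppr_eq0; exact: char0.
move=> i; rewrite in_cons => /orP[/eqP ->|]; last exact: IH'.
by move: s0; rewrite big_cons big_seq big1 ?addr0.
Qed.

(** * The semi-conformal structure *)

(* X, V and I stand for the Lie superalgebra of modes, for V_L and for I_B.  They are
   variables here because unification on the concrete quotients does not terminate in
   practice. *)
Section SemiConformal.
Variables (k : fieldType) (A : comAlg k) (B X V : lmodType k).
Variables (Bpar : bool -> set B) (star : A -> B -> B) (anchor : B -> A -> A).
Variables (bbr : B -> B -> B) (bpair : B -> B -> A) (lam : B -> A) (dA : A -> B).
Variables (mA : A -> int -> X) (mB : B -> int -> X) (act : X -> V -> V).
Variables (par : bool -> set V) (one : V) (Y : V -> int -> V -> V).
Variables (T : int -> X -> X) (L : int -> V -> V).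

Hypothesis char0 : forall n : nat, n.+1%:R != 0 :> k.
Hypothesis HV : vertex_superalgebra par one Y.
Hypotheses (mA_lin : forall n, linear (mA^~ n)) (mB_lin : forall n, linear (mB^~ n)).
Hypotheses (star_lin : forall a, linear (star a)) (lam_lin : linear lam).
Hypothesis Bpar_span : forall S : set B, submodule S -> (forall p b, Bpar p b -> S b) ->
  forall b, S b.
Hypothesis star_par : forall p a b, Bpar p b -> Bpar p (star a b).
Hypothesis lam_odd : forall b, Bpar true b -> lam b = 0.
Hypothesis lam_star : forall a b, lam (star a b) = anchor b a + a * lam b.
Hypothesis act_bil : bilin act.
Hypothesis X_span : forall S : set X, submodule S -> (forall a n, S (mA a n)) ->
  (forall b n, S (mB b n)) -> forall x, S x.
Hypothesis V_span : forall S : set V, submodule S -> S one ->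
  (forall x v, S v -> S (act x v)) -> forall v, S v.

Let ia (a : A) : V := act (mA a (-1)) one.
Let ib (b : B) : V := act (mB b (-1)) one.

Hypotheses (Y_A : forall a n v, Y (ia a) n v = act (mA a n) v)
           (Y_B : forall b n v, Y (ib b) n v = act (mB b n) v).
Hypotheses (parA : forall a, par false (ia a)) (parB : forall p b, Bpar p b -> par p (ib b)).
Hypotheses (vacA : forall a n, 0 <= n -> act (mA a n) one = 0)
           (vacB : forall b n, 0 <= n -> act (mB b n) one = 0).
Hypothesis commAA : forall a n a' m v,
  act (mA a n) (act (mA a' m) v) = act (mA a' m) (act (mA a n) v).
Hypothesis commAB : forall a n b m v, act (mA a n) (act (mB b m) v) =
  act (mB b m) (act (mA a n) v) - act (mA (anchor b a) (n + m)) v.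
Hypothesis commBB : forall p q b n b' m v, Bpar p b -> Bpar q b' ->
  act (mB b n) (act (mB b' m) v) = act (mB (bbr b b') (n + m)) v +
    n%:~R *: act (mA (bpair b b') (n + m - 1)) v +
    (-1) ^+ (p && q) *: act (mB b' m) (act (mB b n) v).
Hypothesis mB_dA : forall a n, mB (dA a) n = - (n%:~R *: mA a (n - 1)).
Hypothesis T_lin : forall m, linear (T m).
Hypothesis TA : forall m a n, T m (mA a n) = - ((n + m + 1)%:~R *: mA a (n + m)).
Hypothesis TB : forall m b n, T m (mB b n) = - (n%:~R *: mB b (n + m)) +
     vir_beta k m *: mA (lam b) (n + m - 1).
Hypothesis T_vir : forall m n x, T m (T n x) = T n (T m x) + (m - n)%:~R *: T (m + n) x.
Hypothesis L_lin : forall m, linear (L m).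
Hypothesis L_one : forall m, -1 <= m -> L m one = 0.
Hypothesis L_act : forall m x v, -1 <= m -> L m (act x v) = act (T m x) v + act x (L m v).

Local Notation D := (Dop one Y).

Let actl v : linear (act^~ v). Proof. exact: act_bil.1. Qed.
Let actr x : linear (act x). Proof. exact: act_bil.2. Qed.
Let amA_lin n v : linear (fun a => act (mA a n) v).
Proof. exact: linear_comp (actl v) (mA_lin n). Qed.
Let amB_lin n v : linear (fun b => act (mB b n) v).
Proof. exact: linear_comp (actl v) (mB_lin n). Qed.
Let ia_lin : linear ia. Proof. exact: amA_lin. Qed.
Let ib_lin : linear ib. Proof. exact: amB_lin. Qed.

Lemma act_stable (S' : set V) v : submodule S' ->
  (forall a n, S' (act (mA a n) v)) -> (forall p b n, Bpar p b -> S' (act (mB b n) v)) ->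
  forall x, S' (act x v).
Proof.
move=> sS' SA SB; apply: X_span => //; first exact: submodule_preim (actl v) _ sS'.
move=> b n; move: b; apply: Bpar_span; first exact: submodule_preim (amB_lin n v) _ sS'.
by move=> p b pb; exact: SB pb.
Qed.

(** Induction over the generation of V that keeps track of parity, so that P may use the Borcherds
    identity. *)
Lemma hom_span (P : bool -> set V) : P false one ->
  (forall a n q v, P q v -> P q (act (mA a n) v)) ->
  (forall p b n q v, Bpar p b -> P q v -> P (p (+) q) (act (mB b n) v)) ->
  forall v, lspan [set v | exists p, P p v] v.
Proof.
move=> P1 PA PB; have sS := lspan_submodule [set v | exists p, P p v].
apply: V_span => // [|x v Sv]; first by apply: sub_lspan; exists false.
apply: (lspan_preim (actr x) sS _ Sv) => {Sv}v [q Pv]; move: x.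
apply: act_stable => // [a n|p b n pb]; apply: sub_lspan.
  by exists q; exact: PA.
by exists (p (+) q); exact: PB.
Qed.

(** * L(m) on generators and the Virasoro relations on V_L *)

Lemma L_A m a n v : -1 <= m ->
  L m (act (mA a n) v) = - ((n + m + 1)%:~R *: act (mA a (n + m)) v) + act (mA a n) (L m v).
Proof. by move=> m1; rewrite L_act // TA (linN (actl v)) (linZ (actl v)). Qed.

Lemma L_B m b n v : -1 <= m -> L m (act (mB b n) v) =
  - (n%:~R *: act (mB b (n + m)) v) + vir_beta k m *: act (mA (lam b) (n + m - 1)) v
  + act (mB b n) (L m v).
Proof.
by move=> m1; rewrite L_act // TB (linD (actl v)) (linN (actl v)) !(linZ (actl v)).
Qed.

(** For m > 0 the index m - 1 is nonnegative and kills the vacuum; for m = 0 the coefficient n + m +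
    1 vanishes at n = -1. *)
Lemma L_ia m a : 0 <= m -> L m (ia a) = 0.
Proof.
move=> m0; rewrite L_A; last by lia.
rewrite L_one ?(lin0 (actr _)) ?addr0; last by lia.
have [->|mn0] := eqVneq m 0; first by rewrite addr0 subrr scale0r oppr0.
by rewrite vacA ?scaler0 ?oppr0 //; lia.
Qed.

Lemma L_ib m b : 0 <= m ->
  L m (ib b) = if m == 0 then ib b else if m == 1 then ia (lam b) else 0.
Proof.
move=> m0; rewrite L_B; last by lia.
rewrite L_one ?(lin0 (actr _)) ?addr0; last by lia.
rewrite vir_betaE; case: eqVneq => [->|mn0].
  by rewrite mulr0 mul0r scale0r !addr0 mulrNz scaleN1r opprK.
rewrite vacB ?scaler0 ?oppr0 ?add0r; last by lia.
case: eqVneq => [->|mn1]; last by rewrite vacA ?scaler0 //; lia.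
by rewrite mulr1 divff ?scale1r // ; exact: (char0 1).
Qed.

(** Both operators kill the vacuum, and T_(-1) sends the mode u(n) to -n u(n-1), which is the
    commutator of D with it by [D_Y]. *)
Lemma L_D v : L (-1) v = D v.
Proof.
move: v; apply: V_span => [||x v e].
- by apply: linear_eq_submodule => //; exact: Dop_linear HV.
- by rewrite /mkset L_one // (D_one HV).
- move: x; apply: X_span => [|a n|b n]; rewrite /mkset.
  + apply: linear_eq_submodule; first exact: linear_comp (L_lin _) (actl v).
    exact: linear_comp (Dop_linear HV) (actl v).
  + rewrite L_A // -(Y_A a n v) (D_Y char0 HV) -e !Y_A addrC subrK.
    by congr (_ - _ *: _); rewrite addrK.
  + rewrite L_B // -(Y_B b n v) (D_Y char0 HV) -e !Y_B /vir_beta addNr zbin0 //.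
    by rewrite scale0r addr0 addrC.
Qed.

Lemma L_vir m n v : -1 <= m -> -1 <= n ->
  L m (L n v) = L n (L m v) + (m - n)%:~R *: L (m + n) v.
Proof.
(* The case m = n = -1 would lead to L(-2), where [L_act] gives no information; its coefficient m -
   n is zero. *)
move=> m1 n1; have [->|mn] := eqVneq m n; first by rewrite subrr scale0r addr0.
have mn1 : -1 <= m + n by move/eqP: mn; lia.
move: v; apply: V_span => [||x v e]; rewrite /mkset.
- apply: linear_eq_submodule; first exact: linear_comp.
  by apply: linear_add; [exact: linear_comp|exact: linear_scale].
- by rewrite !(L_one, lin0 (L_lin _)) // scaler0 addr0.
- rewrite !(L_act, linD (L_lin _)) // e T_vir (linD (actl v)) (linZ (actl v)).
  rewrite (linD (actr x)) (linZ (actr x)) scalerDr.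
  by rewrite [LHS](AC ((2*1)*(1*2)) ((1*4*(3*5))*(2*6))) /=.
Qed.

(** * The commutator formula on V_L *)

Let K (M : nat) : V -> V := L (M%:Z - 1).

Let K1 (M : nat) : -1 <= M%:Z - 1 :> int. Proof. by lia. Qed.

Let K_lin M : linear (K M). Proof. exact: L_lin. Qed.

Lemma K0 v : K 0 v = D v. Proof. by rewrite /K sub0r L_D. Qed.

Lemma sum_bin3 M (f : nat -> V) : (forall j, (2 < j)%N -> f j = 0) ->
  \sum_(j < M.+1) 'C(M, j)%:R *: f j = f 0%N + M%:R *: f 1%N + 'C(M, 2)%:R *: f 2%N.
Proof.
move=> f0; have MM : (M.+1 <= M.+3)%N by lia.
rewrite (big_ord_widen _ (fun j => 'C(M, j)%:R *: f j) MM) big_mkcond.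
rewrite (eq_bigr (fun j : 'I_M.+3 => 'C(M, j)%:R *: f j)); last first.
  by move=> j _; case: ltnP => // h; rewrite bin_small ?scale0r.
rewrite !big_ord_recl big1 => [|j _]; last by rewrite f0 ?scaler0.
by rewrite /= bin0 bin1 scale1r addr0 addrA.
Qed.

Lemma conf_comm_A a : conf_comm Y K (ia a).
Proof.
move=> M n w; rewrite Y_A {1}/K L_A ?K1 // addrC Y_A; congr (_ + _).
rewrite (@sum_bin3 M (fun j => Y (K j (ia a)) (n + M%:Z - j%:Z) w)) => [|j j2].
  rewrite K0 [K 1 _]L_ia // [K 2 _]L_ia // !(lin0 (Yl HV _ _)) !scaler0 !addr0.
  rewrite (Y_D char0 HV) Y_A.
  by congr (- (_%:~R *: act (mA _ _) _)); lia.
by rewrite /K L_ia ?(lin0 (Yl HV _ _)) //; lia.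
Qed.

Lemma conf_comm_B b : conf_comm Y K (ib b).
Proof.
move=> M n w; rewrite Y_B {1}/K L_B ?K1 // addrC Y_B; congr (_ + _).
rewrite (@sum_bin3 M (fun j => Y (K j (ib b)) (n + M%:Z - j%:Z) w)) => [|j j2].
  rewrite K0 [K 1 _]L_ib // [K 2 _]L_ib // (Y_D char0 HV) /= !Y_B Y_A.
  have -> : n + M%:Z - 0%:Z = n + M%:Z by lia.
  have -> : n + M%:Z - 1%:Z = n + (M%:Z - 1) by lia.
  rewrite /vir_beta subrK zbin_nat //.
  have -> : n + (M%:Z - 1) - 1 = n + M%:Z - 2 by lia.
  congr (_ + _); rewrite -!scaleNr -scalerDl; congr (_ *: _).
  by rewrite intrD opprD subrK.
rewrite /K L_ib; last by lia.
have -> : (j%:Z - 1 == 0) = false by apply/eqP; lia.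
have -> : (j%:Z - 1 == 1) = false by apply/eqP; lia.
exact: lin0 (Yl HV _ _).
Qed.

Lemma conf_comm_all v : conf_comm Y K v.
Proof.
(* The parities of all [K j v] belong to the invariant, because [conf_comm_prod] compares signs for
   them. *)
pose P p v := [/\ par p v, (forall j, par p (K j v)) & conf_comm Y K v].
suff: lspan [set v | exists p, P p v] v.
  apply: lspan_min => [|u [p []] //]; split=> [M n w|c x y cx cy M n w].
    rewrite !(lin0 (Yl HV _ _)) (lin0 (K_lin _)) big1 ?addr0 // => j _.
    by rewrite (lin0 (K_lin _)) (lin0 (Yl HV _ _)) scaler0.
  rewrite !(Yl HV) (K_lin _) cx cy scalerDr addrACA scaler_sumr -big_split.
  congr (_ + _); apply: eq_bigr => j _ /=.
  by rewrite (K_lin _) (Yl HV) scalerDr !scalerA mulrC.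
have par_0 p : par p 0 by case: (par_sub HV p).
have prod p q u l w : P p u -> P q w -> P (p (+) q) (Y u l w).
  move=> [pu pKu cu] [qw qKw cw]; split; first exact: (vx_par HV).
    move=> j; rewrite cu; apply: (submoduleD (par_sub HV _)); first exact: (vx_par HV).
    apply: (submodule_sum _ (par_sub HV _)) => i _.
    by apply: (submoduleZ _ (par_sub HV _)); exact: (vx_par HV).
  exact: (conf_comm_prod char0 HV K_lin l pu qw pKu qKw cu cw).
have PA a : P false (ia a).
  split=> // [j|]; last exact: conf_comm_A.
  case: j => [|j]; last by rewrite /K L_ia //; lia.
  by rewrite K0; exact: (vx_par HV _ (parA a) (vx_one_par HV)).
have PB p b : Bpar p b -> P p (ib b).
  move=> pb; split=> [|j|]; [exact: parB|idtac|exact: conf_comm_B].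
  case: j => [|j].
    by rewrite K0 -[p]addbF; exact: (vx_par HV _ (parB pb) (vx_one_par HV)).
  rewrite /K L_ib; last by lia.
  case: ifP => _; first exact: parB; case: ifP => _ //.
  by case: p pb => pb; [rewrite lam_odd // (lin0 ia_lin)|exact: parA].
apply: hom_span.
- split=> [|j|M n w]; first exact: (vx_one_par HV).
    by rewrite /K L_one.
  rewrite !(vx_one HV) big1 => [|j _]; last by rewrite /K L_one // (lin0 (Yl HV _ _)) scaler0.
  by rewrite addr0; case: ifP => // _; exact: lin0 (K_lin _).
- by move=> a n q w Pw; rewrite -Y_A -[q]addFb; exact: prod.
- by move=> p b n q w pb Pw; rewrite -Y_B; apply: prod => //; exact: PB.
Qed.

Let Erel (v : V) : Prop := [\/ v = ia 1 - one,
  exists a a', v = act (mA a (-1)) (ia a') - ia (a * a')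
  | exists a b, v = act (mA a (-1)) (ib b) - ib (star a b)].

(* Words in negative modes applied to the vacuum, together with their degree. *)
Inductive negword : int -> V -> Prop :=
| NegOne : negword 0 one
| NegA a n e v : n < 0 -> negword e v -> negword (e - n - 1) (act (mA a n) v)
| NegB p b n e v : n < 0 -> Bpar p b -> negword e v -> negword (e - n) (act (mB b n) v).

Definition negspan (e : int) : set V := lspan (negword e).

Lemma negspan_sub e : submodule (negspan e). Proof. exact: lspan_submodule. Qed.

Lemma negspan_A a n e v : n < 0 -> negspan e v -> negspan (e - n - 1) (act (mA a n) v).
Proof.
move=> n0; apply: (lspan_preim (actr _) (negspan_sub _)) => w ew.
by apply: sub_lspan; exact: NegA.
Qed.

Lemma negspan_B b n e v : n < 0 -> negspan e v -> negspan (e - n) (act (mB b n) v).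
Proof.
move=> n0 ev; move: b; apply: Bpar_span.
  exact: submodule_preim (amB_lin n v) _ (negspan_sub _).
move=> p b pb; move: v ev; apply: (lspan_preim (actr _) (negspan_sub _)) => w ew.
by apply: sub_lspan; exact: NegB pb ew.
Qed.

(** A nonnegative mode is moved to the right until it meets the vacuum. Commutators preserve total
    degree, and the single modes they produce act on the shorter word, where the induction
    hypothesis covers modes of every index. *)
Lemma negspan_act e v : negspan e v ->
  (forall a n, negspan (e - n - 1) (act (mA a n) v)) /\
  (forall b n, negspan (e - n) (act (mB b n) v)).
Proof.
have z i : negspan i 0 by case: (negspan_sub i).
suff h w : negword e w -> (forall a n, negspan (e - n - 1) (act (mA a n) w)) /\
    (forall p b n, Bpar p b -> negspan (e - n) (act (mB b n) w)).
  move=> ev; split=> [a n|b n].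
    move: v ev; apply: (lspan_preim (actr _) (negspan_sub _)) => w /h [wA _]; exact: wA.
  move: b; apply: Bpar_span; first exact: submodule_preim (amB_lin n v) _ (negspan_sub _).
  move=> p b pb; move: v ev; apply: (lspan_preim (actr _) (negspan_sub _)) => w /h [_ wB].
  exact: wB pb.
elim=> [|a n {}e {}w n0 ew [IA IB]|p b n {}e {}w n0 pb ew [IA IB]].
- have h1 : negspan 0 one by apply: sub_lspan; exact: NegOne.
  split=> [a n|p b n pb]; have [n0|n0] := ltP n 0.
  + by apply: negspan_A.
  + by rewrite vacA.
  + exact: negspan_B.
  + by rewrite vacB.
- have ew' : negspan (e - n - 1) (act (mA a n) w) by apply: sub_lspan; exact: NegA.
  split=> [a' m|p b m pb]; have [m0|m0] := ltP m 0.
  + by apply: negspan_A.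
  + rewrite commAA (_ : _ - m - 1 = (e - m - 1) - n - 1); last by ring.
    by apply: negspan_A => //; exact: IA.
  + exact: negspan_B.
  + have := commAB a n b m w => /(congr1 (fun t => t + act (mA (anchor b a) (n + m)) w)).
    rewrite subrK => <-; apply: (submoduleD (negspan_sub _)).
      rewrite (_ : _ - m = (e - m) - n - 1); last by ring.
      by apply: negspan_A => //; exact: IB pb.
    by rewrite (_ : _ - m = e - (n + m) - 1); [exact: IA|ring].
- have ew' : negspan (e - n) (act (mB b n) w) by apply: sub_lspan; exact: NegB pb ew.
  split=> [a' m|q b' m qb]; have [m0|m0] := ltP m 0.
  + by apply: negspan_A.
  + rewrite commAB; apply: (submoduleB (negspan_sub _)).
      rewrite (_ : _ - m - 1 = (e - m - 1) - n); last by ring.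
      by apply: negspan_B => //; exact: IA.
    by rewrite (_ : e - n - m - 1 = e - (m + n) - 1); [exact: IA|ring].
  + exact: negspan_B.
  + rewrite (commBB _ _ _ qb pb); apply: (submoduleD (negspan_sub _)).
      have hB : forall c l, negspan (e - l) (act (mB c l) w).
        move=> c l; move: c; apply: Bpar_span => [|r c rc]; last exact: IB rc.
        exact: submodule_preim (amB_lin l w) _ (negspan_sub _).
      apply: (submoduleD (negspan_sub _)).
        by rewrite (_ : e - n - m = e - (m + n)); [exact: hB|ring].
      apply: (submoduleZ _ (negspan_sub _)).
      by rewrite (_ : e - n - m = e - (m + n - 1) - 1); [exact: IA|ring].
    apply: (submoduleZ _ (negspan_sub _)).
    rewrite (_ : _ - m = (e - m) - n); last by ring.
    by apply: negspan_B => //; exact: IB qb.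
Qed.

Lemma negword_ge0 e v : negword e v -> 0 <= e.
Proof. by elim=> //; lia. Qed.

Lemma negspan_lt0 e v : e < 0 -> negspan e v -> v = 0.
Proof.
move=> e0; apply: (lspan_min (submodule_set0 V)) => w /negword_ge0.
by move: e0; case: ltP => //; lia.
Qed.

Lemma negspan_L0 e v : negspan e v -> L 0 v = e%:~R *: v.
Proof.
apply: (lspan_eq_linear (L_lin 0)) => [c x y|w]; first by rewrite scalerDr !scalerA mulrC.
elim=> [|a n {}e {}v n0 ev IH|p b n {}e {}v n0 pb ev IH].
- by rewrite L_one // scale0r.
- rewrite L_A // IH (linZ (actr _)) addr0 -scaleNr -scalerDl; congr (_ *: _).
  by rewrite -intrN -intrD; congr (_%:~R); ring.
- rewrite L_B // IH (linZ (actr _)) addr0 /vir_beta add0r.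
  rewrite (_ : zbin k 1 2 = 0); last by rewrite (zbin_nat char0 1).
  rewrite scale0r addr0 -scaleNr -scalerDl; congr (_ *: _).
  by rewrite -intrN -intrD; congr (_%:~R); ring.
Qed.

(** Requiring the components to vanish from N on allows two decompositions to be added over a common
    range. *)
Lemma negspan_total v : exists (N : nat) (f : int -> V),
  [/\ forall i, negspan i (f i), forall i : nat, (N <= i)%N -> f i%:Z = 0
    & v = \sum_(i < N) f i%:Z].
Proof.
have ext (f : int -> V) (N N' : nat) : (N <= N')%N ->
    (forall i : nat, (N <= i)%N -> f i%:Z = 0) -> \sum_(i < N) f i%:Z = \sum_(i < N') f i%:Z.
  move=> NN f0; rewrite (big_ord_widen _ (fun i : nat => f i%:Z) NN) big_mkcond.
  by apply: eq_bigr => i _; case: ltnP => // /f0.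
pose W : set V := [set v | exists (N : nat) (f : int -> V),
  [/\ forall i, negspan i (f i), forall i : nat, (N <= i)%N -> f i%:Z = 0
    & v = \sum_(i < N) f i%:Z]].
suff: lspan [set v | exists e, negspan e v] v.
  apply: (@lspan_min _ _ _ W) => [|w [e ew]].
    split.
      exists 0%N, (fun=> 0); split=> [i|//|]; first by case: (negspan_sub i).
      by rewrite big_ord0.
    move=> c x y [N [f [fN f0 ->]]] [N' [f' [fN' f0' ->]]].
    exists (N + N')%N, (fun i => c *: f i + f' i); split=> [i|i hi|].
    - by apply: (negspan_sub i).2.
    - by rewrite f0 ?f0' ?scaler0 ?addr0 //; lia.
    - rewrite (ext f N (N + N')%N) ?leq_addr // (ext f' N' (N + N')%N) ?leq_addl //.
      by rewrite scaler_sumr -big_split.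
  have [e0|e0] := ltP e 0.
    exists 0%N, (fun=> 0); split=> [i|//|]; first by case: (negspan_sub i).
    by rewrite big_ord0 (negspan_lt0 e0 ew).
  exists (absz e).+1, (fun i => if i == e then w else 0); split=> [i|i hi|].
  - by case: eqP => [->//|_]; case: (negspan_sub i).
  - by case: eqP => // h; lia.
  - rewrite (sum_single (j := absz e) (F := fun i : nat => if i%:Z == e then w else 0)) //.
      by case: eqP => // h; lia.
    by move=> i /eqP h; case: eqP => // h'; lia.
have sS := lspan_submodule [set v : V | exists e, negspan e v].
move: v; apply: V_span => // [|x v Sv].
  by apply: sub_lspan; exists 0; apply: sub_lspan; exact: NegOne.
move: v Sv; apply: (lspan_preim (actr x) sS) => v [e ev]; have [vA vB] := negspan_act ev.
move: x; apply: X_span => [|a n|b n]; first exact: submodule_preim (actl v) _ sS.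
  by apply: sub_lspan; exists (e - n - 1).
by apply: sub_lspan; exists (e - n).
Qed.

(** * The ideal I_B *)

Section Quotient.
Variable I : set V.
Local Notation J := (lspan I).
Hypothesis J_iter : forall e j, Erel e -> J (iter j D e).
Hypothesis J_act : forall x v, J v -> J (act x v).
Hypothesis J_min : forall S : set V, submodule S -> (forall x v, S v -> S (act x v)) ->
  (forall e j, Erel e -> S (iter j D e)) -> forall v, J v -> S v.

Let sJ : submodule J. Proof. exact: lspan_submodule. Qed.

(** Since D = L(-1) is a derivation over T_(-1), the vectors of J whose image under D stays in J
    form a submodule stable under the action; it contains the generators D^j e. *)
Lemma J_D v : J v -> J (D v).
Proof.
suff h : J v -> J v /\ J (D v) by case/h.
apply: (J_min (S := [set v | J v /\ J (D v)])) => [|x w [Jw JDw]|e j Ee].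
- split=> [|c x y [Jx JDx] [Jy JDy]]; first by rewrite /mkset (lin0 (Dop_linear HV)); case: sJ.
  by split; [|rewrite (Dop_linear HV)]; apply: sJ.2.
- split; first exact: J_act.
  by rewrite -L_D L_act // L_D; apply: (submoduleD sJ); exact: J_act.
- by split; [exact: J_iter|exact: (J_iter j.+1)].
Qed.

(** The three kinds of relators have weights 0, 0 and 1. Positive m kills them, except that L(1)
    sends the third relator of [a], [b] to the second relator of [a], [lam b]. *)
Lemma Erel_L m e : 0 <= m -> Erel e -> J (L m e).
Proof.
move=> m0 Ee; have J0 : J 0 by case: sJ.
have m1 : -1 <= m by lia.
case: (Ee) => [->|[a [a' ->]]|[a [b ->]]]; rewrite (linB (L_lin m)).
- by rewrite L_ia // L_one // subr0.
- rewrite [L m (ia (_ * _))]L_ia // subr0 L_A // L_ia // (lin0 (actr _)) addr0.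
  have [->|mn0] := eqVneq m 0; first by rewrite addr0 addNr scale0r oppr0.
  by rewrite commAA vacA ?(lin0 (actr _)) ?scaler0 ?oppr0 //; lia.
- rewrite L_A // !L_ib //; have [->|mn0] := eqVneq m 0.
    by rewrite addr0 addNr scale0r oppr0 add0r; apply: (J_iter 0); constructor 3; exists a, b.
  rewrite /ib commAB (vacA a); last by lia.
  rewrite (lin0 (actr _)) sub0r; case: eqVneq => [->|mn1]; last first.
    by rewrite vacA ?(lin0 (actr _)) ?oppr0 ?scaler0 ?oppr0 ?addr0 ?subr0 //; lia.
  have -> : (-1 + 1 + 1)%:~R = 1 :> k by [].
  rewrite scale1r opprK lam_star (linD ia_lin).
  rewrite -/(ia _) opprD addrACA subrr add0r.
  by apply: (J_iter 0); constructor 2; exists a, (lam b).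
Qed.

(** Proved for all indices at once: in the induction on the power of D, moving L(n) past D leaves
    (n+1) L(n-1) on the lower power. *)
Lemma J_L m v : -1 <= m -> J v -> J (L m v).
Proof.
move=> m1; suff h : J v -> J v /\ forall m, -1 <= m -> J (L m v) by case/h => _; exact.
apply: (J_min (S := [set v | J v /\ forall m, -1 <= m -> J (L m v)])) => [|x w [Jw JLw]|e j Ee].
- split=> [|c x y [Jx JLx] [Jy JLy]].
    by split=> [|n n1]; rewrite ?(lin0 (L_lin _)); case: sJ.
  by split=> [|n n1]; rewrite ?(L_lin n); apply: sJ.2 => //; [exact: JLx|exact: JLy].
- split=> [|n n1]; first exact: J_act.
  by rewrite L_act //; apply: (submoduleD sJ); apply: J_act => //; exact: JLw.
- split; first exact: J_iter.
  elim: j => [|j IH] n n1 /=.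
    have [n0|n0] := leP 0 n; first exact: Erel_L.
    have -> : n = -1 by lia.
    by rewrite L_D; exact: (J_iter 1 Ee).
  have [n0|n0] := leP 0 n; last first.
    have -> : n = -1 by lia.
    by rewrite L_D; exact: (J_iter j.+2 Ee).
  rewrite -L_D L_vir //; apply: (submoduleD sJ).
    by rewrite L_D; apply: J_D; exact: IH.
  by apply: (submoduleZ _ sJ); apply: IH; lia.
Qed.

(** Modes of generators preserve J by hypothesis; the iterate formula passes this on to their
    products, hence to all of V. *)
Lemma J_Yr u n v : J v -> J (Y u n v).
Proof.
move=> Jv; pose P p w := par p w /\ forall n v, J v -> J (Y w n v).
suff: lspan [set w | exists p, P p w] u.
  apply: (lspan_preim (Yl HV n v) sJ) => w [p [_ h]]; exact: h.
apply: (@hom_span P) => [|a m q w [qw Jw]|p b m q w pb [qw Jw]].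
- split=> [|m w Jw]; first exact: (vx_one_par HV).
  by rewrite (vx_one HV); case: ifP => // _; case: sJ.
- rewrite -Y_A; split; first by rewrite -[q]addFb; exact: (vx_par HV).
  apply: (iterate_stable char0 HV _ sJ (parA a) qw) => // j x Jx.
  by rewrite Y_A; exact: J_act.
- rewrite -Y_B; split; first by apply: (vx_par HV) => //; exact: parB.
  apply: (iterate_stable char0 HV _ sJ (parB pb) qw) => // j x Jx.
  by rewrite Y_B; exact: J_act.
Qed.

(** For a homogeneous [D^j e] this is skew-symmetry applied to [J_Yr]; acting by modes keeps the
    property by [iterate_ideal], and [J_min] then covers J. *)
Lemma J_Yl v n w : J v -> J (Y v n w).
Proof.
move=> Jv; pose P p x := par p x /\ forall n w, J (Y x n w).
have sS := lspan_submodule [set x | exists p, P p x].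
suff: lspan [set x | exists p, P p x] v.
  apply: (lspan_preim (Yl HV n w) sJ) => x [p [_ h]]; exact: h.
have par_iter p e j : par p e -> par p (iter j D e).
  move=> pe; elim: j => //= j IH; rewrite -[p]addbF.
  exact: (vx_par HV _ IH (vx_one_par HV)).
have hom p e j : par p e -> Erel e -> lspan [set x | exists p, P p x] (iter j D e).
  move=> pe Ee; apply: sub_lspan; exists p; split; first exact: par_iter.
  move=> l x; apply: (right_ideal_left char0 HV sJ J_D J_Yr l x (par_iter _ _ _ pe)).
  exact: J_iter.
apply: (J_min sS) v Jv => [x v Sv|e j Ee].
  move: x; apply: act_stable => // [a l|p b l pb].
    move: v Sv; apply: (lspan_preim (actr _) sS) => y [q [qy Jy]].
    rewrite -Y_A; apply: sub_lspan; exists q; split.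
      by rewrite -[q]addFb; exact: (vx_par HV).
    apply: (iterate_ideal char0 HV _ sJ (parA a) qy) => // i x Jx.
    by rewrite Y_A; exact: J_act.
  move: v Sv; apply: (lspan_preim (actr _) sS) => y [q [qy Jy]].
  rewrite -Y_B; apply: sub_lspan; exists (p (+) q); split.
    by apply: (vx_par HV) => //; exact: parB.
  apply: (iterate_ideal char0 HV _ sJ (parB pb) qy) => // i x Jx.
  by rewrite Y_B; exact: J_act.
have parAA a p x : par p x -> par p (act (mA a (-1)) x).
  by move=> px; rewrite -Y_A -[p]addFb; exact: (vx_par HV).
case: (Ee) => [e1|[a [a' e1]]|[a [b ->]]].
- apply: (hom false) => //; rewrite e1; apply: (submoduleB (par_sub HV _)) => //.
  exact: (vx_one_par HV).
- apply: (hom false) => //; rewrite e1; apply: (submoduleB (par_sub HV _)) => //.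
  exact: parAA.
(* A relator with arbitrary [b] need not be homogeneous, but it is linear in [b], which reduces it
   to homogeneous [b]. *)
- have lit : linear (fun b => iter j D (act (mA a (-1)) (ib b) - ib (star a b))).
    have lj : linear (iter j D).
      by elim: j => // j IH; exact: linear_comp (Dop_linear HV) IH.
    apply: linear_comp lj _; apply: linear_sub.
      exact: linear_comp (actr _) ib_lin.
    exact: linear_comp ib_lin (star_lin a).
  move: b; apply: Bpar_span; first exact: submodule_preim lit _ sS.
  move=> p b pb; apply: (hom p); last by constructor 3; exists a, b.
  apply: (submoduleB (par_sub HV _)); first by apply: parAA; exact: parB.
  by apply: parB; exact: star_par.
Qed.

(** Degrees 0 and 1 are treated together: removing the leftmost letter of a word of degree 1 leaves
    a word of degree 1 or 0, and the latter reduces to an element of A. *)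
Lemma negspan1_ib v : negspan 1 v -> exists b, J (v - ib b).
Proof.
have J_sub x y z : J (x - y) -> J (y - z) -> J (x - z).
  by move=> h1 h2; rewrite -(subrKA y); exact: (submoduleD sJ).
have J_actB x u w : J (u - w) -> J (act x u - act x w).
  by move=> h; rewrite -(linB (actr x)); exact: J_act.
have J_star a b : J (act (mA a (-1)) (ib b) - ib (star a b)).
  by apply: (J_iter 0); constructor 3; exists a, b.
pose W : set V := [set v | exists b, J (v - ib b)].
apply: (@lspan_min _ _ _ W).
  split=> [|c x y [b xb] [b' yb']].
    by exists 0; rewrite (lin0 ib_lin) subr0; case: sJ.
  exists (c *: b + b'); rewrite ib_lin opprD addrACA -scalerBr.
  exact: sJ.2.
suff h e w : negword e w -> (e = 0 -> exists a, J (w - ia a)) /\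
    (e = 1 -> exists b, J (w - ib b)) by move=> w /h [_]; apply.
elim=> [|a n {}e {}w n0 ew [IA IB]|p b n {}e {}w n0 pb ew [IA IB]].
- split=> // _; exists 1; rewrite -opprB; apply: (submoduleN sJ).
  by apply: (J_iter 0); constructor 1.
- have e0 := negword_ge0 ew; split=> e1.
    have [n1 z] : n = -1 /\ e = 0 by lia.
    have [a' h] := IA z; exists (a * a'); rewrite n1.
    apply: J_sub (J_actB _ _ _ h) _.
    by apply: (J_iter 0); constructor 2; exists a, a'.
  have [[n1 z]|[n1 z]] : (n = -1 /\ e = 1) \/ (n = -2 /\ e = 0) by lia.
    have [b' h] := IB z; exists (star a b'); rewrite n1.
    exact: J_sub (J_actB _ _ _ h) (J_star _ _).
  have [a' h] := IA z; rewrite n1.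
  have -> : mA a (-2) = mB (dA a) (-1).
    by rewrite mB_dA mulrNz scaleN1r opprK.
  (* The relators only describe a(-1) on the left of b(-1). Swapping b(-1)a'(-1) leaves the anchor
     term with index -2, which is again an exact differential; hence the second summand of the
     witness. *)
  have := commAB a' (-1) (dA a) (-1) one => E.
  exists (star a' (dA a) + dA (anchor (dA a) a')).
  apply: J_sub (J_actB _ _ _ h) _; rewrite /ia.
  rewrite -[act (mB _ _) _](subrK (act (mA (anchor (dA a) a') (-1 - 1)) one)).
  rewrite -E (linD ib_lin) opprD addrACA; apply: (submoduleD sJ); first exact: J_star.
  rewrite /ib mB_dA mulrNz scaleN1r opprK subrr; by case: sJ.
- have e0 := negword_ge0 ew; split=> e1; first by lia.
  have [n1 z] : n = -1 /\ e = 0 by lia.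
  have [a' h] := IA z; rewrite n1.
  have := commAB a' (-1) b (-1) one => E.
  exists (star a' b + dA (anchor b a')).
  apply: J_sub (J_actB _ _ _ h) _; rewrite /ia.
  rewrite -[act (mB _ _) _](subrK (act (mA (anchor b a') (-1 - 1)) one)).
  rewrite -E (linD ib_lin) opprD addrACA; apply: (submoduleD sJ); first exact: J_star.
  rewrite /ib mB_dA mulrNz scaleN1r opprK subrr; by case: sJ.
Qed.

(** * The semi-conformal structure on the quotient *)

Local Notation Q := (quo I).
Local Notation pi := (quo_pi I).

Let pi_lin : linear pi. Proof. exact: linearP. Qed.

(** Written in the same form as [VB_Y], so that the abstract result specialises by conversion. *)
Definition quo_Y (u : Q) (n : int) (v : Q) : Q := pi (Y (quo_repr u) n (quo_repr v)).

Lemma quo_YE u n v : quo_Y (pi u) n (pi v) = pi (Y u n v).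
Proof.
have hl s y : I s -> J (Y s n y) by move=> Is; apply: J_Yl; exact: sub_lspan.
have hr x s : I s -> J (Y x n s) by move=> Is; apply: J_Yr; exact: sub_lspan.
exact: (@quo_bilinE k V I (fun u v => Y u n v) (vx_bilin HV n) hl hr u v).
Qed.

Lemma quo_L_ex m : {h : {linear Q -> Q} | -1 <= m -> forall v, h (pi v) = pi (L m v)}.
Proof.
(* Operators with m < -1 are unconstrained; zero is chosen. *)
have [m1|m1] := boolP (-1 <= m); last by exists (GRing.null_fun _).
have lf : linear (pi \o L m) by exact: linear_comp.
have kf s : I s -> (pi \o L m) s = 0.
  by move=> Is; apply/(quo_pi0 I); apply: J_L => //; exact: sub_lspan.
pose h : {linear Q -> Q} := HB.pack (quo_lift (pi \o L m))
  (GRing.isLinear.Build k Q Q *:%R (quo_lift (pi \o L m)) (quo_lift_linear lf kf)).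
by exists h => _ v; exact: (quo_liftE v lf kf).
Qed.

Definition quo_L (m : int) : {linear Q -> Q} := sval (quo_L_ex m).

Lemma quo_LE m v : -1 <= m -> quo_L m (pi v) = pi (L m v).
Proof. by move=> m1; rewrite /quo_L; case: (quo_L_ex m) => h /= ->. Qed.

Lemma quo_weight_total q : exists (N : nat) (f : int -> Q),
  (forall i, L_weight quo_L i (f i)) /\ q = \sum_(i < N) f i%:Z.
Proof.
move: q; apply: quo_ind => v; have [N [f [fn _ ->]]] := negspan_total v.
exists N, (pi \o f); split=> [i|]; last by rewrite (lin_sum pi_lin).
by rewrite /L_weight /mkset /= quo_LE // (negspan_L0 (fn i)) (linZ pi_lin).
Qed.

(** Writing q as a sum of vectors of nonnegative weight gives a relation between -q, of weight -n,
    and eigenvectors for other eigenvalues; independence of eigenvectors kills q. *)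
Lemma quo_weight_neg (n : int) q : 1 <= n -> quo_L 0 q = (- n)%:~R *: q -> q = 0.
Proof.
move=> n1 qn; have [N [f [fw qE]]] := quo_weight_total q.
pose F j := if j == - n then - q else f j.
pose s := - n :: [seq i%:Z | i <- iota 0 N].
apply/eqP; rewrite -oppr_eq0; apply/eqP.
have -> : - q = F (- n) by rewrite /F eqxx.
have ns (i : nat) : (i%:Z == - n) = false by apply/eqP; lia.
apply: (eigen_free char0 (linearP (quo_L 0)) (s := s)).
- rewrite /= map_inj_uniq ?iota_uniq ?andbT; last by move=> i j [].
  by apply/mapP => -[i _ /eqP]; rewrite eq_sym ns.
- move=> j; rewrite /F; case: eqP => [->|_]; last exact: fw.
  by rewrite linearN /= qn scalerN.
- rewrite big_cons big_map {1}/F eqxx.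
  rewrite (eq_bigr (fun i : nat => f i%:Z)) => [|i _]; last by rewrite /F ns.
  have -> : iota 0 N = index_iota 0 N by rewrite /index_iota subn0.
  by rewrite big_mkord -qE addNr.
- by rewrite in_cons eqxx.
Qed.

Lemma quo_span (S : set Q) : submodule S -> S (pi one) ->
  (forall a n w, S w -> S (quo_Y (pi (ia a)) n w)) ->
  (forall b n w, S w -> S (quo_Y (pi (ib b)) n w)) -> forall q, S q.
Proof.
move=> sS S1 SA SB; apply: quo_ind; apply: V_span => // [|x v Sv].
  exact: submodule_preim pi_lin _ sS.
move: x; apply: X_span => [|a n|b n].
- exact: submodule_preim (actl v) _ (submodule_preim pi_lin sS).
- by have := SA a n _ Sv; rewrite quo_YE Y_A.
- by have := SB b n _ Sv; rewrite quo_YE Y_B.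
Qed.

Lemma quo_semi_conformal : semi_conformal (pi one) quo_Y quo_L.
Proof.
split.
- move=> m n m1 n1; apply: quo_ind => v.
  have [->|mn] := eqVneq m n; first by rewrite !subrr scale0r.
  have mn1 : -1 <= m + n by move/eqP: mn; lia.
  rewrite !quo_LE // L_vir // (linD pi_lin) (linZ pi_lin).
  by rewrite addrC addKr.
- split=> [i|v|s f us fw s0 i si].
  + split=> [|c x y]; rewrite /L_weight /mkset ?linear0 ?scaler0 // linearP => -> ->.
    by rewrite scalerDr !scalerA mulrC.
  + have [N [f [fw ->]]] := quo_weight_total v.
    exists [seq i%:Z | i <- iota 0 N], f; split=> //.
    rewrite big_map; have -> : iota 0 N = index_iota 0 N by rewrite /index_iota subn0.
    by rewrite big_mkord.
  + exact: (eigen_free char0 (linearP (quo_L 0)) us fw s0 si).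
- by exists 1 => n n1 q; exact: quo_weight_neg.
- by apply: quo_ind => v; rewrite quo_LE // L_D /Dop quo_YE.
- move=> m n m1; apply: quo_ind => v; apply: quo_ind => w.
  rewrite !(quo_LE, quo_YE) // -(linB pi_lin).
  (* [conf_comm] is indexed by M = m + 1, a natural number. *)
  have mM : m = (absz (m + 1))%:Z - 1 by lia.
  have := conf_comm_all v (absz (m + 1)) n w; rewrite /K -mM => ->.
  rewrite addrC addKr (lin_sum pi_lin); apply: eq_bigr => i _.
  rewrite (linZ pi_lin) quo_LE ?quo_YE; last by lia.
  rewrite -zbin_nat // (_ : (absz (m + 1))%:Z = m + 1); last by lia.
  by rewrite addrA.
Qed.

(** * Uniqueness *)

Lemma quo_one : pi one = pi (ia 1).
Proof.
apply/eqP; rewrite eq_sym -subr_eq0 -(linB pi_lin); apply/eqP/(quo_pi0 I).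
by apply: (J_iter 0); constructor 1.
Qed.

(** The commutator of L(m) with [u_n] involves [L(j) u] only for j from -1 to m, so agreement on A
    and B for these j propagates along words. The vacuum is covered because it equals the unit of A
    in the quotient. *)
Lemma semi_conformal_ext (L1 L2 : int -> {linear Q -> Q}) (m : int) :
  semi_conformal (pi one) quo_Y L1 -> semi_conformal (pi one) quo_Y L2 -> -1 <= m ->
  (forall j a, -1 <= j <= m -> L1 j (pi (ia a)) = L2 j (pi (ia a))) ->
  (forall j b, -1 <= j <= m -> L1 j (pi (ib b)) = L2 j (pi (ib b))) ->
  L1 m =1 L2 m.
Proof.
move=> s1 s2 m1 hA hB.
have step u n w : (forall j, -1 <= j <= m -> L1 j u = L2 j u) -> L1 m w = L2 m w ->
    L1 m (quo_Y u n w) = L2 m (quo_Y u n w).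
  move=> hu hw; have h1 := sc_comm s1 n m1 u w; have h2 := sc_comm s2 n m1 u w.
  apply: (addIr (- quo_Y u n (L1 m w))); rewrite h1 hw h2.
  by apply: eq_bigr => i _; rewrite hu //; have := ltn_ord i; lia.
apply: quo_span => [||a n w|b n w]; rewrite /mkset.
- by apply: linear_eq_submodule; exact: linearP.
- by rewrite quo_one; apply: hA; lia.
- by apply: step => j; exact: hA.
- by apply: step => j; exact: hB.
Qed.

Definition prescribed (L' : int -> {linear Q -> Q}) : Prop :=
  [/\ forall a, L' 0 (pi (ia a)) = 0, forall b, L' 0 (pi (ib b)) = pi (ib b),
      forall a, L' 1 (pi (ia a)) = 0 & forall b, L' 1 (pi (ib b)) = pi (ia (lam b))].

(* L'(0) agrees with L(0), so weights are nonnegative; since L'(m) lowers weights by m, it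
   kills A for m > 0 and B for m > 1. *)
Lemma semi_conformal_unique (L' : int -> {linear Q -> Q}) :
  semi_conformal (pi one) quo_Y L' -> prescribed L' ->
  forall m, -1 <= m -> L' m =1 quo_L m.
Proof.
move=> s' [A0 B0 A1 B1]; have s := quo_semi_conformal.
have N1 v : L' (-1) v = quo_L (-1) v by rewrite (sc_D s') (sc_D s).
have hA0 a : L' 0 (pi (ia a)) = quo_L 0 (pi (ia a)).
  by rewrite A0 quo_LE // L_ia // (lin0 pi_lin).
have hB0 b : L' 0 (pi (ib b)) = quo_L 0 (pi (ib b)) by rewrite B0 quo_LE // L_ib.
have j01 (j : int) : -1 <= j <= 0 -> j = -1 \/ j = 0 by lia.
(* This comes before any weight argument: [quo_weight_neg] concerns [quo_L 0] and becomes available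
   for [L'] only now. *)
have L'0 : L' 0 =1 quo_L 0.
  by apply: semi_conformal_ext => // [j a /j01 []|j b /j01 []] ->.
(* From [L(0), L(m)] = -m L(m), the vector [L' m u] has weight e - m < 0. *)
have weight m (e : int) u : 1 <= m -> L' 0 u = e%:~R *: u -> e < m -> L' m u = 0.
  move=> m1 ue em; apply: (@quo_weight_neg (m - e)); first by lia.
  have mm1 : -1 <= m by lia.
  have := sc_vir s' (m := 0) (n := m) isT mm1 u; rewrite add0r -L'0 => /(canRL (subrK _)) ->.
  rewrite ue (linZ (linearP (L' m))) add0r -scalerDl -intrD.
  by congr (_%:~R *: _); lia.
have hA m a : -1 <= m -> L' m (pi (ia a)) = quo_L m (pi (ia a)).
  move=> m1; have [->|mN1] := eqVneq m (-1); first exact: N1.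
  have [->|m0] := eqVneq m 0; first exact: hA0.
  rewrite (weight m 0) ?A0 ?scale0r //; [|lia|lia].
  by rewrite quo_LE // L_ia ?(lin0 pi_lin) //; lia.
have hB m b : -1 <= m -> L' m (pi (ib b)) = quo_L m (pi (ib b)).
  move=> m1; have [->|mN1] := eqVneq m (-1); first exact: N1.
  have [->|m0] := eqVneq m 0; first exact: hB0.
  rewrite quo_LE // L_ib ?(negbTE m0); last by lia.
  have [->|mn1] := eqVneq m 1; first exact: B1.
  by rewrite (weight m 1) ?B0 ?scale1r ?(lin0 pi_lin) //; lia.
by move=> m m1; apply: semi_conformal_ext => // j u /andP[j1 _]; [exact: hA|exact: hB].
Qed.

Theorem semi_conformal_quotient : exists Lq : int -> {linear Q -> Q},
  [/\ semi_conformal (pi one) quo_Y Lq, prescribed Lq,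
      forall L', semi_conformal (pi one) quo_Y L' -> prescribed L' ->
        forall m, -1 <= m -> L' m =1 Lq m
    & forall v, negspan 1 v -> exists b, pi v = pi (ib b)].
Proof.
exists quo_L; split; [exact: quo_semi_conformal| |exact: semi_conformal_unique|].
  by split=> [a|b|a|b]; rewrite quo_LE // ?L_ia ?L_ib // (lin0 pi_lin).
by move=> v /negspan1_ib [b h]; exists b; apply/(quo_piP I).
Qed.

End Quotient.

End SemiConformal.

(** * The modules V_L and V_B *)

HB.lock Definition vact (k : fieldType) (A : comAlg k) (g : lieSuper k) (act : lieAction g A)
  (x : calL A g) (v : VL act) : VL act := VL_act x v.

Section InducedModule.
Variables (k : fieldType) (A : comAlg k) (g : lieSuper k) (act : lieAction g A).

Local Notation B := (Bmod A g).
Local Notation X := (calL A g).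
Local Notation V := (VL act).
Local Notation one := (VL_one act).
Local Notation vact := (@vact k A g act).
Local Notation mA := (@mA k A g).
Local Notation mB := (@mB k A g).
Local Notation gB := (@gB k A g).
Local Notation kB := (@kB k A g).
Local Notation cpar := (@calL_par k A g).
Local Notation cnn := (@calL_nonneg k A g).
Local Notation cbr := (calL_br act).
Local Notation AB_par := (@AB_par k A g).

Definition bpar (p : bool) : set B :=
  lspan ([set b | exists a x, lie_par p x /\ b = gB a x]
         `|` [set b | ~~ p /\ exists a c, b = kB a c]).

Lemma bpar_sub p : submodule (bpar p). Proof. exact: lspan_submodule. Qed.

Lemma bpar_g p a x : lie_par p x -> bpar p (gB a x).
Proof. by move=> px; apply: sub_lspan; rewrite /setU /mkset; left; exists a, x. Qed.

Lemma bpar_k a c : bpar false (kB a c).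
Proof. by apply: sub_lspan; rewrite /setU /mkset; right; split=> //; exists a, c. Qed.

Lemma bpar_ind p (S : set B) : submodule S -> (forall a x, lie_par p x -> S (gB a x)) ->
  (~~ p -> forall a c, S (kB a c)) -> forall b, bpar p b -> S b.
Proof.
move=> sS Sg Sk; apply: lspan_min => // b; rewrite /setU /mkset.
by case=> [[a [x [px ->]]]|[np [a [c ->]]]]; [exact: Sg|exact: Sk].
Qed.

Lemma bpar_span (S : set B) : submodule S -> (forall p b, bpar p b -> S b) -> forall b, S b.
Proof.
move=> sS Sp; apply: B_span => // a x; last by apply: (Sp false); exact: bpar_k.
move: x; apply: lie_par_span => [|p x px]; last by apply: (Sp p); exact: bpar_g.
exact: submodule_preim ((gB_bilin A g).2 a) _ sS.
Qed.

Lemma bpar_star p a b : bpar p b -> bpar p (bstar act a b).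
Proof.
have kl := (kB_kaehlerian A g).1.
move: b; apply: bpar_ind => [|a' x px|np a' c].
- exact: submodule_preim (bstar_linear act a) _ (bpar_sub p).
- rewrite bstar_g; case: p px => px.
    by rewrite !(lie_act_odd _ _ px) !(lin0 (kl.1 _)) !addr0; exact: bpar_g.
  apply: (submoduleD (bpar_sub _)); last exact: bpar_k.
  by apply: (submoduleD (bpar_sub _)); [exact: bpar_g|exact: bpar_k].
- by rewrite bstar_k; case: p np => // _; exact: bpar_k.
Qed.

Lemma AB_par_A a : AB_par false (inA g a).
Proof. by apply: sub_lspan; rewrite /setU /mkset; left; left; split=> //; exists a. Qed.

Lemma AB_par_B p b : bpar p b -> AB_par p (inB b).
Proof.
have sP : submodule (AB_par p) by exact: lspan_submodule.
move: b; apply: bpar_ind => [|a x px|np a c].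
- exact: submodule_preim (@inB_linear k A g) _ sP.
- rewrite gB.unlock; apply: sub_lspan; rewrite /setU /mkset.
  by left; right; exists a, x.
- rewrite kB.unlock; apply: sub_lspan; rewrite /setU /mkset.
  by right; split=> //; exists (kd a c).
Qed.

Lemma cpar_A a n : cpar false (mA a n).
Proof.
by rewrite mA.unlock; apply: sub_lspan; exists (inA g a), n; split=> //; exact: AB_par_A.
Qed.

Lemma cpar_B p b n : bpar p b -> cpar p (mB b n).
Proof.
by move=> pb; rewrite mB.unlock; apply: sub_lspan; exists (inB b), n; split=> //; exact: AB_par_B.
Qed.

Lemma cnn_A a n : 0 <= n -> cnn (mA a n).
Proof. by move=> n0; rewrite mA.unlock; apply: sub_lspan; exists (inA g a), n. Qed.

Lemma cnn_B b n : 0 <= n -> cnn (mB b n).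
Proof. by move=> n0; rewrite mB.unlock; apply: sub_lspan; exists (inB b), n. Qed.

Lemma vactE : vact = fun x v => @iact k X cpar cbr cnn (env_in cpar cbr x) v.
Proof. by rewrite vact.unlock iact.unlock. Qed.

Lemma vact_bilin : bilin vact.
Proof. by rewrite vactE; exact: act_bilin. Qed.

Lemma vact_nonneg x : cnn x -> vact x one = 0.
Proof. by rewrite vactE; exact: act_one0. Qed.

Lemma vact_span (S : set V) : submodule S -> S one ->
  (forall x v, S v -> S (vact x v)) -> forall v, S v.
Proof. by rewrite vactE; exact: ind_span. Qed.

Lemma vact_br p q x y v : cpar p x -> cpar q y ->
  vact x (vact y v) = vact (lbr act x y) v + (-1) ^+ (p && q) *: vact y (vact x v).
Proof. by rewrite vactE lbr.unlock; exact: act_br. Qed.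

Let vl v : linear (vact^~ v). Proof. exact: vact_bilin.1. Qed.
Let vr x : linear (vact x). Proof. exact: vact_bilin.2. Qed.

Lemma vact_AA a n a' m v :
  vact (mA a n) (vact (mA a' m) v) = vact (mA a' m) (vact (mA a n) v).
Proof.
rewrite (vact_br v (cpar_A a n) (cpar_A a' m)) lbr_AA (lin0 (vl v)) add0r.
by rewrite andbF expr0 scale1r.
Qed.

Lemma vact_AB a n b m v : vact (mA a n) (vact (mB b m) v) =
  vact (mB b m) (vact (mA a n) v) - vact (mA (banchor act b a) (n + m)) v.
Proof.
move: b; apply: bpar_span => [|p b pb].
  apply: linear_eq_submodule.
    apply: linear_comp (vr _) _; exact: linear_comp (vl v) (mB_linear _).
  apply: linear_sub; first exact: linear_comp (vl _) (mB_linear _).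
  apply: linear_comp (vl v) _.
  have h1 := @mA_linear k A g (n + m); have h2 := (banchor_bilin act).1 a.
  exact: (linear_comp h1 h2).
rewrite /mkset (vact_br v (cpar_A a n) (cpar_B m pb)) lbr_AB (linN (vl v)).
by rewrite expr0 scale1r addrC.
Qed.

Lemma vact_BB p q b n b' m v : bpar p b -> bpar q b' ->
  vact (mB b n) (vact (mB b' m) v) = vact (mB (bbr act b b') (n + m)) v +
    n%:~R *: vact (mA (bpair act b b') (n + m - 1)) v +
    (-1) ^+ (p && q) *: vact (mB b' m) (vact (mB b n) v).
Proof.
move=> pb qb; rewrite (vact_br v (cpar_B n pb) (cpar_B m qb)) lbr_BB.
by rewrite (linD (vl v)) (linZ (vl v)).
Qed.

Lemma VL_in_A a : VL_in act (inA g a) = vact (mA a (-1)) one.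
Proof. by rewrite vact.unlock mA.unlock. Qed.

Lemma VL_in_B b : VL_in act (inB b) = vact (mB b (-1)) one.
Proof. by rewrite vact.unlock mB.unlock. Qed.

Lemma VL_par_letter p x : cpar p x -> VL_par p (vact x one).
Proof.
move=> px; rewrite vact.unlock; apply: sub_lspan; exists [:: (p, x)]; split=> //.
  by move=> y; rewrite inE => /eqP ->.
by rewrite /= addbF.
Qed.

Variable Y : V -> int -> V -> V.
Hypothesis hY : VL_vertex Y.

Lemma VL_Y_A a n v : Y (vact (mA a (-1)) one) n v = vact (mA a n) v.
Proof. by rewrite -VL_in_A hY.2 vact.unlock mA.unlock. Qed.

Lemma VL_Y_B b n v : Y (vact (mB b (-1)) one) n v = vact (mB b n) v.
Proof. by rewrite -VL_in_B hY.2 vact.unlock mB.unlock. Qed.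

Let E (v : V) : Prop := [\/ v = vact (mA 1 (-1)) one - one,
  exists a a', v = vact (mA a (-1)) (vact (mA a' (-1)) one) - vact (mA (a * a') (-1)) one
  | exists a b, v = vact (mA a (-1)) (vact (mB b (-1)) one)
                    - vact (mB (bstar act a b) (-1)) one].

Lemma E_BE v : @E_B k A g act v <-> E v.
Proof.
have aA a w : VL_act (mode (inA g a) (-1)) w = vact (mA a (-1)) w.
  by rewrite vact.unlock mA.unlock.
have st a b : star act a b = bstar act a b by rewrite bstar.unlock.
rewrite /E_B /setU /mkset; split.
  case=> [[->|[a [a' ->]]]|[a [b ->]]]; rewrite ?aA !(VL_in_A, VL_in_B) ?st.
  - by constructor 1.
  - by constructor 2; exists a, a'.
  - by constructor 3; exists a, b.
case=> [->|[a [a' ->]]|[a [b ->]]].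
- by left; left; rewrite VL_in_A.
- by left; right; exists a, a'; rewrite aA !VL_in_A.
- by right; exists a, b; rewrite aA !VL_in_B st.
Qed.

Let UL_iact u v : UL_act u v = @iact k X cpar cbr cnn u v.
Proof. by rewrite iact.unlock. Qed.

Lemma I_B_iter e j : E e -> lspan (I_B Y) (iter j (Dop one Y) e).
Proof.
move=> /E_BE Ee; apply: sub_lspan; exists (env_one cpar cbr), j, e; split=> //.
rewrite UL_iact; exact: (esym (ind_act1 _)).
Qed.

Lemma I_B_act x v : lspan (I_B Y) v -> lspan (I_B Y) (vact x v).
Proof.
apply: (lspan_preim (vr x) (lspan_submodule _)) => _ [u [j [e [Ee ->]]]].
apply: sub_lspan; exists (emul (env_in cpar cbr x) u), j, e; split=> //.
by rewrite !UL_iact ind_actA vactE.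
Qed.

Lemma I_B_min (S : set V) : submodule S -> (forall x v, S v -> S (vact x v)) ->
  (forall e j, E e -> S (iter j (Dop one Y) e)) -> forall v, lspan (I_B Y) v -> S v.
Proof.
rewrite vactE => sS Sx SE; apply: lspan_min => // _ [u [j [e [/E_BE Ee ->]]]].
by rewrite UL_iact; apply: ind_act_stable => //; exact: SE.
Qed.

Local Notation negspan := (@negspan k A B X V bpar mA mB vact one).

(** The grading of V_L allows letters of any index; [negspan_act] rewrites each such word, letter by
    letter, through negative modes of the same total degree. *)
Lemma VL_deg_negspan n v : VL_deg n v -> negspan n v.
Proof.
apply: lspan_min => [|_ [s [hs <- ->]]]; first exact: negspan_sub.
elim: s hs => [|[d x] s IH] hs /=; first by apply: sub_lspan; exact: NegOne.
have {}IH := IH (fun y ys => hs y (mem_behead (s := (d, x) :: s) ys)).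
have := hs (d, x) (mem_head _ _); rewrite /=.
move: IH; set i := foldr _ _ s; set w := foldr _ _ s => iw.
have [wA wB] := negspan_act (@mB_linear k A g) bpar_span vact_bilin
  (fun a n n0 => vact_nonneg (cnn_A a n0)) (fun b n n0 => vact_nonneg (cnn_B b n0))
  vact_AA vact_AB vact_BB iw.
rewrite (_ : VL_act x w = vact x w); last by rewrite vact.unlock.
move: x hs => x _; apply: (lspan_preim (vl w) (negspan_sub _ _ _ _ _ _)) => {}x.
rewrite /setU /mkset => -[[a [m [<- ->]]]|[b [m [<- ->]]]].
  rewrite (_ : mode (inA g a) m = mA a m); last by rewrite mA.unlock.
  by rewrite (_ : - m - 1 + i = i - m - 1); [exact: wA|ring].
rewrite (_ : mode (inB b) m = mB b m); last by rewrite mB.unlock.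
by rewrite addrC; exact: wB.
Qed.

(** * Specialisation to V_L and V_B *)

Variable d : g -> A.
Hypothesis hd : lie_derivation act d.
Hypothesis char0 : forall n : nat, n.+1%:R != 0 :> k.

Local Notation lam := (blam act d).

Lemma VL_L_ex (T : int -> X -> X) : (forall m, linear (T m)) ->
  (forall m a n, T m (mA a n) = - ((n + m + 1)%:~R *: mA a (n + m))) ->
  (forall m b n, T m (mB b n) = - (n%:~R *: mB b (n + m)) +
     vir_beta k m *: mA (lam b) (n + m - 1)) ->
  exists L : int -> V -> V, [/\ forall m, linear (L m),
    forall m, -1 <= m -> L m one = 0
    & forall m x v, -1 <= m -> L m (vact x v) = vact (T m x) v + vact x (L m v)].
Proof.
move=> lT TA TB.
suff /choice [L hL] : forall m, exists D : V -> V, linear D /\ (-1 <= m -> D one = 0 /\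
    forall x v, D (vact x v) = vact (T m x) v + vact x (D v)).
  by exists L; split=> [m|m m1|m x v m1]; have [? h] := hL m => //; case: (h m1).
(* T_m is known to preserve the nonnegative modes only for m >= -1; below that the zero map serves
   as a default. *)
move=> m; have [m1|m1] := boolP (-1 <= m); last first.
  by exists (fun=> 0); split=> // c x y; rewrite scaler0 addr0.
have brT p q x y : cpar p x -> cpar q y -> T m (cbr x y) = cbr (T m x) y + cbr x (T m y).
  by move=> _ _; have := mode_der_br hd (lT m) (TA m) (TB m) x y; rewrite lbr.unlock.
have parT p x : cpar p x -> cpar p (T m x).
  exact: (mode_der_par hd (lT m) (TA m) (TB m)).
have nnT x : cnn x -> cnn (T m x).
  by move=> nx; exact: (mode_der_nonneg (lT m) (TA m) (TB m) m1 nx).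
have [D lD [D1 Dx]] := @ind_der_ex k X cpar cbr cnn (T m) (lT m) parT brT nnT.
by exists D; split=> // _; split=> //; rewrite vactE.
Qed.

(** The last clause identifies the whole degree-one component with the image of B, from which the
    equality of the images under L(1) is immediate. *)
Theorem VB_semi_conformal : exists L : int -> {linear VB Y -> VB Y},
    [/\ semi_conformal (VB_one Y) (VB_Y Y) L,
        L_conditions d L,
        forall L' : int -> {linear VB Y -> VB Y},
          semi_conformal (VB_one Y) (VB_Y Y) L' -> L_conditions d L' ->
          forall m : int, -1 <= m -> L' m =1 L m
      & VB_deg Y 1 = range (VB_inB Y)].
Proof.
have [T hT] : exists T : int -> X -> X, forall m, [/\ linear (T m),
    forall a n, T m (mA a n) = - ((n + m + 1)%:~R *: mA a (n + m))
    & forall b n, T m (mB b n) = - (n%:~R *: mB b (n + m)) +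
     vir_beta k m *: mA (lam b) (n + m - 1)].
  exists (fun m => s2val (mode_der_ex hd m)) => m.
  by case: (mode_der_ex hd m) => T lT [].
have lT m : linear (T m) by case: (hT m).
have TA m : forall a n, T m (mA a n) = - ((n + m + 1)%:~R *: mA a (n + m)) by case: (hT m).
have TB m : forall b n, T m (mB b n) = - (n%:~R *: mB b (n + m)) +
     vir_beta k m *: mA (lam b) (n + m - 1) by case: (hT m).
have [L [lL L1 Lx]] := VL_L_ex lT TA TB.
have lam_odd b : bpar true b -> lam b = 0.
  move: b; apply: bpar_ind => //; first exact: submodule_ker (blam_linear hd).
  move=> a x px; rewrite /mkset (blam_g hd) (lie_act_odd _ _ px) (lie_der_even hd px).
  by rewrite mulr0 addr0.
have [Lq [sc pr un n1]] := @semi_conformal_quotient k A B X V bpar (bstar act) (banchor act)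
  (bbr act) (bpair act) lam (fun a => kB 1 a) mA mB vact (@VL_par k A g act) one Y T L
  char0 hY.1 (@mA_linear k A g) (@mB_linear k A g)
  (bstar_linear act) bpar_span bpar_star lam_odd (blam_star hd) vact_bilin
  (@calL_span k A g) vact_span VL_Y_A VL_Y_B
  (fun a => VL_par_letter (cpar_A a (-1))) (fun p b pb => VL_par_letter (cpar_B (-1) pb))
  (fun a n n0 => vact_nonneg (cnn_A a n0)) (fun b n n0 => vact_nonneg (cnn_B b n0))
  vact_AA vact_AB vact_BB (@mB_partial k A g) TA TB (mode_der_vir lT TA TB) lL L1 Lx
  (I_B Y) I_B_iter I_B_act I_B_min.
have inAE a : VB_inA Y a = quo_pi (I_B Y) (vact (mA a (-1)) one).
  by rewrite /VB_inA VL_in_A.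
have inBE b : VB_inB Y b = quo_pi (I_B Y) (vact (mB b (-1)) one).
  by rewrite /VB_inB VL_in_B.
have lB : linear (VB_inB Y).
  rewrite (_ : VB_inB Y = fun b => quo_pi (I_B Y) (vact (mB b (-1)) one)); last exact/funext.
  apply: linear_comp (quo_pi_is_linear (I_B Y)) _.
  exact: linear_comp (vl one) (mB_linear _).
have lA : linear (VB_inA Y).
  rewrite (_ : VB_inA Y = fun b => quo_pi (I_B Y) (vact (mA b (-1)) one)); last exact/funext.
  apply: linear_comp (quo_pi_is_linear (I_B Y)) _.
  exact: linear_comp (vl one) (@mA_linear k A g (-1)).
exists Lq; split => //.
- case: pr => A0 B0 A1 B1; split=> [a|b|a|w|a x].
  + by rewrite inAE A0.
  + by rewrite inBE B0.
  + by rewrite inAE A1.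
  + by rewrite inBE B1 -inAE (blam_inKd hd) (lin0 lA).
  + by rewrite inBE B1 -inAE; congr (VB_inA Y _); rewrite -(blam_g hd) gB.unlock.
- move=> L' s' [A0 B0 A1 K1 G1]; apply: un => //; split=> [a|b|a|b].
  + by rewrite -inAE A0.
  + by rewrite -inBE B0.
  + by rewrite -inAE A1.
  (* The prescribed values concern pure tensors and differentials; linearity extends them to the
     single formula [L' 1 b = lam b] on B. *)
  + rewrite -inBE -inAE; move: b; apply: B_span => [|a x|a c].
    * apply: linear_eq_submodule; first exact: linear_comp (linearP (L' 1)) lB.
      exact: linear_comp lA (blam_linear hd).
    * by rewrite /mkset (blam_g hd) -G1 gB.unlock.
    * by rewrite /mkset (blam_k hd) (lin0 lA) -(K1 (kd a c)) kB.unlock.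
- apply/seteqP; split=> q.
    move=> [v /VL_deg_negspan/n1 [b hb] <-]; exists b => //.
    by rewrite inBE -hb.
  (* Conversely, an element of B is the one-letter word b(-1), of degree 1. *)
  move=> [b _ <-]; exists (VL_in act (inB b)) => //.
  apply: sub_lspan; exists [:: (1, mode (inB b) (-1))]; split=> //.
  move=> y; rewrite inE => /eqP -> /=; apply: sub_lspan; rewrite /setU /mkset.
  by right; exists b, (-1).
Qed.

End InducedModule.

Local Open Scope complex_scope.

Theorem proposition4p9 (R : realType) (A : comAlg R[i]) (g : lieSuper R[i])
    (act : lieAction g A) (Y : VL act -> int -> VL act -> VL act)
    (hY : VL_vertex Y) (d : g -> A) (hd : lie_derivation act d) :
  exists L : int -> {linear VB Y -> VB Y},
    [/\ semi_conformal (VB_one Y) (VB_Y Y) L,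
        L_conditions d L,
        forall L' : int -> {linear VB Y -> VB Y},
          semi_conformal (VB_one Y) (VB_Y Y) L' -> L_conditions d L' ->
          forall m : int, -1 <= m -> L' m =1 L m
      & L 1 @` VB_deg Y 1 = L 1 @` range (VB_inB Y)].
Proof.
have char0 (n : nat) : n.+1%:R != 0 :> R[i] by rewrite pnatr_eq0.
have [L [sc Lc un deg1]] := VB_semi_conformal hY hd char0.
by exists L; split=> //; rewrite deg1.
Qed.
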